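(* Suppose $\bar V$ is such that the set $\Lambda(\bar V)$ is contained between the lines $\theta=\pm\pi$. Let $F$ be a function such that $$\frac{d}{dt}V^{\mathrm{PLL}}\le F\big(V^{\mathrm{PLL}},V^{\mathrm{CC}}\big)$$ along the solutions of the system $$\dot x=Ax,\qquad \dot\theta=-k_p f(\theta,\omega,x)+\omega,\qquad \dot\omega=-k_i f(\theta,\omega,x).$$ Let $\Phi$ be a non-increasing function on $[0,\bar{\bar V}]$, $\bar{\bar V}>\bar V$, given by $$\Phi(V)=\bar V\quad\text{for all } V\in[0,\bar V]$$ and as a solution to the differential equation $$\Phi'(V)=-\frac{F(\Phi(V),V)}{\gamma V},\qquad \Phi(\bar V)=\bar V$$ on the interval $[\bar V,\bar{\bar V}]$, with $\bar{\bar V}$ such that $\Phi(\bar{\bar V})=0$. Then the set $$\left\{(\theta,\omega,x):\ V^{\mathrm{PLL}}(\theta,\omega)\le\Phi\big(V^{\mathrm{CC}}(x)\big)\right\}$$ is an estimation of the lock-in domain of the origin of the system; that is, this set is forward-invariant and every solution starting in it converges to the origin without crossing the lines $\theta=\pm\pi$.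
   Context: Notation: $\theta,\omega\in\mathbb{R}$, $x\in\mathbb{R}^4$; $A\in\mathbb{R}^{4\times4}$ is Hurwitz; $k_p>0$, $k_i>0$, $\mu\in\mathbb{R}$, $\mu\neq0$, $\nu\in\mathbb{R}^4$ are constants; $$f(\theta,\omega,x)=\frac{g(\theta,\omega)-h(\omega)^T x}{\mu-\nu^T x},$$ where $g:\mathbb{R}^2\to\mathbb{R}$ and $h:\mathbb{R}\to\mathbb{R}^4$ are given smooth functions, $g$ is $2\pi$-periodic in $\theta$, $g(0,0)=0$, the matrix $h(\omega)\nu^T-\nu h(\omega)^T$ does not depend on $\omega$, and $\nabla_x f$ vanishes nowhere on the domain of $f$. The $(\theta,\omega)$-equations are called the PLL, the $x$-equation the CC. Standing assumption: the Jacobian at $(0,0)$ of the PLL with $x=0$ has non-real eigenvalues with negative real parts. $V^{\mathrm{CC}}(x)=x^TPx$, where $P$ is symmetric positive definite and $A^TP+PA+\gamma P$ is negative definite with a fixed $\gamma>0$ (the same $\gamma$ as in the differential equation for $\Phi$); hence $\frac{d}{dt}V^{\mathrm{CC}}\le-\gamma V^{\mathrm{CC}}$ along solutions. For $V\ge0$ such that $\{V^{\mathrm{CC}}(x)\le V\}$ contains no point with $\nu^Tx=\mu$, the $V$-comparison system is $\dot\theta=-k_pf_*(\theta,\omega)+\omega$, $\dot\omega=-k_if_*(\theta,\omega)$, with $$f_*(\theta,\omega)=\begin{cases}\min_{V^{\mathrm{CC}}(x)\le V} f(\theta,\omega,x), & \omega\ge0,\\ \max_{V^{\mathrm{CC}}(x)\le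 V} f(\theta,\omega,x), & \omega<0.\end{cases}$$ Standing assumption: $\bar V>0$ is such that for every $V\in[0,\bar V]$ the $V$-comparison system is defined and has a stable limit cycle going clockwise around the origin (for $V=0$ it reduces to the zero equilibrium), and this limit cycle changes smoothly with $V$ on $[0,\bar V]$. $\Lambda(V)$ denotes the closed region bounded by this limit cycle, and its boundary $\partial\Lambda(V)$ is the limit cycle itself ($\Lambda(0)=\{(0,0)\}$). These limit cycles do not intersect each other, so $\Lambda(V_1)\subset\operatorname{int}\Lambda(V_2)$ for $0\le V_1<V_2\le\bar V$. The function $V^{\mathrm{PLL}}$ is defined on $\Lambda(\bar V)$ by $V^{\mathrm{PLL}}(\theta,\omega)=V$ for all $(\theta,\omega)\in\partial\Lambda(V)$, $V\in[0,\bar V]$; thus $\Lambda(V)=\{V^{\mathrm{PLL}}\le V\}$. The set in the conclusion consists of points where both sides are defined, i.e. $(\theta,\omega)\in\Lambda(\bar V)$ and $V^{\mathrm{CC}}(x)\in[0,\bar{\bar V}]$; the inequality defining $F$ is understood at points with $(\theta,\omega)\in\Lambda(\bar V)$ and $V^{\mathrm{CC}}(x)\le\bar{\bar V}$, and $f$ has no singularities ($\nu^Tx\ne\mu$) there. The lock-in domain of the origin is the set of initial conditions $(\theta,\omega,x)$ from which the solution converges to the origin without crossing the lines $\theta=\pm\pi$. An estimation of the lock-in domain is a forward-invariant set contained in the lock-in domain.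
   Formalization: The bound V̄̄ is taken to be the first zero of Φ, that is, Φ>0 on [V̄,V̄̄); if Φ vanished earlier and stayed zero up to V̄̄, the set would contain points (0,0,x) with f(0,0,x)≠0 and would not be forward-invariant. *)

(* Defs.v *)
(* MathComp-Analysis over an abstract real field R : realType. *)
From HB Require Import structures.
From mathcomp Require Import all_boot all_order all_algebra.
From mathcomp Require Import complex.
From mathcomp Require Import all_classical all_reals all_analysis.

Set Implicit Arguments.
Unset Strict Implicit.
Unset Printing Implicit Defensive.

Import Order.TTheory GRing.Theory Num.Theory.
Import numFieldNormedType.Exports.

Local Open Scope classical_set_scope.
Local Open Scope ring_scope.

(* Derivative of u at t relative to J: two-sided at interior points of J,
   one-sided at an endpoint belonging to J. *)
Definition derive_within (R : realType) (W : normedModType R)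
    (J : set R) (u : R -> W) (t : R) (d : W) : Prop :=
  (fun s => (s - t)^-1 *: (u s - u t)) @ within J t^' --> d.

(* u is of class C^n on the open set D, by means of iterated directional
   derivatives; for maps between finite-dimensional spaces this is the usual
   notion. *)
Fixpoint Ck (R : realType) (V W : normedModType R) (D : set V) (n : nat)
    (u : V -> W) : Prop :=
  (forall q, D q -> {for q, continuous u}) /\
  if n is m.+1 then
    forall v, (forall q, D q -> derivable u q v) /\
              Ck D m (fun q => 'D_v u q)
  else True.

Definition smooth (R : realType) (V W : normedModType R) (u : V -> W) : Prop :=
  forall n, Ck setT n u.

Definition grad (R : realType) (n : nat) (u : 'cV[R]_n.+1 -> R)
    (x : 'cV[R]_n.+1) : 'cV[R]_n.+1 :=
  \col_i 'D_(delta_mx i 0) u x.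

Definition jac2 (R : realType) (u : R * R -> R * R) (q : R * R) : 'M[R]_2 :=
  \matrix_(i < 2, j < 2)
    let d := 'D_(if j == 0 then (1, 0) else (0, 1)) u q in
    if i == 0 then d.1 else d.2.

Definition ceigenvalue (R : realType) (n : nat) (M : 'M[R]_n) (l : R[i]) : bool :=
  eigenvalue (map_mx (real_complex R) M) l.

Definition hurwitz (R : realType) (n : nat) (M : 'M[R]_n) : Prop :=
  forall l, ceigenvalue M l -> complex.Re l < 0.

Definition dot (R : realType) (n : nat) (u v : 'cV[R]_n) : R :=
  (u^T *m v) 0 0.

Definition posdef (R : realType) (n : nat) (M : 'M[R]_n) : Prop :=
  M^T = M /\ forall x : 'cV[R]_n, x != 0 -> 0 < dot x (M *m x).

(* Least and greatest elements of a set; meaningful when they exist. *)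
Definition minimum (R : realType) (E : set R) : R :=
  get [set m | E m /\ lbound E m].
Definition maximum (R : realType) (E : set R) : R :=
  get [set m | E m /\ ubound E m].

(** Planar systems with a possibly discontinuous right-hand side *)

(* The right-hand side of a comparison system jumps across omega = 0, so a
   solution is a continuous curve that satisfies the equation except at a
   locally finite set E of times. *)
Definition pw_solution (R : realType) (X : R * R -> R * R) (J : set R)
    (z : R -> R * R) : Prop :=
  {within J, continuous z} /\
  exists E : set R, (forall a b : R, finite_set (E `&` `[a, b])) /\
    forall t, J t -> ~ E t -> derive_within J z t (X (z t)).

Definition near_set (R : realType) (C : set (R * R)) (e : R) (q : R * R) : Prop :=
  exists2 c, C c & `|q - c| < e.

Definition orbitally_stable (R : realType) (X : R * R -> R * R)
    (C : set (R * R)) : Prop :=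
  (forall e : R, 0 < e -> exists2 d : R, 0 < d &
     forall (tau : R) z, pw_solution X `[0, tau[ z -> near_set C d (z 0) ->
       forall t, 0 <= t < tau -> near_set C e (z t)) /\
  (exists2 d : R, 0 < d &
     forall z, pw_solution X [set t | 0 <= t] z -> near_set C d (z 0) ->
       forall e : R, 0 < e -> \forall t \near +oo, near_set C e (z t)).

(* Clockwise around the origin: a continuous polar angle decreases by 2 pi
   over one period.  The cycle is a limit cycle (isolated among closed orbits)
   because it attracts all neighbouring solutions. *)
Definition stable_clockwise_limit_cycle (R : realType) (X : R * R -> R * R)
    (C : set (R * R)) : Prop :=
  (exists (z : R -> R * R) (T : R),
    [/\ 0 < T,
        pw_solution X setT z,
        forall t, z (t + T) = z t,
        {in `[0, T[ &, injective z} &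
        C = range z] /\
    exists rho phi : R -> R,
      [/\ continuous phi,
          forall t, 0 < rho t,
          forall t, z t = (rho t * cos (phi t), rho t * sin (phi t)) &
          forall t, phi (t + T) = phi t - 2 * pi]) /\
  orbitally_stable X C.

(* The closed region bounded by a closed curve C: the curve together with the
   bounded connected components of its complement. *)
Definition region (R : realType) (C : set (R * R)) : set (R * R) :=
  [set q | C q \/ bounded_set (connected_component (~` C) q)].

(** The system *)

Record pll_cc (R : realType) := PllCc {
  A : 'M[R]_4;
  kp : R;
  ki : R;
  mu : R;
  nu : 'cV[R]_4;
  g : R * R -> R;
  h : R -> 'cV[R]_4;
  gamma : R;
  P : 'M[R]_4
}.

(* Meaningful for dot (nu s) x != mu s only. *)
Definition f (R : realType) (s : pll_cc R) (q : R * R) (x : 'cV[R]_4) : R :=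
  (g s q - dot (h s q.2) x) / (mu s - dot (nu s) x).

Definition pll_rhs (R : realType) (s : pll_cc R) (y : R) (q : R * R) : R * R :=
  (- kp s * y + q.2, - ki s * y).

(* States are ((theta, omega), x). *)
Definition rhs (R : realType) (s : pll_cc R) (z : R * R * 'cV[R]_4) :
    R * R * 'cV[R]_4 :=
  (pll_rhs s (f s z.1 z.2) z.1, A s *m z.2).

Definition VCC (R : realType) (s : pll_cc R) (x : 'cV[R]_4) : R :=
  dot x (P s *m x).

Record standing_assumptions (R : realType) (s : pll_cc R) : Prop := {
  A_hurwitz : hurwitz (A s);
  kp_gt0 : 0 < kp s;
  ki_gt0 : 0 < ki s;
  mu_neq0 : mu s != 0;
  g_smooth : smooth (g s);
  h_smooth : smooth (h s);
  g_periodic : forall theta omega,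
    g s (theta + 2 * pi, omega) = g s (theta, omega);
  g_00 : g s (0, 0) = 0;
  h_nu : forall omega omega',
    h s omega *m (nu s)^T - nu s *m (h s omega)^T =
    h s omega' *m (nu s)^T - nu s *m (h s omega')^T;
  grad_f_neq0 : forall q x, dot (nu s) x != mu s -> grad (f s q) x != 0;
  pll_jacobian : forall l,
    ceigenvalue (jac2 (fun q => pll_rhs s (f s q 0) q) (0, 0)) l ->
    complex.Im l != 0 /\ complex.Re l < 0;
  gamma_gt0 : 0 < gamma s;
  P_posdef : posdef (P s);
  lyapunov_inequality :
    posdef (- ((A s)^T *m P s + P s *m A s + gamma s *: P s))
}.

Definition nonsingular (R : realType) (s : pll_cc R) (V : R) : Prop :=
  forall x, VCC s x <= V -> dot (nu s) x != mu s.

Definition fstar (R : realType) (s : pll_cc R) (V : R) (q : R * R) : R :=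
  if 0 <= q.2 then minimum (f s q @` [set x | VCC s x <= V])
  else maximum (f s q @` [set x | VCC s x <= V]).

Definition comparison_rhs (R : realType) (s : pll_cc R) (V : R) (q : R * R) :
    R * R :=
  pll_rhs s (fstar s V q) q.

(* The curves C V, 0 <= V <= Vb, change smoothly with V: they are traced by a
   map p (V, s), 1-periodic in s, that is continuous for 0 <= V <= Vb and, for
   0 < V <= Vb, continuously differentiable with invertible Jacobian matrix
   (so that the level function of the family is differentiable).  No
   derivative is required at V = 0: the size of the cycles is of order
   sqrt V there. *)
Definition smooth_curve_family (R : realType) (Vb : R)
    (C : R -> set (R * R)) : Prop :=
  exists (p : R * R -> R * R) (U : R), Vb < U /\
  [/\ forall V, 0 <= V <= Vb -> C V = range (fun t => p (V, t)),
      forall V t, p (V, t + 1) = p (V, t),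
      forall V, 0 < V <= Vb -> {in `[0, 1[ &, injective (fun t => p (V, t))},
      {within [set q | 0 <= q.1 <= Vb], continuous p} &
      Ck [set q | 0 < q.1 < U] 1 p /\
      forall q, 0 < q.1 <= Vb -> \det (jac2 p q) != 0].

(* C V is the limit cycle of the V-comparison system. *)
Record limit_cycle_family (R : realType) (s : pll_cc R) (Vb : R)
    (C : R -> set (R * R)) : Prop := {
  comparison_defined : forall V, 0 <= V <= Vb -> nonsingular s V;
  cycle_0 : C 0 = [set (0, 0)];
  cycle_V : forall V, 0 < V <= Vb ->
    stable_clockwise_limit_cycle (comparison_rhs s V) (C V);
  cycle_smooth : smooth_curve_family Vb C;
  cycle_disjoint : forall V1 V2, 0 <= V1 -> V1 < V2 -> V2 <= Vb ->
    C V1 `&` C V2 = set0;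
  cycle_nested : forall V1 V2, 0 <= V1 -> V1 < V2 -> V2 <= Vb ->
    region (C V1) `<=` (region (C V2))°
}.

Definition is_VPLL (R : realType) (Vb : R) (C : R -> set (R * R))
    (VPLL : R * R -> R) : Prop :=
  (forall V q, 0 <= V <= Vb -> C V q -> VPLL q = V) /\
  (forall q, region (C Vb) q -> exists2 V, 0 <= V <= Vb & C V q).

(** Solutions and the lock-in domain *)

Definition solution (R : realType) (s : pll_cc R) (J : set R)
    (z : R -> R * R * 'cV[R]_4) : Prop :=
  forall t, J t ->
    dot (nu s) (z t).2 != mu s /\ derive_within J z t (rhs s (z t)).

Definition lock_in_domain (R : realType) (s : pll_cc R) :
    set (R * R * 'cV[R]_4) :=
  [set z0 |
    (exists2 z, solution s [set t | 0 <= t] z & z 0 = z0) /\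
    forall z, solution s [set t | 0 <= t] z -> z 0 = z0 ->
      (z t @[t --> +oo] --> (0 : R * R * 'cV[R]_4)) /\
      forall t, 0 <= t -> - pi < (z t).1.1 < pi].

Definition forward_invariant (R : realType) (s : pll_cc R)
    (S : set (R * R * 'cV[R]_4)) : Prop :=
  forall (T : R) z, solution s `[0, T] z -> S (z 0) ->
    forall t, 0 <= t <= T -> S (z t).

Definition lock_in_estimation (R : realType) (s : pll_cc R)
    (S : set (R * R * 'cV[R]_4)) : Prop :=
  forward_invariant s S /\ S `<=` lock_in_domain s.

(* Main.v *)
(* Trace the cycles by p (V, t) and let alpha be the rate at which V changes
   along the PLL field at p (V, t).  Among the values that f takes on the
   ellipsoid VCC <= V, the comparison system selects the one that turns the
   field furthest outwards, so alpha <= 0 as long as VCC <= V; moreover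
   alpha < 0 at x = 0 unless omega = 0.  If VCC > Vb and alpha > 0, a solution
   that arrives at the given state stays in the region shortly before, so the
   bound F applies and alpha <= F; this makes the moving region
   {VPLL <= Phi (VCC (x t))} grow at least as fast as the field requires.  By
   Nagumo's argument (the distance to the moving region satisfies a Gronwall
   inequality) no solution leaves it.  For the convergence, x tends to 0 and
   VPLL has a limit L, because the regions {VPLL <= V} are invariant as soon as
   VCC <= V; if L were positive, VPLL + k omega f (q, 0) with a small k > 0 would
   decrease at a positive rate.  Solutions are constructed for a globally
   Lipschitz field that agrees with the given one near the estimation. *)

Require Import Defs.
From HB Require Import structures.
From mathcomp Require Import all_boot all_order all_algebra.
From mathcomp Require Import complex.
From mathcomp Require Import all_classical all_reals all_analysis.
From mathcomp Require Import ring lra.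
Import Order.TTheory GRing.Theory Num.Theory.
Import numFieldNormedType.Exports.
Local Open Scope classical_set_scope.
Local Open Scope ring_scope.

Set Implicit Arguments.
Unset Strict Implicit.
Unset Printing Implicit Defensive.

(** * Derivatives relative to a set and Gronwall's inequality *)

(** The obstacle is that [F] is an arbitrary function. Where [VPLL] equals [Phi (VCC x)] the
    hypotheses give only a non-strict inequality between the two rates, which does not forbid
    crossing, and without regularity of [F] no comparison theorem for scalar differential equations
    applies. The Lipschitz constant of the field takes the place of this regularity: the rates are
    compared at the closest point of the moving region, not along the solution itself. So the bound
    by [F] is needed at points that the given solution may never visit, and auxiliary solutions are
    run backwards from them. The field of a comparison system jumps at [omega = 0]; the sign of
    [alpha] is therefore found at a dense set of points of each cycle and extended by continuity.
    How a cycle is oriented relative to its parametrization is read off at its topmost point. Away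
    from the origin the regularity of [VPLL] comes from a local inverse of [p]; at the origin only
    continuity is available. *)

Definition has_deriv (R : realType) (W : normedModType R) (J : set R)
    (u : R -> W) (t : R) (d : W) : Prop :=
  forall e, 0 < e -> exists2 del, 0 < del & forall s, J s -> `|s - t| < del ->
    `|u s - u t - (s - t) *: d| <= e * `|s - t|.

(** Without the quotient no case [s = t] has to be excluded, and derivatives can be restricted,
    paired and composed by plain norm estimates. *)
Lemma derive_withinP (R : realType) (W : normedModType R) (J : set R)
    (u : R -> W) (t : R) (d : W) :
  derive_within J u t d <-> has_deriv J u t d.
Proof.
split=> [/cvgrPdist_lt du e e0|du].
- have [del /= del0 H] := du e e0; exists del => // s Js std.
  have [->|st] := eqVneq s t; first by rewrite !subrr scale0r subrr !normr0 mulr0.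
  have := H s; rewrite /= distrC => /(_ std st Js)/ltW.
  have st0 : s - t != 0 by rewrite subr_eq0.
  rewrite -(ler_pM2r (_ : 0 < `|s - t|)) ?normr_gt0//; apply: le_trans.
  rewrite [leRHS]mulrC -normrZ scalerBr scalerA divff// scale1r.
  by rewrite -[leLHS]normrN opprB.
- apply/cvgrPdist_lt => e e0.
  have [del del0 H] := du (e / 2) (divr_gt0 e0 (ltr0Sn _ 1)); exists del => //= s std st Js.
  have st0 : s - t != 0 by rewrite subr_eq0.
  have st1 : 0 < `|s - t| by rewrite normr_gt0.
  rewrite -(ltr_pM2r st1) [ltLHS]mulrC -normrZ scalerBr scalerA divff// scale1r.
  rewrite -normrN opprB; apply: le_lt_trans (H s Js _) _; first by rewrite distrC.
  by rewrite ltr_pM2r//; lra.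
Qed.

Lemma has_deriv_sub (R : realType) (W : normedModType R) (J K : set R)
    (u : R -> W) (t : R) (d : W) :
  J `<=` K -> has_deriv K u t d -> has_deriv J u t d.
Proof.
move=> JK du e e0; have [del del0 H] := du e e0.
by exists del => // s /JK; exact: H.
Qed.

Lemma has_deriv_cont (R : realType) (W : normedModType R) (J : set R)
    (u : R -> W) (t : R) (d : W) : has_deriv J u t d ->
  forall e, 0 < e -> exists2 del, 0 < del & forall s, J s -> `|s - t| < del ->
    `|u s - u t| < e.
Proof.
move=> du e e0; have [del del0 H] := du 1 ltr01.
exists (Num.min del (e / (`|d| + 2))).
  by rewrite lt_min del0 divr_gt0// ltr_wpDl.
move=> s Js; rewrite lt_min ltr_pdivlMr ?ltr_wpDl// => /andP[s1 s2].
have := H s Js s1; rewrite mul1r => s3.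
rewrite -[u s - u t](subrK ((s - t) *: d)).
apply: le_lt_trans (ler_normD _ _) _; rewrite normrZ.
have := normr_ge0 d; have := normr_ge0 (s - t).
nra.
Qed.

(* Continuous induction: the times up to which [phi] stays below the line of
   slope [e] through [(a, phi a)] have a supremum, which can only be [b]. *)
Lemma right_dini_le0 (R : realType) (phi : R -> R) (a b : R) : a <= b ->
  (forall t e, a < t <= b -> 0 < e -> exists2 del, 0 < del &
     forall s, a <= s < t -> t - del < s -> phi t <= phi s + e) ->
  (forall t e, a <= t < b -> 0 < e -> exists2 del, 0 < del &
     forall r, 0 < r < del -> phi (t + r) <= phi t + e * r) ->
  phi b <= phi a.
Proof.
move=> ab left_ right_.
suff H e : 0 < e -> phi b <= phi a + e * (b - a).
  apply/ler_addgt0Pr => e e0.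
  have [->|ba] := eqVneq a b; first lra.
  have ba0 : 0 < b - a by rewrite subr_gt0 lt_neqAle ba.
  by have := H _ (divr_gt0 e0 ba0); rewrite divfK ?gt_eqF.
move=> e0.
pose S := [set t | a <= t <= b /\ phi t <= phi a + e * (t - a)].
have Sa : S a by split; rewrite ?lexx//; lra.
have supS : has_sup S by split; [exists a|exists b => t [/andP[_ ->]]].
set c := sup S.
have Sle t : S t -> t <= c by move=> St; exact: (ub_le_sup supS.2).
have ac : a <= c := Sle _ Sa.
have cb : c <= b by apply: ge_sup; [exists a|move=> t [/andP[_ ->]]].
have Sc : S c.
  split; first by rewrite ac.
  have [<-|ca] := eqVneq a c; first by rewrite subrr; lra.
  have {ca} ac' : a < c by rewrite lt_neqAle ca.
  apply/ler_addgt0Pr => e' e'0.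
  have [|del del0 H] := left_ c e' _ e'0; first by rewrite ac' cb.
  have [s [/andP[as_ sb] Ss] sc] := sup_adherent del0 supS.
  have [sc'|cs] := ltP s c.
    have := H s; rewrite as_ sc' => /(_ isT sc); nra.
  have : s <= c by apply: Sle; split=> //; rewrite as_.
  move=> sc'; have -> : c = s by lra.
  by lra.
have [cb'|bc] := ltP c b; last by have -> : b = c by [lra]; case: Sc.
have [|del del0 H] := right_ c e _ e0; first by rewrite ac cb'.
pose r := Num.min (del / 2) (b - c).
have r0 : 0 < r by rewrite lt_min; apply/andP; split; lra.
have rdel : r < del by rewrite gt_min; apply/orP; left; lra.
have rbc : r <= b - c by rewrite ge_min lexx orbT.
have : c + r <= c.
  apply: Sle; split; first by apply/andP; split; lra.
  have := H r; rewrite r0 rdel => /(_ isT).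
  by case: Sc => _; nra.
lra.
Qed.

(* Only an increase of [u] matters: a downward jump is allowed by the left
   condition. *)
Lemma right_dini_gronwall (R : realType) (u : R -> R) (L a b : R) : 0 <= L -> a <= b ->
  (forall t, a <= t <= b -> 0 <= u t) ->
  (forall t e, a < t <= b -> 0 < e -> exists2 del, 0 < del &
     forall s, a <= s < t -> t - del < s -> u t <= u s + e) ->
  (forall t e, a <= t < b -> 0 < e -> exists2 del, 0 < del &
     forall r, 0 < r < del -> u (t + r) <= u t + (L * u t + e) * r) ->
  u b <= expR (L * (b - a)) * u a.
Proof.
move=> L0 ab u0 left_ right_.
suff H : expR (- (L * (b - a))) * u b <= expR (- (L * (a - a))) * u a.
  move: H; rewrite subrr mulr0 oppr0 expR0 mul1r expRN.
  by rewrite ler_pdivrMl ?expR_gt0.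
apply: (@right_dini_le0 R (fun t => expR (- (L * (t - a))) * u t) a b) => //.
- move=> t e tab e0; have [del del0 H] := left_ t e tab e0.
  exists del => // s /andP[as_ st] s1.
  have := H s; rewrite as_ st => /(_ isT s1) {H} H.
  have us : 0 <= u s by apply: u0; rewrite as_/=; case/andP: tab; lra.
  have E1 : expR (- (L * (t - a))) <= expR (- (L * (s - a))).
    by rewrite ler_expR lerN2 ler_wpM2l//; lra.
  have E2 : expR (- (L * (t - a))) <= 1.
    by rewrite -expR0 ler_expR oppr_le0 mulr_ge0//; case/andP: tab; lra.
  have E3 := expR_gt0 (- (L * (t - a))).
  apply: (@le_trans _ _ (expR (- (L * (t - a))) * (u s + e))).
    by rewrite ler_wpM2l// ltW.
  nra.
- move=> t e tab e0; have [del del0 H] := right_ t e tab e0.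
  exists del => // r /andP[r0 r1].
  have := H r; rewrite r0 r1 => /(_ isT) {}H.
  have ut : 0 <= u t by apply: u0; case/andP: tab => -> /ltW.
  have -> : - (L * (t + r - a)) = - (L * (t - a)) - L * r by ring.
  rewrite expRD -mulrA; set E := expR (- (L * (t - a))).
  have E2 : E <= 1.
    by rewrite -expR0 ler_expR oppr_le0 mulr_ge0//; case/andP: tab; lra.
  have E3 : 0 < E := expR_gt0 _.
  (* By [1 + x <= expR x] the exponential weight absorbs the growth [L * u t] over a step of length
     [r]. *)
  have X1 : expR (- (L * r)) * (1 + L * r) <= 1.
    by rewrite expRN ler_pdivrMl ?expR_gt0// mulr1 expR_ge1Dx.
  have X2 : expR (- (L * r)) <= 1.
    by rewrite -expR0 ler_expR oppr_le0 mulr_ge0// ltW.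
  have X3 := expR_gt0 (- (L * r)).
  have : expR (- (L * r)) * u (t + r) <= u t + e * r.
    apply: le_trans (ler_wpM2l (ltW X3) H) _.
    have -> : expR (- (L * r)) * (u t + (L * u t + e) * r)
       = (expR (- (L * r)) * (1 + L * r)) * u t + expR (- (L * r)) * (e * r) by ring.
    have := mulr_ge0 (ltW e0) (ltW r0) => er.
    apply: lerD; first by rewrite -[leRHS]mul1r ler_wpM2r.
    by rewrite -[leRHS]mul1r ler_wpM2r.
  move=> /(ler_wpM2l (ltW E3)) /le_trans; apply.
  rewrite mulrDr lerD2l mulrA -[leRHS]mul1r mulrA mul1r.
  have := mulr_ge0 (ltW e0) (ltW r0) => er.
  by rewrite -mulrA -[leRHS]mul1r ler_wpM2r.
Qed.

Lemma derivable_has_deriv (R : realType) (V W : normedModType R) (u : V -> W)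
    (q v : V) : derivable u q v ->
  has_deriv setT (fun r : R => u (q + r *: v)) 0 ('D_v u q).
Proof.
move=> /cvgP; rewrite -/('D_v u q) => /cvgrPdist_lt du e e0.
have [del /= del0 H] := du e e0; exists del => // s _; rewrite subr0 => s1.
have [->|s0] := eqVneq s 0; first by rewrite !subrr scale0r subrr !normr0 mulr0.
have := H s; rewrite /= distrC subr0 => /(_ s1 s0)/ltW.
rewrite -(ler_pM2r (_ : 0 < `|s|)) ?normr_gt0//; apply: le_trans.
rewrite [leRHS]mulrC -normrZ scalerBr scalerA divff// scale1r.
by rewrite -[leLHS]normrN opprB scale0r addr0 [q + _]addrC.
Qed.

Lemma has_deriv_shift (R : realType) (W : normedModType R) (u : R -> W)
    (t : R) d : has_deriv setT (fun r => u (t + r)) 0 d -> has_deriv setT u t d.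
Proof.
move=> du e e0; have [del del0 H] := du e e0; exists del => // s _ s1.
by have := H (s - t) I; rewrite /= subr0 addr0 [t + _]addrC subrK; exact.
Qed.

Lemma has_deriv_pair (R : realType) (V W : normedModType R) (J : set R)
    (u : R -> V) (w : R -> W) t a b :
  has_deriv J u t a -> has_deriv J w t b ->
  has_deriv J (fun s => (u s, w s)) t (a, b).
Proof.
move=> du dw e e0; have [d1 d10 H1] := du e e0; have [d2 d20 H2] := dw e e0.
exists (Num.min d1 d2); first by rewrite lt_min d10.
move=> s Js; rewrite lt_min => /andP[s1 s2].
by rewrite prod_normE ge_max /= (H1 s Js s1) (H2 s Js s2).
Qed.

Lemma has_deriv_fst (R : realType) (V W : normedModType R) (J : set R)
    (u : R -> V * W) t d : has_deriv J u t d -> has_deriv J (fun s => (u s).1) t d.1.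
Proof.
move=> du e e0; have [del del0 H] := du e e0; exists del => // s Js s1.
by apply: le_trans (H s Js s1); rewrite prod_normE le_max lexx.
Qed.

Lemma has_deriv_snd (R : realType) (V W : normedModType R) (J : set R)
    (u : R -> V * W) t d : has_deriv J u t d -> has_deriv J (fun s => (u s).2) t d.2.
Proof.
move=> du e e0; have [del del0 H] := du e e0; exists del => // s Js s1.
by apply: le_trans (H s Js s1); rewrite prod_normE le_max lexx orbT.
Qed.

Lemma mx_norm_leP (R : realType) (m n : nat) (x : 'M[R]_(m, n)) (c : R) : 0 <= c ->
  `|x| <= c <-> forall i j, `|x i j| <= c.
Proof.
move=> c0; have -> : `|x| = mx_norm x by []. 
  rewrite mx_normrE; split.
  by move=> /bigmax_leP[_ H] i j; exact: (H (i, j)).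
by move=> H; apply/bigmax_leP; split => // -[i j] _; exact: H.
Qed.

Lemma mx_norm_coord (R : realType) (m n : nat) (x : 'M[R]_(m, n)) i j :
  `|x i j| <= `|x|.
Proof. by have /mx_norm_leP := lexx `|x|; apply. Qed.

Lemma has_deriv_col (R : realType) (n : nat) (J : set R) (u : 'I_n.+1 -> R -> R) t
    (d : 'I_n.+1 -> R) : (forall i, has_deriv J (u i) t (d i)) ->
  has_deriv J (fun s => \col_i u i s) t (\col_i d i).
Proof.
move=> du e e0.
have /choice[del H] : forall i, exists del, 0 < del /\ forall s, J s -> `|s - t| < del ->
    `|u i s - u i t - (s - t) *: d i| <= e * `|s - t|.
  by move=> i; have [del ? ?] := du i e e0; exists del.
have [d0 d00 Hd0] : exists2 d0, 0 < d0 & forall i, d0 <= del i.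
  have : forall s : seq 'I_n.+1, exists2 d0, 0 < d0 & forall i, i \in s -> d0 <= del i.
    elim=> [|i s [d0 d00 IH]]; first by exists 1.
    exists (Num.min (del i) d0); first by rewrite lt_min d00 (H i).1.
    move=> j; rewrite inE => /orP[/eqP->|/IH]; rewrite ge_min ?lexx//.
    by move=> ->; rewrite orbT.
  move=> /(_ (enum 'I_n.+1))[d0 d00 Hd]; exists d0 => // i.
  by apply: Hd; rewrite mem_enum.
exists d0 => // s Js s1; apply/mx_norm_leP; first by rewrite mulr_ge0// ltW.
move=> i j; rewrite !mxE; apply: (H i).2 => //.
exact: lt_le_trans s1 (Hd0 i).
Qed.

(** Vector-valued functions have no mean value equality. The real function [|u t - u a| - psi t] has
    right growth rate at most 0, so continuous induction applies to it in any normed space. *)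
Lemma mean_value_le (R : realType) (W : normedModType R) (J : set R)
    (u du : R -> W) (psi dpsi : R -> R) (a b : R) : a <= b -> `[a, b] `<=` J ->
  (forall t, a <= t <= b -> has_deriv J u t (du t)) ->
  (forall t, a <= t <= b -> has_deriv J psi t (dpsi t)) ->
  (forall t, a <= t <= b -> `|du t| <= dpsi t) ->
  `|u b - u a| <= psi b - psi a.
Proof.
move=> ab abJ hu hpsi hle.
suff : `|u b - u a| - psi b <= `|u a - u a| - psi a.
  by rewrite subrr normr0; lra.
have inJ t : a <= t <= b -> J t by move=> ?; apply: abJ; rewrite /= in_itv.
apply: (@right_dini_le0 R (fun t => `|u t - u a| - psi t)) => //.
- move=> t e /andP[ta tb] e0.
  have tab : a <= t <= b by rewrite tb ltW.
  have e20 : 0 < e / 2 by lra.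
  have [d1 d10 H1] := has_deriv_cont (hu t tab) e20.
  have [d2 d20 H2] := has_deriv_cont (hpsi t tab) e20.
  exists (Num.min d1 d2); first by rewrite lt_min d10.
  move=> s /andP[as_ st] s1.
  have Js : J s by apply: inJ; apply/andP; split; lra.
  have std : `|s - t| < Num.min d1 d2 by rewrite ltr0_norm ?subr_lt0//; lra.
  move: std; rewrite lt_min => /andP[std1 std2].
  have := H1 s Js std1; have := H2 s Js std2; rewrite ltr_norml => /andP[_ ?] ?.
  have := ler_distD (u s) (u t) (u a); rewrite [`|u t - u s|]distrC.
  lra.
- move=> t e /andP[ta tb] e0.
  have tab : a <= t <= b by rewrite ta ltW.
  have e20 : 0 < e / 2 by lra.
  have [d1 d10 H1] := hu t tab _ e20.
  have [d2 d20 H2] := hpsi t tab _ e20.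
  exists (Num.min (Num.min d1 d2) (b - t)).
    by rewrite !lt_min d10 d20 subr_gt0.
  move=> r; rewrite !lt_min => /andP[r0 /andP[/andP[r1 r2] rb]].
  have Jr : J (t + r) by apply: inJ; apply/andP; split; lra.
  have E : t + r - t = r by ring.
  have := H1 _ Jr; rewrite E gtr0_norm// => /(_ r1) {}H1.
  have := H2 _ Jr; rewrite E gtr0_norm// => /(_ r2) {}H2.
  have := hle t tab => hl.
  have : `|u (t + r) - u t| <= r * dpsi t + e / 2 * r.
    rewrite -[u (t + r) - u t](subrK (r *: du t)).
    apply: le_trans (ler_normD _ _) _; rewrite normrZ gtr0_norm//.
    by rewrite [leRHS]addrC; apply: lerD => //; rewrite ler_pM2l.
  have := ler_distD (u t) (u (t + r)) (u a).
  move: H2; rewrite ler_norml /GRing.scale /= => /andP[H2 _].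
  lra.
Qed.

Lemma subACA (V : zmodType) (x y z t : V) : x - y - (z - t) = x - z - (y - t).
Proof. by rewrite !opprD !opprK addrACA. Qed.

Lemma has_derivB (R : realType) (W : normedModType R) (J : set R)
    (u w : R -> W) t a b :
  has_deriv J u t a -> has_deriv J w t b ->
  has_deriv J (fun s => u s - w s) t (a - b).
Proof.
move=> du dw e e0; have e20 : 0 < e / 2 by lra.
have [d1 d10 H1] := du _ e20; have [d2 d20 H2] := dw _ e20.
exists (Num.min d1 d2); first by rewrite lt_min d10.
move=> s Js; rewrite lt_min => /andP[s1 s2].
have -> : u s - w s - (u t - w t) - (s - t) *: (a - b) =
  (u s - u t - (s - t) *: a) - (w s - w t - (s - t) *: b).
  by rewrite scalerBr (subACA (u s)) (subACA (u s - u t)).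
apply: le_trans (ler_normB _ _) _.
by have := H1 s Js s1; have := H2 s Js s2; lra.
Qed.

Lemma has_deriv_lin (R : realType) (W : normedModType R) (J : set R) (d : W) t :
  has_deriv J (fun r => r *: d) t d.
Proof.
move=> e e0; exists 1 => // s _ _.
by rewrite -scalerBl subrr normr0 mulr_ge0// ltW.
Qed.

Lemma mean_value_lin (R : realType) (W : normedModType R) (J : set R)
    (u du : R -> W) (d : W) (K a b : R) : a <= b -> `[a, b] `<=` J ->
  (forall t, a <= t <= b -> has_deriv J u t (du t)) ->
  (forall t, a <= t <= b -> `|du t - d| <= K) ->
  `|u b - u a - (b - a) *: d| <= K * (b - a).
Proof.
move=> ab abJ hu hle.
have := @mean_value_le R W J (fun r => u r - r *: d) (fun r => du r - d)
  (fun r => r *: K) (fun=> K) a b ab abJ.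
have -> : u b - b *: d - (u a - a *: d) = u b - u a - (b - a) *: d.
  by rewrite scalerBl (subACA (u b)).
rewrite -scalerBl [(b - a) *: K]mulrC; apply => // t tab.
  by apply: has_derivB; [exact: hu|exact: has_deriv_lin].
exact: has_deriv_lin.
Qed.

Lemma mean_value_abs (R : realType) (W : normedModType R) (J : set R)
    (u du : R -> W) (d : W) (K a b : R) :
  (forall t, `|t - a| <= `|b - a| -> J t -> has_deriv J u t (du t)) ->
  (forall t, Num.min a b <= t <= Num.max a b -> J t) ->
  (forall t, `|t - a| <= `|b - a| -> J t -> `|du t - d| <= K) ->
  `|u b - u a - (b - a) *: d| <= K * `|b - a|.
Proof.
move=> hu abJ hle; have [ab|ba] := leP a b.
  have near_ t : a <= t <= b -> `|t - a| <= `|b - a| /\ J t.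
    move=> /andP[ta tb]; split; first by rewrite !ger0_norm ?subr_ge0//; lra.
    by apply: abJ; rewrite min_l// max_r// ta.
  rewrite [`|b - a|]ger0_norm ?subr_ge0//.
  apply: (@mean_value_lin R W J u du) => // [t|t /near_[]|t /near_[]]; auto.
  by rewrite /= in_itv/= => /near_[].
have near_ t : b <= t <= a -> `|t - a| <= `|b - a| /\ J t.
  move=> /andP[ta tb]; split; first by rewrite !ler0_norm ?subr_le0//; lra.
  by apply: abJ; rewrite min_r ?(ltW ba)// max_l ?(ltW ba)// ta.
rewrite [`|b - a|]ltr0_norm ?subr_lt0// opprB.
have -> : u b - u a - (b - a) *: d = - (u a - u b - (a - b) *: d).
  by rewrite opprD opprB opprK -scaleNr opprB.
rewrite normrN.
apply: (@mean_value_lin R W J u du _ _ _ _ (ltW ba)) => [t|t /near_[]|t /near_[]]; auto.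
by rewrite /= in_itv/= => /near_[].
Qed.

(** * Picard iteration *)

Definition cont_within (R : realType) (W : normedModType R) (J : set R)
    (c : R -> W) := forall t, J t -> forall e, 0 < e -> exists2 del, 0 < del &
    forall s, J s -> `|s - t| < del -> `|c s - c t| < e.

(* The two properties of the values needed by Picard iteration; both pass to
   finite products, and so they are checked on [R] only. *)
Definition picard_space (R : realType) (V : normedModType R) : Prop :=
  (forall c : R -> V, cont_within [set t | 0 <= t] c -> exists C : R -> V,
     forall t, 0 <= t -> has_deriv [set t | 0 <= t] C t (c t)) /\
  (forall (v : nat -> V) (K : R), (forall n, `|v n.+1 - v n| <= K / 2 ^+ n) ->
     exists l, forall n, `|l - v n| <= 2 * K / 2 ^+ n).

Lemma le_half_pow (R : realType) (x y K : R) :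
  (forall n, x <= y + K / 2 ^+ n) -> x <= y.
Proof.
move=> H; rewrite leNgt; apply/negP => yx.
have K0 : 0 < K.
  have := H 0%N; rewrite expr0 divr1; lra.
have d0 : 0 < x - y by lra.
have [n Hn] : exists n : nat, K / (x - y) < n%:R.
  exists (Num.bound (K / (x - y))).
  have := archi_boundP (ltW (divr_gt0 K0 d0)); exact.
have := H n.
have n2 : (n%:R : R) <= 2 ^+ n by rewrite -natrX ler_nat ltnW// ltn_expl.
have p0 : 0 < 2 ^+ n :> R by rewrite exprn_gt0.
rewrite -lerBlDl ler_pdivlMr// => H1.
move: Hn; rewrite ltr_pdivrMr//; nra.
Qed.

Lemma half_pow_lt (R : realType) (K e : R) : 0 < e -> exists n, K / 2 ^+ n < e.
Proof.
move=> e0; apply: contrapT => H.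
have : e <= 0.
  apply: (@le_half_pow R e 0 K) => n; rewrite add0r leNgt; apply/negP => ?.
  by apply: H; exists n.
lra.
Qed.

Lemma picard_space_R (R : realType) : picard_space R^o.
Proof.
split.
(* Continuing [c] by a constant to negative times and integrating from [-1] makes every [t >= 0] an
   interior point, where the fundamental theorem of calculus gives a two-sided derivative. *)
- move=> c cc; pose k (t : R) : R := c (Num.max t 0).
  have ck : continuous k.
    move=> t; apply/cvgrPdist_lt => e e0.
    have m0 : 0 <= Num.max t 0 by rewrite le_max lexx orbT.
    have [del del0 H] := cc _ m0 e e0.
    exists del => //= s st; rewrite distrC; apply: H.
      by rewrite /= le_max lexx orbT.
    apply: le_lt_trans st; rewrite [leRHS]distrC.
    rewrite !maxEle; case: (leP s 0) => ?; case: (leP t 0) => ? //.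
    + by rewrite subrr normr0.
    + by rewrite sub0r normrN gtr0_norm// distrC ger0_norm; lra.
    + by rewrite subr0 gtr0_norm// ger0_norm; lra.
  pose F x : R := \int[lebesgue_measure]_(t in [set` `[-1, x]]) (k t).
  exists F => t t0 e e0.
  have [|||D1 D2] := @continuous_FTC1_closed R k (-1) t (t + 1) _ _ _ (ck t).
  + by rewrite ltrDl.
  + apply: continuous_compact_integrable; first exact: segment_compact.
    exact: continuous_subspaceT.
  + lra.
  have := derivable_has_deriv D1; rewrite -derive1E D2 {2}/k max_l// => H.
  have := @has_deriv_shift R R^o F t (c t).
  have -> : (fun r => F (t + r)) = (fun r => F (t + r *: 1)).
    by apply/funext => r; rewrite [r *: 1]mulr1.
  move=> /(_ H e e0)[del del0 H']; exists del => // s _; exact: H'.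
- move=> v K Hv.
  have K0 : 0 <= K.
    by have := le_trans (normr_ge0 _) (Hv 0%N); rewrite expr0 divr1.
  (* [w n] sums the increment bounds from index [n] on, so the intervals with centre [v n] and
     radius [w n] are nested; the supremum of their left endpoints lies in all of them. *)
  pose w n := 2 * K / 2 ^+ n.
  have wS n : K / 2 ^+ n = w n - w n.+1.
    rewrite /w exprS; field; by rewrite expf_neq0.
  have w0 n : 0 <= w n by rewrite /w divr_ge0 ?mulr_ge0// exprn_ge0.
  have stepm m n : `|v (n + m)%N - v n| <= w n - w (n + m)%N.
    elim: m => [|m IH]; first by rewrite addn0 !subrr normr0.
    rewrite addnS; have := ler_distD (v (n + m)%N) (v (n + m).+1) (v n).
    have := Hv (n + m)%N; rewrite wS; lra.
  have le_ m n : v m - w m <= v n + w n.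
    have [mn|nm] := leqP m n.
      have := stepm (n - m)%N m; rewrite subnKC// ler_distl => /andP[].
      have := w0 n; have := w0 m; lra.
    have := stepm (m - n)%N n; rewrite subnKC ?(ltnW nm)// ler_distl => /andP[].
    have := w0 n; have := w0 m; lra.
  pose S := [set v m - w m | m in [set: nat]].
  have S0 : S !=set0 by exists (v 0%N - w 0%N); exists 0%N.
  have Sub : has_ubound S by exists (v 0%N + w 0%N) => _ [m _ <-].
  exists (sup S) => n; rewrite -/(w n) ler_distl; apply/andP; split.
    by apply: (ub_le_sup Sub); exists n.
  by apply: ge_sup => // _ [m _ <-].
Qed.

Lemma cont_within_comp_le (R : realType) (V W : normedModType R) (J : set R)
    (c : R -> V) (d : R -> W) : (forall s t, `|d s - d t| <= `|c s - c t|) ->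
  cont_within J c -> cont_within J d.
Proof.
move=> H cc t Jt e e0; have [del del0 Hd] := cc t Jt e e0.
by exists del => // s Js st; apply: le_lt_trans (H _ _) (Hd s Js st).
Qed.

Lemma picard_space_prod (R : realType) (V W : normedModType R) :
  picard_space V -> picard_space W -> picard_space (V * W)%type.
Proof.
move=> [pV cV] [pW cW]; split.
- move=> c cc.
  have [|C1 H1] := pV (fun t => (c t).1).
    by apply: cont_within_comp_le cc => s t; rewrite [leRHS]prod_normE le_max lexx.
  have [|C2 H2] := pW (fun t => (c t).2).
    by apply: cont_within_comp_le cc => s t; rewrite [leRHS]prod_normE le_max lexx orbT.
  exists (fun t => (C1 t, C2 t)) => t t0; rewrite [c t]surjective_pairing.
  by apply: has_deriv_pair; auto.
- move=> v K Hv.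
  have [|l1 H1] := cV (fun n => (v n).1) K.
    by move=> n; apply: le_trans (Hv n); rewrite prod_normE le_max lexx.
  have [|l2 H2] := cW (fun n => (v n).2) K.
    by move=> n; apply: le_trans (Hv n); rewrite prod_normE le_max lexx orbT.
  by exists (l1, l2) => n; rewrite prod_normE ge_max H1 H2.
Qed.

Lemma picard_space_col (R : realType) (n : nat) : picard_space 'cV[R]_n.+1.
Proof.
have [pR cR] := picard_space_R R; split.
- move=> c cc.
  have /choice[C HC] : forall i, exists C : R -> R, forall t, 0 <= t ->
      has_deriv [set t | 0 <= t] C t (c t i 0).
    move=> i; apply: (pR (fun t => c t i 0)).
    apply: cont_within_comp_le cc => s t.
    by have := mx_norm_coord (c s - c t) i 0; rewrite !mxE.
  exists (fun t => \col_i C i t) => t t0.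
  have -> : c t = \col_i c t i 0 by apply/colP => i; rewrite mxE.
  by apply: has_deriv_col => i; exact: HC.
- move=> v K Hv.
  have /choice[l Hl] : forall i, exists l : R, forall m, `|l - v m i 0| <= 2 * K / 2 ^+ m.
    move=> i; apply: (cR (fun m => v m i 0)) => m; apply: le_trans (Hv m).
    by have := mx_norm_coord (v m.+1 - v m) i 0; rewrite !mxE.
  exists (\col_i l i) => m; apply/mx_norm_leP.
    exact: le_trans (normr_ge0 _) (Hl 0 m).
  by move=> i j; rewrite !mxE ord1.
Qed.

Lemma has_deriv_expR (R : realType) (J : set R) (K k t : R) :
  has_deriv J (fun r => K * expR (k * r)) t (k * (K * expR (k * t))).
Proof.
apply: (@has_deriv_sub R R^o J setT) => //.
apply: has_deriv_shift.
have D : is_derive t 1 (fun r : R => K * expR (k * r)) (k * (K * expR (k * t))).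
  have D1 : is_derive t 1 (fun r : R => k * r) k.
    have D0 : is_derive t 1 (k \*: (id : R -> R)) (k *: 1) by exact: is_deriveZ.
    by apply: (is_derive_eq D0); rewrite /GRing.scale /= mulr1.
  have D2 := is_derive1_comp (is_derive_expR (k * t)) D1.
  have D3 := is_deriveZ K D2.
  by apply: (is_derive_eq D3); rewrite /GRing.scale /=; ring.
have := derivable_has_deriv (@ex_derive _ _ _ _ _ _ _ D).
rewrite derive_val.
by under eq_fun do rewrite [_ *: 1]mulr1.
Qed.

(** Measured with the weight [expR (2 * L * t)] the iteration contracts by a factor 1/2 on the whole
    half-line, so that no local solutions have to be continued. *)
Theorem picard (R : realType) (V : normedModType R) (G : V -> V) (L : R) (z0 : V) :
  picard_space V -> 0 < L -> (forall a b, `|G a - G b| <= L * `|a - b|) ->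
  exists u : R -> V, u 0 = z0 /\
    forall t, 0 <= t -> has_deriv [set t | 0 <= t] u t (G (u t)).
Proof.
move=> [prim compl] L0 GL; set J := [set t : R | 0 <= t].
have subJ a b : 0 <= a -> `[a, b] `<=` J.
  by move=> a0 t; rewrite /J /= in_itv/= => /andP[]; lra.
have contG u : cont_within J u -> cont_within J (fun t => G (u t)).
  move=> uc t t0 e e0; have [del del0 H] := uc t t0 _ (divr_gt0 e0 L0).
  exists del => // s s0 st; apply: le_lt_trans (GL _ _) _.
  by have := H s s0 st; rewrite ltr_pdivlMr// mulrC.
have /choice[step Hstep] : forall u : R -> V, exists u' : R -> V, cont_within J u ->
    [/\ cont_within J u', u' 0 = z0 &
        forall t, 0 <= t -> has_deriv J u' t (G (u t))].
  move=> u; have [uc|nuc] := pselect (cont_within J u); last by exists u.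
  have [C HC] := prim _ (contG _ uc); exists (fun t => C t - C 0 + z0) => _.
  have D t : 0 <= t -> has_deriv J (fun t => C t - C 0 + z0) t (G (u t)).
    move=> t0 e e0; have [del del0 H] := HC t t0 e e0; exists del => // s s0 st.
    by rewrite opprD addrACA subrr addr0 opprB addrA subrK; exact: H.
  split=> //; last by rewrite subrr add0r.
  by move=> t t0 e; exact: has_deriv_cont (D t t0) e.
pose u n := iter n step (fun=> z0).
have uc n : cont_within J (u n).
  elim: n => [|n IH]; last by have [] := Hstep _ IH.
  by move=> t _ e e0; exists 1 => // s _ _; rewrite subrr normr0.
have u0 n : u n 0 = z0 by case: n => [//|n]; have [] := Hstep _ (uc n).
have ud n t : 0 <= t -> has_deriv J (u n.+1) t (G (u n t)).
  by have [_ _] := Hstep _ (uc n); apply.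
(* With this [M] the derivative of [M * expR (2 * L * t)] dominates [|G z0|], which starts the
   induction. *)
pose M := `|G z0| / (2 * L).
have M0 : 0 <= M by rewrite divr_ge0// mulr_ge0// ltW.
have E0 t : 0 < expR (2 * L * t) := expR_gt0 _.
have E1 t : 0 <= t -> 1 <= expR (2 * L * t).
  by move=> t0; rewrite -expR0 ler_expR !mulr_ge0// ltW.
have uM n t : 0 <= t -> `|u n.+1 t - u n t| <= M * expR (2 * L * t) / 2 ^+ n.
  elim: n t => [|n IH] t t0.
    have -> : u 0%N t = u 1%N 0 by rewrite (u0 1%N).
    rewrite expr0 divr1.
    have := @mean_value_le R V J (u 1%N) (fun=> G z0)
      (fun t => M * expR (2 * L * t)) (fun t => 2 * L * (M * expR (2 * L * t))) 0 t t0
      (subJ _ _ (lexx _)).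
    rewrite mulr0 expR0 mulr1 => H; apply: le_trans (H _ _ _) _ => //.
    + by move=> s /andP[s0 _]; exact: (ud 0%N).
    + by move=> s _; exact: has_deriv_expR.
    + move=> s /andP[s0 _].
      have -> : 2 * L * (M * expR (2 * L * s)) = `|G z0| * expR (2 * L * s).
        by rewrite /M; field; rewrite gt_eqF.
      by have := E1 s s0; have := normr_ge0 (G z0); nra.
    + by rewrite gerBl.
  pose K := M / 2 ^+ n.+1.
  have -> : M * expR (2 * L * t) / 2 ^+ n.+1 = K * expR (2 * L * t).
    by rewrite /K mulrAC.
  have K0 : 0 <= K by rewrite divr_ge0// exprn_ge0.
  have := @mean_value_le R V J (fun t => u n.+2 t - u n.+1 t)
    (fun t => G (u n.+1 t) - G (u n t))
    (fun t => K * expR (2 * L * t)) (fun t => 2 * L * (K * expR (2 * L * t))) 0 t t0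
    (subJ _ _ (lexx _)).
  cbv beta; rewrite (u0 n.+2) (u0 n.+1) subrr subr0 mulr0 expR0 mulr1 => H.
  apply: le_trans (H _ _ _) _ => //.
  + by move=> s /andP[s0 _]; apply: has_derivB; exact: ud.
  + by move=> s _; exact: has_deriv_expR.
  + move=> s /andP[s0 _]; apply: le_trans (GL _ _) _.
    rewrite mulrAC [leRHS]mulrC mulrA; apply: (le_trans (ler_wpM2l (ltW L0) (IH s s0))).
    rewrite le_eqVlt; apply/orP; left; apply/eqP.
    by rewrite /K exprS; field; rewrite expf_neq0.
  + by rewrite gerBl.
have /choice[l Hl] : forall t, exists l, 0 <= t -> forall n,
    `|l - u n t| <= 2 * (M * expR (2 * L * t)) / 2 ^+ n.
  move=> t; have [t0|t0] := boolP (0 <= t); last by exists 0.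
  by have [l Hl] := compl (fun n => u n t) _ (fun n => uM n t t0); exists l.
exists l; split.
  apply/eqP; rewrite -subr_eq0 -normr_le0.
  apply: (@le_half_pow R _ _ (2 * (M * expR (2 * L * 0)))) => n.
  by rewrite add0r -(u0 n); exact: Hl.
move=> t t0 e e0.
pose B := 2 * (M * expR (2 * L * (t + 1))).
have B0 : 0 <= B by rewrite /B mulr_ge0// mulr_ge0// ltW.
have lB s n : 0 <= s -> s <= t + 1 -> `|l s - u n s| <= B / 2 ^+ n.
  move=> s0 st; apply: (le_trans (Hl s s0 n)).
  rewrite ler_pM2r ?invr_gt0 ?exprn_gt0// /B ler_pM2l// ler_wpM2l// ler_expR.
  by rewrite ler_pM2l// mulr_gt0.
(* Near [t] the late iterates stay within [4 * eta] of [l t], so the field along them stays within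
   [e] of [G (l t)]. *)
pose eta := e / (4 * L).
have eta0 : 0 < eta by rewrite divr_gt0// mulr_gt0.
have [N HN] := half_pow_lt B eta0.
have HN' n : (N <= n)%N -> B / 2 ^+ n <= eta.
  move=> Nn; apply: le_trans (ltW HN).
  by rewrite ler_wpM2l// lef_pV2 ?posrE ?exprn_gt0// ler_eXn2l// ltr1n.
have [del0 del00 Hdel] := uc N t t0 eta eta0.
exists (Num.min del0 1); first by rewrite lt_min del00/=.
move=> s s0; rewrite lt_min => /andP[sd s1].
have closel r n : (N <= n)%N -> 0 <= r -> `|r - t| <= `|s - t| -> `|u n r - l t| <= 4 * eta.
  move=> Nn r0 rs.
  have r1 : r <= t + 1.
    by have := le_lt_trans rs s1; rewrite ltr_norml => /andP[]; lra.
  have t1 : t <= t + 1 by rewrite lerDl.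
  have X1 := le_trans (lB r n r0 r1) (HN' n Nn).
  have X2 := le_trans (lB r N r0 r1) (HN' N (leqnn N)).
  have X3 := Hdel r r0 (le_lt_trans rs sd).
  have X4 := le_trans (lB t N t0 t1) (HN' N (leqnn N)).
  have := ler_distD (l r) (u n r) (l t); have := ler_distD (u N r) (l r) (l t).
  have := ler_distD (u N t) (u N r) (l t); rewrite [`|u n r - l r|]distrC.
  rewrite [`|u N t - l t|]distrC.
  lra.
(* For fixed [s] and [t] the error made by replacing the limit by an iterate vanishes as [n] grows;
   what remains is the mean value bound for the iterates with slope [G (l t)]. *)
apply: (@le_half_pow R _ _ (2 * (eta * 2 ^+ N + B))) => n.
have Nn : (N <= n + N)%N by rewrite leq_addl.
have Jmin r : Num.min t s <= r <= Num.max t s -> J r.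
  move=> /andP[]; rewrite ge_min /J /=.
  by move=> /orP[|] ? _; [exact: le_trans t0 _|exact: le_trans s0 _].
have Gl r : `|r - t| <= `|s - t| -> J r ->
    `|G (u (n + N)%N r) - G (l t)| <= 4 * (L * eta).
  move=> rs r0; apply: le_trans (GL _ _) _; rewrite mulrCA ler_pM2l//.
  exact: closel.
have := @mean_value_abs R V J (u (n + N).+1) (fun t => G (u (n + N)%N t)) (G (l t))
  (4 * (L * eta)) t s (fun r _ r0 => ud _ r r0) Jmin Gl.
have -> : 4 * (L * eta) = e by rewrite /eta; field; rewrite gt_eqF.
have s1' : s <= t + 1 by move: s1; rewrite ltr_norml => /andP[]; lra.
have t1 : t <= t + 1 by rewrite lerDl.
have := lB s (n + N).+1 s0 s1'; have := lB t (n + N).+1 t0 t1.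
set m := (n + N).+1 => X1 X2 X3.
have -> : l s - l t - (s - t) *: G (l t) =
  (u m s - u m t - (s - t) *: G (l t)) + ((l s - u m s) - (l t - u m t)).
  rewrite [RHS]addrC addrA; congr (_ + _).
  by rewrite subACA subrK.
apply: (le_trans (ler_normD _ _)); apply: lerD X3 _.
apply: (le_trans (ler_normB _ _)).
apply: (@le_trans _ _ (2 * (B / 2 ^+ m))); first by lra.
rewrite mulrA ler_pdivrMr ?exprn_gt0// -mulrA -mulrA.
have p0 : 0 < 2 ^+ n :> R by rewrite exprn_gt0.
rewrite ler_pM2l// mulrA mulrAC -mulrA.
have q1 : 1 <= (2 ^+ n)^-1 * 2 ^+ m :> R.
  by rewrite ler_pdivlMl// mulr1 ler_eXn2l ?ltr1n// /m ltnW// ltnS leq_addr.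
have := mulr_ge0 (ltW eta0) (exprn_ge0 N (ler0n R 2)).
set x := eta * _; set y := _^-1 * _ in q1 *.
move=> x0; rewrite [2 ^+ m / _]mulrC -/y; nra.
Qed.

(** * Quadratic forms and ellipsoids *)

Lemma mulmx_norm_le (R : realType) (m n p : nat) (B : 'M[R]_(m, n)) (D : 'M[R]_(n, p)) :
  `|B *m D| <= n%:R * `|B| * `|D|.
Proof.
apply/mx_norm_leP => [|i j]; first by rewrite !mulr_ge0.
rewrite mxE; apply: le_trans (ler_norm_sum _ _ _) _.
apply: (@le_trans _ _ (\sum_(k < n) `|B| * `|D|)).
  apply: ler_sum => k _; rewrite normrM.
  by apply: ler_pM => //; exact: mx_norm_coord.
by rewrite sumr_const card_ord -[leLHS]mulr_natl mulrA.
Qed.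

Lemma trmx_norm (R : realType) (m n : nat) (B : 'M[R]_(m, n)) : `|B^T| = `|B|.
Proof.
apply/eqP; rewrite eq_le; apply/andP; split.
  by apply/mx_norm_leP => // i j; rewrite mxE; exact: mx_norm_coord.
apply/mx_norm_leP => // i j.
by have := mx_norm_coord B^T j i; rewrite mxE.
Qed.

Section Dot.
Context {R : realType} {n : nat}.
Implicit Types u v w : 'cV[R]_n.

Lemma dotE u v : dot u v = \sum_i u i 0 * v i 0.
Proof. by rewrite /dot mxE; apply: eq_bigr => i _; rewrite mxE. Qed.

Lemma dotDl u v w : dot (u + v) w = dot u w + dot v w.
Proof. by rewrite /dot linearD mulmxDl mxE. Qed.

Lemma dotDr u v w : dot w (u + v) = dot w u + dot w v.
Proof. by rewrite /dot mulmxDr mxE. Qed.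

Lemma dotBl u v w : dot (u - v) w = dot u w - dot v w.
Proof. by rewrite /dot linearB mulmxBl !mxE. Qed.

Lemma dotBr u v w : dot w (u - v) = dot w u - dot w v.
Proof. by rewrite /dot mulmxBr !mxE. Qed.

Lemma dotZl (a : R) u v : dot (a *: u) v = a * dot u v.
Proof. by rewrite /dot linearZ -scalemxAl mxE. Qed.

Lemma dotZr (a : R) u v : dot u (a *: v) = a * dot u v.
Proof. by rewrite /dot -scalemxAr mxE. Qed.

Lemma dot0r u : dot u 0 = 0.
Proof. by rewrite /dot mulmx0 mxE. Qed.

Lemma dot_norm_le u v : `|dot u v| <= n%:R * `|u| * `|v|.
Proof.
by apply: le_trans (mx_norm_coord _ _ _) _; rewrite -[`|u|]trmx_norm mulmx_norm_le.
Qed.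

Lemma dot_mulmx u v (B : 'M[R]_n) : dot (B *m u) v = dot u (B^T *m v).
Proof. by rewrite /dot trmx_mul mulmxA. Qed.

Lemma dot_gt0 u : u != 0 -> 0 < dot u u.
Proof.
move=> u0; rewrite dotE.
have [i ui] : exists i, u i 0 != 0.
  apply/existsP; apply: contraNT u0; rewrite negb_exists => /forallP H.
  by apply/eqP/colP => i; rewrite mxE; apply/eqP; rewrite -[_ == _]negbK H.
rewrite (bigD1 i) //=; apply: ltr_wpDr.
  by apply: sumr_ge0 => j _; rewrite -expr2 sqr_ge0.
by rewrite -expr2 exprn_even_gt0.
Qed.
End Dot.

Lemma has_deriv_quad (R : realType) (n : nat) (J : set R) (P : 'M[R]_n)
    (x : R -> 'cV[R]_n) t d : has_deriv J x t d ->
  has_deriv J (fun s => dot (x s) (P *m x s)) t (dot d (P *m x t) + dot (x t) (P *m d)).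
Proof.
move=> dx e e0.
have n0 : 0 <= n%:R :> R by [].
(* [a] bounds the part linear in the first-order remainder of [x], and [b] the part quadratic in its
   increment. *)
pose a := n%:R * `|P *m x t| + n%:R * `|x t| * (n%:R * `|P|).
pose b := n%:R * (n%:R * `|P|) * (`|d| + 1) ^+ 2.
have a0 : 0 <= a by rewrite addr_ge0// !mulr_ge0.
have b0 : 0 <= b by rewrite !mulr_ge0// exprn_ge0// addr_ge0.
have ea0 : 0 < e / (2 * (a + 1)) by rewrite divr_gt0// mulr_gt0// ltr_wpDl.
have [d1 d10 H1] := dx _ ea0.
have [d2 d20 H2] := dx _ ltr01.
have eb0 : 0 < e / (2 * (b + 1)) by rewrite divr_gt0// mulr_gt0// ltr_wpDl.
exists (Num.min (Num.min d1 d2) (e / (2 * (b + 1)))).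
  by rewrite !lt_min d10 d20.
move=> s Js; rewrite !lt_min => /andP[/andP[s1 s2] s3].
have {}H1 := H1 s Js s1; have {}H2 := H2 s Js s2.
set y := x s - x t in H1 H2.
set r := s - t in s1 s2 s3 H1 H2 *.
have -> : dot (x s) (P *m x s) - dot (x t) (P *m x t)
    - r *: (dot d (P *m x t) + dot (x t) (P *m d)) =
  dot (y - r *: d) (P *m x t) + dot (x t) (P *m (y - r *: d)) + dot y (P *m y).
  have -> : x s = y + x t by rewrite /y subrK.
  rewrite -!scaleNr !mulmxDr -!scalemxAr !dotDl !dotDr !dotZl !dotZr.
  rewrite /GRing.scale /=.
  by ring.
have r0 := normr_ge0 r.
have Y : `|y| <= (`|d| + 1) * `|r|.
  rewrite -(subrK (r *: d) y); apply: (le_trans (ler_normD _ _)).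
  by rewrite normrZ; lra.
set Y1 := y - r *: d in H1 *.
have B1 : `|dot Y1 (P *m x t)| <= n%:R * `|P *m x t| * `|Y1|.
  by apply: le_trans (dot_norm_le _ _) _; rewrite mulrAC.
have B2 : `|dot (x t) (P *m Y1)| <= n%:R * `|x t| * (n%:R * `|P|) * `|Y1|.
  apply: le_trans (dot_norm_le _ _) _; rewrite -[leRHS]mulrA ler_wpM2l ?mulr_ge0//.
  exact: mulmx_norm_le.
have B3 : `|dot y (P *m y)| <= b * (`|r| * `|r|).
  apply: (@le_trans _ _ (n%:R * (n%:R * `|P|) * (`|y| * `|y|))).
    apply: le_trans (dot_norm_le _ _) _.
    have -> : n%:R * (n%:R * `|P|) * (`|y| * `|y|) = n%:R * `|y| * (n%:R * `|P| * `|y|).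
      by ring.
    by rewrite ler_wpM2l ?mulr_ge0// mulmx_norm_le.
  have Y2 : `|y| * `|y| <= (`|d| + 1) ^+ 2 * (`|r| * `|r|).
    by rewrite expr2 mulrACA; apply: ler_pM.
  by rewrite /b -[leRHS]mulrA ler_wpM2l ?mulr_ge0.
apply: (le_trans (ler_normD _ _)).
have B4 : `|dot Y1 (P *m x t) + dot (x t) (P *m Y1)| <= a * `|Y1|.
  by apply: (le_trans (ler_normD _ _)); rewrite /a mulrDl; apply: lerD.
have B5 : a * `|Y1| <= e / 2 * `|r|.
  apply: (le_trans (ler_wpM2l a0 H1)); rewrite mulrA ler_wpM2r//.
  have a1 : 0 < a + 1 by rewrite ltr_wpDl.
  have -> : a * (e / (2 * (a + 1))) = e / 2 * (a / (a + 1)) by field; rewrite gt_eqF.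
  rewrite ler_piMr//; first by rewrite divr_ge0// ltW.
  by rewrite ler_pdivrMr// mul1r lerDl.
have B6 : b * (`|r| * `|r|) <= e / 2 * `|r|.
  rewrite mulrA ler_wpM2r//; apply: (@le_trans _ _ ((b + 1) * `|r|)).
    by rewrite ler_wpM2r// lerDl.
  rewrite mulrC -ler_pdivlMr ?ltr_wpDl//.
  by rewrite -mulrA -invfM ltW.
lra.
Qed.

Lemma cont_epsP (R : realType) (V W : normedModType R) (u : V -> W) (x : V) :
  {for x, continuous u} <-> forall e, 0 < e -> exists2 del, 0 < del &
    forall y, `|y - x| < del -> `|u y - u x| < e.
Proof.
split=> [/cvgrPdist_lt H e e0|H].
  have /nbhs_normP[del /= del0 Hd] := H e e0; exists del => // y yx.
  by rewrite distrC; apply: Hd; rewrite /= distrC.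
apply/cvgrPdist_lt => e e0; have [del del0 Hd] := H e e0; apply/nbhs_normP; exists del => //= y yx.
by rewrite distrC; apply: Hd; rewrite distrC.
Qed.

Lemma lip_continuous (R : realType) (V W : normedModType R) (u : V -> W) (K : R) :
  (forall a b, `|u a - u b| <= K * `|a - b|) -> continuous u.
Proof.
move=> uK x; apply/cont_epsP => e e0; exists (e / (`|K| + 1)).
  by rewrite divr_gt0// ltr_wpDl.
move=> y; rewrite ltr_pdivlMr ?ltr_wpDl// => yx.
apply: le_lt_trans (uK _ _) _; apply: le_lt_trans yx.
have := ler_norm K; have := normr_ge0 (y - x); nra.
Qed.

Lemma bounded_closed_compact_col (R : realType) n (A : set 'cV[R]_n) :
  bounded_set A -> closed A -> compact A.
Proof.
move=> bA cA.
have tc k l : continuous (@trmx R k l).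
  apply: (@lip_continuous _ _ _ _ 1) => a b.
  by rewrite mul1r -linearB trmx_norm.
have -> : A = trmx @` (trmx @^-1` A).
  rewrite eqEsubset; split=> [x Ax|_ [y Ay <-]//].
  by exists x^T; rewrite /= trmxK.
apply: continuous_compact; first by apply: continuous_subspaceT; exact: tc.
apply: bounded_closed_compact; last first.
  by have /continuous_closedP /(_ _ cA) := tc 1%N n.
case: bA => M [Mr HM]; exists M; split=> // r Mr' x Ax /=.
by rewrite -trmx_norm; exact: HM.
Qed.

Lemma quad_dist (R : realType) (n : nat) (P : 'M[R]_n) (x y : 'cV[R]_n) :
  `|dot y (P *m y) - dot x (P *m x)| <=
     n%:R * (n%:R * `|P|) * `|y - x| * (`|y| + `|x|).
Proof.
have -> : dot y (P *m y) - dot x (P *m x) =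
    dot (y - x) (P *m y) + dot x (P *m (y - x)).
  by rewrite mulmxBr dotBr dotBl; ring.
apply: (le_trans (ler_normD _ _)).
rewrite mulrDr; apply: lerD; apply: (le_trans (dot_norm_le _ _)).
  rewrite mulrAC -[leLHS]mulrA mulrAC -mulrA mulrCA [leRHS]mulrC -!mulrA.
  have := mulmx_norm_le P y; have := normr_ge0 (y - x) => y0 H.
  have := ler_wpM2l (mulr_ge0 (ler0n R n) y0) H; lra.
have := mulmx_norm_le P (y - x); have := normr_ge0 x => x0 H.
have := ler_wpM2l (mulr_ge0 (ler0n R n) x0) H; lra.
Qed.

Lemma quad_continuous (R : realType) (n : nat) (P : 'M[R]_n) :
  continuous (fun x : 'cV[R]_n => dot x (P *m x)).
Proof.
move=> x; apply/(@cont_epsP _ _ R^o) => e e0.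
set c := n%:R * (n%:R * `|P|); have c0 : 0 <= c by rewrite !mulr_ge0.
have k0 : 0 < c * (2 * `|x| + 1) + 1.
  by rewrite ltr_wpDl// mulr_ge0// addr_ge0// mulr_ge0.
exists (Num.min 1 (e / (c * (2 * `|x| + 1) + 1))); first by rewrite lt_min ltr01 divr_gt0.
move=> y; rewrite lt_min ltr_pdivlMr// => /andP[y1 y2].
apply: le_lt_trans (quad_dist P x y) _; apply: le_lt_trans y2.
rewrite -/c mulrAC [leRHS]mulrC ler_wpM2r//.
have : `|y| <= `|x| + 1.
  by rewrite -(subrK x y); apply: le_trans (ler_normD _ _) _; lra.
have := normr_ge0 x; nra.
Qed.

(** The constant is the minimum over the unit sphere, which is compact; homogeneity of degree two
    does the rest. *)
Lemma posdef_coercive (R : realType) (n : nat) (P : 'M[R]_n.+1) : posdef P ->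
  exists2 c, 0 < c & forall x : 'cV[R]_n.+1, c * `|x| ^+ 2 <= dot x (P *m x).
Proof.
move=> [_ P0]; pose S := [set x : 'cV[R]_n.+1 | `|x| = 1].
have S0 : S !=set0.
  exists (const_mx 1); apply/eqP; rewrite eq_le; apply/andP; split.
    by apply/mx_norm_leP => // i j; rewrite mxE normr1.
  by have := @mx_norm_coord R n.+1 1 (const_mx 1) 0 0; rewrite mxE normr1.
have cS : compact S.
  apply: bounded_closed_compact_col.
    by exists 1; split=> // r r1 x x1; rewrite /= (x1 : `|x| = 1) ltW.
  have := @norm_continuous R 'cV[R]_n.+1 => /continuous_closedP /(_ [set 1]).
  by apply; exact: closed_eq.
have [x] := compact_EVT_min S0 cS (continuous_subspaceT (@quad_continuous R _ P)).
rewrite inE => x1 xmin.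
have x0 : x != 0 by rewrite -normr_gt0 x1.
exists (dot x (P *m x)); first exact: P0.
move=> y; have [->|y0] := eqVneq y 0.
  by rewrite normr0 expr0n /= mulr0 mulmx0 dot0r.
have ny0 : 0 < `|y| by rewrite normr_gt0.
have := xmin (`|y|^-1 *: y); rewrite inE => /(_ _).
rewrite -scalemxAr dotZl dotZr mulrA -invfM -expr2 mulrC ler_pdivlMr ?exprn_gt0//.
by apply; rewrite /S /= normrZ normfV normr_id mulVf// gt_eqF.
Qed.

Section Ellipsoid.
Context {R : realType} {s : pll_cc R}.
Hypothesis Hs : standing_assumptions s.

Lemma VCC_coercive : exists2 c, 0 < c & forall x, c * `|x| ^+ 2 <= VCC s x.
Proof. exact: posdef_coercive (P_posdef Hs). Qed.

Lemma VCC_ge0 x : 0 <= VCC s x.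
Proof.
have [c c0 H] := VCC_coercive; apply: le_trans (H x).
by rewrite mulr_ge0 ?exprn_ge0// ltW.
Qed.

Lemma VCC0 : VCC s 0 = 0.
Proof. by rewrite /VCC mulmx0 dot0r. Qed.

Lemma VCCZ (a : R) x : VCC s (a *: x) = a ^+ 2 * VCC s x.
Proof. by rewrite /VCC -scalemxAr dotZl dotZr mulrA expr2. Qed.

Lemma VCC_bounded V : exists2 M, 0 < M & forall x, VCC s x <= V -> `|x| < M.
Proof.
have [c c0 H] := VCC_coercive; exists (`|V| / c + 1).
  by rewrite ltr_wpDl// divr_ge0// ltW.
move=> x xV; rewrite ltNge; apply/negP => Mx.
have := le_trans (H x) xV => H1.
have : `|x| ^+ 2 <= `|V| / c.
  by rewrite ler_pdivlMr// mulrC; apply: le_trans H1 (ler_norm V).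
have : 0 <= `|V| / c by rewrite divr_ge0// ltW.
nra.
Qed.

Lemma ellipsoid_compact V : compact [set x | VCC s x <= V].
Proof.
apply: bounded_closed_compact_col.
  have [M M0 H] := VCC_bounded V; exists M; split=> [|r Mr x /H]; first exact: num_real.
  by move/ltW => xM; exact: le_trans xM (ltW Mr).
have := @quad_continuous R _ (P s) => /continuous_closedP /(_ [set v | v <= V]).
by apply; exact: closed_le.
Qed.

Lemma VCC_deriv J x t : has_deriv J x t (A s *m x t) -> exists2 w',
  has_deriv J (fun r => VCC s (x r)) t w' & w' <= - (gamma s * VCC s (x t)).
Proof.
move=> dx; exists (dot (A s *m x t) (P s *m x t) + dot (x t) (P s *m (A s *m x t))).
  exact: has_deriv_quad dx.
rewrite dot_mulmx !mulmxA -dotDr -mulmxDl.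
have [_ N0] := lyapunov_inequality Hs.
have : 0 <= dot (x t) (- ((A s)^T *m P s + P s *m A s + gamma s *: P s) *m x t).
  have [->|x0] := eqVneq (x t) 0; last exact/ltW/N0.
  by rewrite mulmx0 dot0r.
rewrite mulNmx -scaleN1r dotZr. rewrite (mulmxDl ((A s)^T *m P s + P s *m A s)) dotDr.
rewrite -scalemxAl dotZr /VCC.
lra.
Qed.

(** The ellipsoid is star-shaped about the origin. If the denominator vanished at [x] or had there
    the sign opposite to [mu], the multiple of [x] by [mu / dot nu x], a factor in [0, 1], would be
    a singular point of the ellipsoid. Compactness then gives a uniform bound. *)
Lemma den_sign Vbb : 0 <= Vbb -> nonsingular s Vbb ->
  exists2 m0, 0 < m0 & forall x, VCC s x <= Vbb ->
    m0 <= Num.sg (mu s) * (mu s - dot (nu s) x).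
Proof.
move=> V0 ns; have mu0 := mu_neq0 Hs.
have pos x : VCC s x <= Vbb -> 0 < Num.sg (mu s) * (mu s - dot (nu s) x).
  move=> xV; rewrite ltNge; apply/negP => H.
  have mun : Num.sg (mu s) * mu s = `|mu s| by rewrite -normrEsg.
  have munx : `|mu s| <= Num.sg (mu s) * dot (nu s) x.
    by move: H; rewrite mulrBr mun; lra.
  have mu1 : 0 < `|mu s| by rewrite normr_gt0.
  have d0 : 0 < Num.sg (mu s) * dot (nu s) x by exact: lt_le_trans munx.
  have d1 : dot (nu s) x != 0 by apply: contraTneq d0 => ->; rewrite mulr0 ltxx.
  have E : mu s / dot (nu s) x = `|mu s| / (Num.sg (mu s) * dot (nu s) x).
    rewrite -mun -mulf_div divff ?sgr_eq0// mul1r//.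
  set r := mu s / dot (nu s) x.
  have r0 : 0 <= r by rewrite /r E divr_ge0// ltW.
  have r1 : r <= 1 by rewrite /r E ler_pdivrMr// mul1r.
  have : VCC s (r *: x) <= Vbb.
    rewrite VCCZ; apply: le_trans xV; rewrite ler_piMl ?VCC_ge0//.
    by rewrite exprn_ile1.
  by move/ns; rewrite dotZr divfK// eqxx.
have ne : [set x | VCC s x <= Vbb] !=set0 by exists 0; rewrite /= VCC0.
have ct : continuous (fun x => Num.sg (mu s) * (mu s - dot (nu s) x)).
  apply: (@lip_continuous _ _ R^o _ (4 * `|nu s|)) => a b.
  have -> : Num.sg (mu s) * (mu s - dot (nu s) a) - Num.sg (mu s) * (mu s - dot (nu s) b)
      = Num.sg (mu s) * - dot (nu s) (a - b) by rewrite dotBr; ring.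
  by rewrite normrM normr_sg mu0 mul1r normrN dot_norm_le.
have [x] := compact_EVT_min ne (@ellipsoid_compact Vbb) (continuous_subspaceT ct).
rewrite inE => xV xmin.
exists (Num.sg (mu s) * (mu s - dot (nu s) x)); first exact: pos.
by move=> y yV; apply: xmin; rewrite inE.
Qed.

End Ellipsoid.

(** * The mean value inequality for functions of two real variables *)

Lemma partial_fst (R : realType) (W : normedModType R) (u : R * R -> W) (q : R * R) :
  derivable u q (1, 0) ->
  has_deriv setT (fun r => u (r, q.2)) q.1 ('D_(1, 0) u q).
Proof.
move=> /derivable_has_deriv H; apply: has_deriv_shift; move: H.
have -> // : (fun r : R => u (q + r *: (1, 0))) = (fun r => u (q.1 + r, q.2)).
apply/funext => r; congr u; case: q => a b /=.
by transitivity (a + r * 1, b + r * 0) => //; rewrite mulr1 mulr0 addr0.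
Qed.

Lemma partial_snd (R : realType) (W : normedModType R) (u : R * R -> W) (q : R * R) :
  derivable u q (0, 1) ->
  has_deriv setT (fun r => u (q.1, r)) q.2 ('D_(0, 1) u q).
Proof.
move=> /derivable_has_deriv H; apply: has_deriv_shift; move: H.
have -> // : (fun r : R => u (q + r *: (0, 1))) = (fun r => u (q.1, q.2 + r)).
apply/funext => r; congr u; case: q => a b /=.
by transitivity (a + r * 0, b + r * 1) => //; rewrite mulr1 mulr0 addr0.
Qed.

Lemma pair_norm_leP (R : realType) (V W : normedModType R) (a : V * W) (r : R) :
  `|a| <= r <-> `|a.1| <= r /\ `|a.2| <= r.
Proof. by rewrite prod_normE ge_max; split=> [/andP|[-> ->]]. Qed.

Lemma pair_norm_ltP (R : realType) (V W : normedModType R) (a : V * W) (r : R) :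
  `|a| < r <-> `|a.1| < r /\ `|a.2| < r.
Proof. by rewrite prod_normE gt_max; split=> [/andP|[-> ->]]. Qed.

(** Balls of the maximum norm are squares, so the corner [(b.1, a.2)] belongs to the square along
    with [a] and [b], and the one-variable bound applies to both legs of the path through it. *)
Lemma mean_value2 (R : realType) (W : normedModType R) (u : R * R -> W)
    (c : R * R) (r eps : R) (l1 l2 : W) :
  (forall q, `|q - c| <= r -> derivable u q (1, 0) /\ derivable u q (0, 1)) ->
  (forall q, `|q - c| <= r -> `|'D_(1, 0) u q - l1| <= eps /\ `|'D_(0, 1) u q - l2| <= eps) ->
  forall a b, `|a - c| <= r -> `|b - c| <= r ->
  `|u b - u a - (b.1 - a.1) *: l1 - (b.2 - a.2) *: l2| <=
     eps * (`|b.1 - a.1| + `|b.2 - a.2|).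
Proof.
move=> hd hl a b ac bc.
have between (x y z w : R) : `|x - w| <= r -> `|y - w| <= r ->
    Num.min x y <= z <= Num.max x y -> `|z - w| <= r.
  by rewrite !ler_distl ge_min le_max => /andP[? ?] /andP[? ?] /andP[/orP[?|?] /orP[?|?]];
    apply/andP; split; lra.
have [ac1 ac2] := (pair_norm_leP _ _).1 ac.
have [bc1 bc2] := (pair_norm_leP _ _).1 bc.
have box (x y : R) : `|x - c.1| <= r -> `|y - c.2| <= r -> `|(x, y) - c| <= r.
  by move=> ? ?; apply/pair_norm_leP.
pose J1 := [set t | Num.min a.1 b.1 <= t <= Num.max a.1 b.1].
pose J2 := [set t | Num.min a.2 b.2 <= t <= Num.max a.2 b.2].
have B1 t : J1 t -> `|(t, a.2) - c| <= r.
  by move=> Jt; apply: box => //; apply: between Jt.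
have B2 t : J2 t -> `|(b.1, t) - c| <= r.
  by move=> Jt; apply: box => //; apply: between Jt.
have H1 := @mean_value_abs R W J1 (fun t => u (t, a.2)) (fun t => 'D_(1, 0) u (t, a.2))
  l1 eps a.1 b.1.
have H2 := @mean_value_abs R W J2 (fun t => u (b.1, t)) (fun t => 'D_(0, 1) u (b.1, t))
  l2 eps a.2 b.2.
have {}H1 : `|u (b.1, a.2) - u a - (b.1 - a.1) *: l1| <= eps * `|b.1 - a.1|.
  rewrite {2}[a]surjective_pairing; apply: H1 => // t _ Jt.
    apply: (@has_deriv_sub _ _ _ setT) => //.
    exact: partial_fst (hd _ (B1 t Jt)).1.
  exact: (hl _ (B1 t Jt)).1.
have {}H2 : `|u b - u (b.1, a.2) - (b.2 - a.2) *: l2| <= eps * `|b.2 - a.2|.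
  rewrite {1}[b]surjective_pairing; apply: H2 => // t _ Jt.
    apply: (@has_deriv_sub _ _ _ setT) => //.
    exact: partial_snd (hd _ (B2 t Jt)).2.
  exact: (hl _ (B2 t Jt)).2.
have -> : u b - u a - (b.1 - a.1) *: l1 - (b.2 - a.2) *: l2 =
  (u b - u (b.1, a.2) - (b.2 - a.2) *: l2) + (u (b.1, a.2) - u a - (b.1 - a.1) *: l1).
  by rewrite [RHS]addrACA [u b - u (b.1, a.2) + _]addrA subrK [RHS]addrA [LHS]addrAC.
apply: (le_trans (ler_normD _ _)); rewrite mulrDr addrC; exact: lerD.
Qed.

(** * Bounded Lipschitz extension of [f] *)

(** Boundedness is included so that the class is closed under products. *)
Definition blip (R : realType) (W : normedModType R) (u : W -> R) : Prop :=
  exists2 K, 0 <= K & (forall a, `|u a| <= K) /\ forall a b, `|u a - u b| <= K * `|a - b|.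

Section Blip.
Context {R : realType} {W : normedModType R}.
Implicit Types u v : W -> R.

Lemma blip_cst (c : R) : blip (fun _ : W => c).
Proof.
exists `|c| => //; split=> // a b.
by rewrite subrr normr0 mulr_ge0.
Qed.

Lemma blipD u v : blip u -> blip v -> blip (fun a => u a + v a).
Proof.
move=> [K K0 [u1 u2]] [K' K'0 [v1 v2]]; exists (K + K'); first exact: addr_ge0.
split=> [a|a b]; first by apply: le_trans (ler_normD _ _) _; apply: lerD.
by rewrite opprD addrACA mulrDl; apply: le_trans (ler_normD _ _) _; apply: lerD.
Qed.

Lemma blipN u : blip u -> blip (fun a => - u a).
Proof.
move=> [K K0 [u1 u2]]; exists K => //; split=> [a|a b]; first by rewrite normrN.
by rewrite -opprD normrN.
Qed.

Lemma blipM u v : blip u -> blip v -> blip (fun a => u a * v a).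
Proof.
move=> [K K0 [u1 u2]] [K' K'0 [v1 v2]]; exists (K * K' + K * K').
  by rewrite addr_ge0// mulr_ge0.
have H a : `|u a * v a| <= K * K' by rewrite normrM ler_pM.
split=> [a|a b]; first by apply: le_trans (H a) _; rewrite lerDl mulr_ge0.
have -> : u a * v a - u b * v b = u a * (v a - v b) + (u a - u b) * v b by ring.
rewrite [leRHS]mulrDl; apply: le_trans (ler_normD _ _) _; rewrite !normrM; apply: lerD.
  by rewrite -mulrA ler_pM.
by rewrite mulrAC ler_pM.
Qed.

Lemma blip_sum (n : nat) (u : 'I_n -> W -> R) : (forall i, blip (u i)) ->
  blip (fun a => \sum_i u i a).
Proof.
move=> H.
have E : (fun a => \sum_i u i a) = \sum_i u i.
  by apply/funext => a; rewrite fct_sumE.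
rewrite E; apply: (@big_ind _ (@blip R W)) => //; first exact: blip_cst.
by move=> *; exact: blipD.
Qed.

Lemma blipV u (m : R) : 0 < m -> (forall a, m <= `|u a|) -> blip u ->
  blip (fun a => (u a)^-1).
Proof.
move=> m0 um [K K0 [u1 u2]].
have uV a : `|(u a)^-1| <= m^-1.
  by rewrite normfV lef_pV2// posrE; exact: lt_le_trans (um a).
have m1 : 0 <= m^-1 by rewrite invr_ge0 ltW.
exists (m^-1 + m^-1 * m^-1 * K); first by rewrite addr_ge0// !mulr_ge0.
split=> [a|a b]; first by apply: le_trans (uV a) _; rewrite lerDl !mulr_ge0.
have u0 c : u c != 0 by rewrite -normr_gt0; exact: lt_le_trans (um c).
have -> : (u a)^-1 - (u b)^-1 = (u a)^-1 * (u b)^-1 * (u b - u a).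
  by field; rewrite !u0.
rewrite !normrM mulrDl; apply: (@le_trans _ _ (m^-1 * m^-1 * K * `|a - b|)).
  rewrite -[leRHS]mulrA; apply: ler_pM; rewrite ?mulr_ge0//.
    by apply: ler_pM.
  by rewrite distrC.
by rewrite lerDr mulr_ge0.
Qed.

Lemma blip_comp (W' : normedModType R) (u : W' -> R) (k : W -> W') :
  (forall a b, `|k a - k b| <= `|a - b|) -> blip u -> blip (u \o k).
Proof.
move=> kl [K K0 [u1 u2]]; exists K => //; split=> [a|a b]; first exact: u1.
by apply: le_trans (u2 _ _) _; rewrite ler_wpM2l.
Qed.

Lemma blip_continuous u : blip u -> continuous (u : W -> R^o).
Proof. by move=> [K _ [_ H]]; exact: (@lip_continuous _ _ R^o _ K). Qed.

End Blip.

Definition clamp (R : realType) (M t : R) : R := Num.max (- M) (Num.min M t).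

Section Clamp.
Context {R : realType} (M : R).
Hypothesis M0 : 0 <= M.

Lemma clamp_id t : `|t| <= M -> clamp M t = t.
Proof.
by rewrite ler_norml /clamp => /andP[? ?]; rewrite min_r// max_r.
Qed.

Lemma clamp_le t : `|clamp M t| <= M.
Proof.
rewrite ler_norml /clamp; apply/andP; split; first by rewrite le_max lexx.
by rewrite ge_max ge_min lexx orTb andbT (le_trans _ M0)// oppr_le0.
Qed.

Lemma clamp_lip a b : `|clamp M a - clamp M b| <= `|a - b|.
Proof.
wlog ab : a b / a <= b.
  move=> H; have [|/ltW] := leP a b; first exact: H.
  by move=> /H; rewrite distrC [X in _ <= X -> _]distrC.
rewrite [`|a - b|]ler0_norm ?subr_le0// opprB.
rewrite /clamp !maxEle !minEle.
by case: (leP M a) => ?; case: (leP M b) => ?; case: (leP (- M) M) => ?;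
  case: (leP (- M) a) => ?; case: (leP (- M) b) => ?; rewrite ler_norml;
  apply/andP; split; lra.
Qed.

End Clamp.

Lemma continuous_bounded_on (R : realType) (V W : normedModType R) (A : set V) (u : V -> W) :
  compact A -> (forall q, A q -> {for q, continuous u}) ->
  exists2 K, 0 <= K & forall q, A q -> `|u q| <= K.
Proof.
move=> cA cu.
have : bounded_set (u @` A).
  apply: compact_bounded; apply: continuous_compact => //.
  by apply: continuous_in_subspaceT => q; rewrite inE; exact: cu.
case=> M [Mr HM]; exists (`|M| + 1); first by rewrite addr_ge0.
move=> q Aq; apply: HM; last by exists q.
by rewrite (le_lt_trans (real_ler_norm Mr))// ltrDl.
Qed.

Lemma box_compact (R : realType) (a b c d : R) :
  compact [set q : R * R | a <= q.1 <= b /\ c <= q.2 <= d].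
Proof.
have -> : [set q : R * R | a <= q.1 <= b /\ c <= q.2 <= d] = `[a, b] `*` `[c, d].
  by apply/seteqP; split=> q /=; rewrite !in_itv.
by apply: compact_setX; exact: segment_compact.
Qed.

Definition clamp2 (R : realType) (M : R) (q : R * R) := (clamp M q.1, clamp M q.2).
Definition clampv (R : realType) (n : nat) (M : R) (x : 'cV[R]_n) : 'cV[R]_n :=
  \col_i clamp M (x i 0).

(** The clamp is 1-Lipschitz in each coordinate and maps into a compact square, on which the
    continuous partial derivatives are bounded. *)
Lemma blip_clamp2 (R : realType) (u : R * R -> R) (M : R) : 0 <= M ->
  Ck setT 1 (u : R * R -> R^o) -> blip (fun q => u (clamp2 M q)).
Proof.
move=> M0 [cu du].
have [d1 [c1 _]] := du (1, 0); have [d2 [c2 _]] := du (0, 1).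
have cB := @box_compact R (- M) M (- M) M; set B := [set _ | _] in cB.
have [K0 K00 H0] := @continuous_bounded_on _ _ R^o _ _ cB (fun q _ => cu q I).
have [K1 K10 H1] := @continuous_bounded_on _ _ R^o _ _ cB (fun q _ => c1 q I).
have [K2 K20 H2] := @continuous_bounded_on _ _ R^o _ _ cB (fun q _ => c2 q I).
have inB q : `|q - 0| <= M -> B q.
  by rewrite subr0 => /pair_norm_leP; rewrite !ler_norml.
have clB q : `|clamp2 M q - 0| <= M.
  by rewrite subr0; apply/pair_norm_leP; rewrite !clamp_le.
exists (K0 + (K1 + K2) * 2); first by rewrite addr_ge0// mulr_ge0// addr_ge0.
split=> [q|a b].
  apply: (le_trans (H0 _ (inB _ (clB q)))).
  by rewrite lerDl mulr_ge0// addr_ge0.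
have := @mean_value2 R R^o u 0 M (K1 + K2) 0 0 (fun q _ => conj (d1 q I) (d2 q I)).
move=> /(_ _ (clamp2 M b) (clamp2 M a) (clB b) (clB a)).
rewrite !scaler0 !subr0 => H.
have {}H : `|u (clamp2 M a) - u (clamp2 M b)| <=
    (K1 + K2) * (`|clamp M a.1 - clamp M b.1| + `|clamp M a.2 - clamp M b.2|).
  apply: H => q /inB Bq; rewrite !subr0; split.
    by apply: (le_trans (H1 q Bq)); rewrite lerDl.
  by apply: (le_trans (H2 q Bq)); rewrite lerDr.
apply: (le_trans H); rewrite [leRHS]mulrDl -[leLHS]add0r; apply: lerD; first exact: mulr_ge0.
rewrite -mulrA ler_wpM2l// ?addr_ge0//.
have /pair_norm_leP[/= n1 n2] : `|a - b| <= `|a - b| by [].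
have := clamp_lip M a.1 b.1; have := clamp_lip M a.2 b.2; lra.
Qed.

Lemma blip_clamp1 (R : realType) (n : nat) (u : R -> 'cV[R]_n.+1) (M : R) i : 0 <= M ->
  Ck setT 1 (u : R^o -> 'cV[R]_n.+1) -> blip (fun t : R^o => u (clamp M t) i 0).
Proof.
move=> M0 [cu du].
have [d1 [c1 _]] := du 1.
have cB := @segment_compact R (- M) M.
have [K0 K00 H0] := @continuous_bounded_on _ R^o _ _ _ cB (fun q _ => cu q I).
have [K1 K10 H1] := @continuous_bounded_on _ R^o _ _ _ cB (fun q _ => c1 q I).
have clB t : `[- M, M]%classic (clamp M t).
  by rewrite /= in_itv /= -ler_norml clamp_le.
exists (K0 + K1); first exact: addr_ge0.
split=> [t|a b].
  apply: le_trans (mx_norm_coord _ _ _) _.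
  by apply: (le_trans (H0 _ (clB t))); rewrite lerDl.
have D t : has_deriv `[- M, M] u t ('D_1 u t).
  apply: (@has_deriv_sub _ _ _ setT) => //; apply: has_deriv_shift.
  have := derivable_has_deriv (d1 t I).
  by under eq_fun do rewrite [_ *: 1]mulr1.
have := @mean_value_abs R _ `[- M, M] u (fun t => 'D_1 u t) 0 K1 (clamp M b) (clamp M a).
move=> /(_ (fun t _ _ => D t)); rewrite scaler0 subr0 => H.
have {}H : `|u (clamp M a) - u (clamp M b)| <= K1 * `|clamp M a - clamp M b|.
  apply: H => t; last by rewrite subr0 => _; exact: H1.
  have := clB a; have := clB b; rewrite /= !in_itv /= => /andP[? ?] /andP[? ?].
  by rewrite ge_min le_max => /andP[/orP[?|?] /orP[?|?]]; apply/andP; split; lra.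
have := mx_norm_coord (u (clamp M a) - u (clamp M b)) i 0; rewrite !mxE => H2.
apply: (le_trans H2); apply: (le_trans H).
rewrite mulrDl -[leLHS]add0r; apply: lerD; first exact: mulr_ge0.
by rewrite ler_wpM2l// clamp_lip.
Qed.

(* On the ellipsoid where [m0] bounds it, the denominator of [f] keeps the sign
   of its value [mu] at [x = 0]. *)
Definition ft (R : realType) (s : pll_cc R) (M m0 : R) (z : R * R * 'cV[R]_4) : R :=
  (g s (clamp2 M z.1) - dot (h s (clamp M z.1.2)) (clampv M z.2)) *
  (Num.sg (mu s) *
   Num.max m0 (Num.sg (mu s) * (mu s - dot (nu s) (clampv M z.2))))^-1.

Section Ft.
Context {R : realType} {s : pll_cc R} (M m0 Vbb : R).
Hypothesis Hs : standing_assumptions s.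
Hypothesis M0 : 0 <= M.
Hypothesis m00 : 0 < m0.
Hypothesis Hm0 : forall x, VCC s x <= Vbb ->
  m0 <= Num.sg (mu s) * (mu s - dot (nu s) x).

Lemma ft_id q x : `|q| <= M -> `|x| <= M -> VCC s x <= Vbb ->
  ft s M m0 (q, x) = f s q x.
Proof.
move=> /pair_norm_leP[q1 q2] xM xV.
have -> : ft s M m0 (q, x) = (g s q - dot (h s q.2) x) *
    (Num.sg (mu s) * Num.max m0 (Num.sg (mu s) * (mu s - dot (nu s) x)))^-1.
  rewrite /ft /clamp2 /= !clamp_id// -surjective_pairing.
  have -> // : clampv M x = x.
  apply/colP => i; rewrite mxE clamp_id//.
  exact: le_trans (mx_norm_coord _ _ _) xM.
rewrite max_r ?Hm0// mulrA -expr2 sqr_sg (mu_neq0 Hs) mul1r //.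
Qed.

Lemma blip_ft : blip (ft s M m0).
Proof.
have fst_lip (a b : R * R * 'cV[R]_4) : `|a.1 - b.1| <= `|a - b|.
  by have /pair_norm_leP[] : `|a - b| <= `|a - b| by [].
have snd_lip (a b : R * R * 'cV[R]_4) : `|a.2 - b.2| <= `|a - b|.
  by have /pair_norm_leP[] : `|a - b| <= `|a - b| by [].
have clv i : blip (fun z : R * R * 'cV[R]_4 => clamp M (z.2 i 0)).
  exists (M + 1); first by rewrite addr_ge0.
  split=> [a|a b]; first by apply: le_trans (clamp_le M0 _) _; rewrite lerDl.
  apply: le_trans (clamp_lip _ _ _) _; rewrite mulrDl mul1r -[leLHS]add0r.
  apply: lerD; first exact: mulr_ge0.
  apply: le_trans (snd_lip a b).
  by have := mx_norm_coord (a.2 - b.2) i 0; rewrite !mxE.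
have bd (c : R * R * 'cV[R]_4 -> 'cV[R]_4) : (forall i, blip (fun z => c z i 0)) ->
    blip (fun z => dot (c z) (clampv M z.2)).
  move=> Hc.
  under eq_fun do rewrite dotE; under eq_fun do under eq_bigr do rewrite mxE.
  apply: blip_sum => i; apply: blipM => //; exact: clv.
apply: blipM.
  apply: blipD.
    exact: (blip_comp fst_lip (blip_clamp2 M0 (g_smooth Hs 1%N))).
  apply: blipN; apply: bd => i.
  have snd2 (a b : R * R * 'cV[R]_4) : `|a.1.2 - b.1.2 : R^o| <= `|a - b|.
    apply: le_trans (fst_lip a b).
    by have /pair_norm_leP[] : `|a.1 - b.1| <= `|a.1 - b.1| by [].
  exact: (blip_comp snd2 (blip_clamp1 i M0 (h_smooth Hs 1%N))).
apply: (blipV m00) => [z|].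
  rewrite normrM normr_sg (mu_neq0 Hs) mul1r.
  by apply: le_trans (ler_norm _); rewrite le_max lexx.
apply: blipM; first exact: blip_cst.
have [K K0 [b1 b2]] : blip (fun z : R * R * 'cV[R]_4 =>
    Num.sg (mu s) * (mu s - dot (nu s) (clampv M z.2))).
  apply: blipM; first exact: blip_cst.
  apply: blipD; first exact: blip_cst.
  by apply: blipN; apply: bd => i; exact: blip_cst.
exists (K + m0); first by rewrite addr_ge0// ltW.
split=> [a|a b].
  have m0' := m00; have := b1 a; rewrite !ler_norml => /andP[? ?].
  by rewrite le_max ge_max; apply/andP; split; [apply/orP; left|apply/andP; split]; lra.
rewrite mulrDl -[leLHS]addr0; apply: lerD; last by rewrite mulr_ge0// ltW.
apply: le_trans (b2 a b).
set x := _ * (_ - dot _ (clampv M a.2)); set y := _ * _.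
have : `|x - y| <= `|x - y| by [].
rewrite ler_norml => /andP[? ?]; rewrite !maxEle.
have := normr_ge0 (x - y).
by case: (leP m0 x) => ?; case: (leP m0 y) => ? ?; rewrite ler_norml; apply/andP; split; lra.
Qed.

End Ft.

(** * The family of cycles *)

Definition cross (R : realType) (u v : R * R) : R := u.1 * v.2 - u.2 * v.1.

Lemma det2 (R : comNzRingType) (B : 'M[R]_2) :
  \det B = B 0 0 * B 1 1 - B 0 1 * B 1 0.
Proof.
rewrite (expand_det_row _ 0) !big_ord_recl big_ord0 addr0 /cofactor !det_mx11 !mxE.
have -> : lift 0 0 = 1 :> 'I_2 by apply/val_inj.
have -> : lift 1 0 = 0 :> 'I_2 by apply/val_inj.
rewrite /= expr0 mul1r expr1 mulN1r mulrN.
by congr (_ * B _ _ - B _ _ * B _ _); apply/val_inj.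
Qed.

Lemma jac2_det (R : realType) (p : R * R -> R * R) (y : R * R) :
  \det (jac2 p y) = cross ('D_(1, 0) p y) ('D_(0, 1) p y).
Proof.
rewrite det2 /jac2; do 4! rewrite mxE.
by rewrite [RHS]/cross; congr (_ - _); rewrite mulrC.
Qed.

(** Cramer's rule. *)
Lemma cross_span (R : realType) (u v w : R * R) : cross u v != 0 ->
  w = (cross w v / cross u v) *: u + (cross u w / cross u v) *: v.
Proof.
rewrite /cross => D; case: u v w D => [a b] [c d] [e f] /= D.
transitivity ((e * d - f * c) / (a * d - b * c) * a + (a * f - b * e) / (a * d - b * c) * c,
  (e * d - f * c) / (a * d - b * c) * b + (a * f - b * e) / (a * d - b * c) * d) => //.
by congr (_, _); field.
Qed.

Lemma cross_le (R : realType) (u v : R * R) : `|cross u v| <= 2 * `|u| * `|v|.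
Proof.
have /pair_norm_leP[u1 u2] : `|u| <= `|u| by [].
have /pair_norm_leP[v1 v2] : `|v| <= `|v| by [].
apply: (le_trans (ler_normB _ _)); rewrite !normrM.
have : `|u.1| * `|v.2| <= `|u| * `|v| by apply: ler_pM.
have : `|u.2| * `|v.1| <= `|u| * `|v| by apply: ler_pM.
lra.
Qed.

Record cycle_param (R : realType) (Vb : R) (C : R -> set (R * R))
    (p : R * R -> R * R) (U : R) : Prop := {
  cp_U : Vb < U;
  cp_range : forall V, 0 <= V <= Vb -> C V = range (fun t => p (V, t));
  cp_period : forall V t, p (V, t + 1) = p (V, t);
  cp_inj : forall V, 0 < V <= Vb -> {in `[0, 1[ &, injective (fun t => p (V, t))};
  cp_cont : {within [set q | 0 <= q.1 <= Vb], continuous p};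
  cp_C1 : Ck [set q | 0 < q.1 < U] 1 p;
  cp_det : forall q, 0 < q.1 <= Vb -> \det (jac2 p q) != 0
}.

Record cycle_setting (R : realType) (s : pll_cc R) (Vb : R) (C : R -> set (R * R))
    (VPLL : R * R -> R) (p : R * R -> R * R) (U : R) : Prop := {
  cs_assumptions : standing_assumptions s;
  cs_Vb : 0 < Vb;
  cs_family : limit_cycle_family s Vb C;
  cs_VPLL : is_VPLL Vb C VPLL;
  cs_param : cycle_param Vb C p U
}.

Section Family.
Context {R : realType} {s : pll_cc R} {Vb : R} {C : R -> set (R * R)}
  {VPLL : R * R -> R} {p : R * R -> R * R} {U : R}.
Hypothesis CS : cycle_setting s Vb C VPLL p U.
Let HVb := cs_Vb CS.
Let HC := cs_family CS.
Let HVPLL := cs_VPLL CS.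
Let Hp := cs_param CS.

Notation Reg := (region (C Vb)).

Lemma region_p V t : 0 <= V <= Vb -> Reg (p (V, t)).
Proof.
move=> /andP[V0 VVb]; have CV : C V (p (V, t)).
  by rewrite (cp_range Hp) ?V0//; exists t.
have [->|VVb'] := eqVneq V Vb.
  by left; rewrite (cp_range Hp) ?lexx ?andbT ?ltW//; exists t.
apply: (interior_subset (cycle_nested HC V0 _ (lexx Vb) _)); last by left.
by rewrite lt_neqAle VVb'.
Qed.

Lemma region_ex q : Reg q -> exists V t, 0 <= V <= Vb /\ q = p (V, t).
Proof.
move=> /(HVPLL.2)[V V0]; rewrite (cp_range Hp)// => -[t _ <-].
by exists V, t.
Qed.

Lemma VPLL_p V t : 0 <= V <= Vb -> VPLL (p (V, t)) = V.
Proof. by move=> V0; apply: HVPLL.1 => //; rewrite (cp_range Hp)//; exists t. Qed.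

Lemma region_int V t : 0 <= V < Vb -> (Reg)° (p (V, t)).
Proof.
move=> /andP[V0 VVb].
apply: (cycle_nested HC V0 VVb (lexx Vb)); left.
by rewrite (cp_range Hp) ?V0 ?ltW//; exists t.
Qed.

Lemma p_0 t : p (0, t) = 0.
Proof.
have : C 0 (p (0, t)) by rewrite (cp_range Hp) ?lexx ?ltW//; exists t.
by rewrite (cycle_0 HC).
Qed.

Lemma p_period_nat V t (n : nat) : p (V, t + n%:R) = p (V, t).
Proof.
elim: n => [|n IH]; first by rewrite addr0.
by rewrite -natr1 addrA (cp_period Hp).
Qed.

Lemma p_period_int V t (n : int) : p (V, t + n%:~R) = p (V, t).
Proof.
case: n => n; first exact: p_period_nat.
by rewrite NegzE mulrNz -(p_period_nat V _ n.+1) subrK.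
Qed.

Lemma p_frac V t a : exists2 n : int, a <= t + n%:~R < a + 1 & p (V, t + n%:~R) = p (V, t).
Proof.
exists (- Num.floor (t - a)); last exact: p_period_int.
have := floor_itv (t - a); rewrite intrD mulrNz mulr1z => /andP[? ?].
by apply/andP; split; lra.
Qed.

Lemma p_inj V t t' : 0 < V <= Vb -> p (V, t) = p (V, t') ->
  exists n : int, t' = t + n%:~R.
Proof.
move=> V0 E.
have [n Hn En] := p_frac V t 0; have [m Hm Em] := p_frac V t' 0.
have E' : t + n%:~R = t' + m%:~R.
  rewrite !add0r in Hn Hm.
  by apply: (cp_inj Hp V0) => //=; rewrite En Em.
exists (n - m); rewrite intrB; lra.
Qed.

Lemma C_disj V V' t t' : 0 <= V <= Vb -> 0 <= V' <= Vb -> p (V, t) = p (V', t') -> V = V'.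
Proof. by move=> V0 V'0 E; rewrite -(VPLL_p t V0) E VPLL_p. Qed.

(** The image of a rectangle under [p] is compact, so a point outside it has positive distance to
    it. The continuity of level and angle as functions of the point rests on this. *)
Lemma p_away c d a b q : 0 <= c -> d <= Vb ->
  (forall V t, c <= V <= d -> a <= t <= b -> p (V, t) <> q) ->
  exists2 r, 0 < r & forall V t, c <= V <= d -> a <= t <= b -> r <= `|p (V, t) - q|.
Proof.
move=> c0 dV away; pose B := [set y : R * R | c <= y.1 <= d /\ a <= y.2 <= b].
have cB : compact (p @` B).
  apply: continuous_compact; last exact: box_compact.
  apply: continuous_subspaceW (cp_cont Hp) => y [/andP[? ?] _] /=.
  by apply/andP; split; lra.
have : closed (p @` B) by apply: compact_closed => //; exact: norm_hausdorff.
move=> /closed_openC oB.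
have /nbhs_normP[r /= r0 Hr] : nbhs q (~` (p @` B)).
  apply: open_nbhs_nbhs; split=> // -[[V t] [/= VB tB] E].
  exact: away VB tB E.
exists r => // V t VB tB; rewrite leNgt; apply/negP => H.
by apply: (Hr (p (V, t))); [rewrite /= distrC|exists (V, t)].
Qed.

Lemma p_unit V t : exists2 t', 0 <= t' <= 1 & p (V, t') = p (V, t).
Proof.
have [n /andP[n1 n2] E] := p_frac V t 0; exists (t + n%:~R) => //.
by apply/andP; split; lra.
Qed.

Lemma VPLL_cont q rho : Reg q -> 0 < rho -> exists2 r, 0 < r &
  forall q', Reg q' -> `|q' - q| < r -> `|VPLL q' - VPLL q| < rho.
Proof.
move=> /region_ex[V [t [VV ->]]] rho0; have /andP[V0 V1] := VV.
have [|||r1 r10 H1] := @p_away (V + rho) Vb 0 1 (p (V, t)).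
- lra.
- by [].
- move=> V' t' /andP[V'1 V'2] _ E; have V'V : 0 <= V' <= Vb by apply/andP; split; lra.
  have := C_disj V'V VV E; lra.
have [|||r2 r20 H2] := @p_away 0 (V - rho) 0 1 (p (V, t)).
- by [].
- lra.
- move=> V' t' /andP[V'1 V'2] _ E; have V'V : 0 <= V' <= Vb by apply/andP; split; lra.
  have := C_disj V'V VV E; lra.
exists (Num.min r1 r2); first by rewrite lt_min r10.
move=> _ /region_ex[V' [t' [V'V ->]]]; rewrite lt_min => /andP[d1 d2].
rewrite !VPLL_p// ltNge; apply/negP => rr.
have [t'' t''1 E] := p_unit V' t'; rewrite -E in d1 d2.
have /andP[? ?] := V'V.
move: rr; rewrite ler_normr => /orP[rr|rr].
- have : r1 <= `|p (V', t'') - p (V, t)| by apply: H1 => //; apply/andP; split; lra.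
  by move=> /(lt_le_trans d1); rewrite ltxx.
- have : r2 <= `|p (V', t'') - p (V, t)| by apply: H2 => //; apply/andP; split; lra.
  by move=> /(lt_le_trans d2); rewrite ltxx.
Qed.

(** Within half a period on either side, [t] is the only angle of the point, since two angles of one
    point differ by an integer. The angles of that window at distance at least [rho] from [t] are
    then bounded away by compactness. *)
Lemma p_local V t rho : 0 < V <= Vb -> 0 < rho -> exists2 r, 0 < r &
  forall V' t', 0 <= V' <= Vb -> `|p (V', t') - p (V, t)| < r ->
  `|V' - V| < rho /\ exists n : int, `|t' + n%:~R - t| < rho.
Proof.
move=> /andP[V0 V1] rho0.
have VV : 0 <= V <= Vb by rewrite ltW.
have VV' : 0 < V <= Vb by rewrite V0.
have [r0 r00 H0] := VPLL_cont (region_p t VV) rho0.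
have key t' : 0 < `|t' - t| <= 1 / 2 -> p (V, t') <> p (V, t).
  move=> tt E; have [n] := p_inj VV' E.
  move: tt; rewrite normr_gt0 subr_eq0 => /andP[tt tt2] n1.
  have : `|n%:~R : R| <= 1 / 2.
    by apply: le_trans tt2; rewrite n1 distrC addrAC subrr add0r.
  have [n0|n0] := eqVneq n 0; first by move: tt; rewrite n1 n0 addr0 eqxx.
  rewrite -intr_norm.
  have : (1 <= `|n|)%R by rewrite -gtz0_ge1 normr_gt0.
  rewrite -(ler_int R) /=; lra.
have sep a b : (forall t', a <= t' <= b -> 0 < `|t' - t| <= 1 / 2) ->
    forall V' t', 0 <= V' <= Vb -> a <= t' <= b -> p (V', t') <> p (V, t).
  move=> ab V' t' V'V /ab tt E; have V'E := C_disj V'V VV E.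
  by move: E; rewrite V'E; exact: key.
have [|r1 r10 H1] := @p_away 0 Vb (t + rho) (t + 1 / 2) (p (V, t)) (lexx _) (lexx _) (sep _ _ _).
- move=> t' /andP[? ?].
  by rewrite ger0_norm; [apply/andP; split|]; lra.
have [|r2 r20 H2] := @p_away 0 Vb (t - 1 / 2) (t - rho) (p (V, t)) (lexx _) (lexx _) (sep _ _ _).
- move=> t' /andP[? ?].
  by rewrite ler0_norm; [apply/andP; split|]; lra.
exists (Num.min r0 (Num.min r1 r2)); first by rewrite !lt_min r00 r10.
move=> V' t' V'V; rewrite !lt_min => /andP[d0 /andP[d1 d2]]; split.
  by have := H0 _ (region_p t' V'V) d0; rewrite !VPLL_p.
have [n /andP[n1 n2] E] := p_frac V' t' (t - 1 / 2); exists n.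
rewrite ltNge; apply/negP => rr; rewrite -E in d1 d2.
move: rr; rewrite ler_normr => /orP[rr|rr].
- have : r1 <= `|p (V', t' + n%:~R) - p (V, t)| by apply: H1 => //; apply/andP; split; lra.
  by move=> /(lt_le_trans d1); rewrite ltxx.
- have : r2 <= `|p (V', t' + n%:~R) - p (V, t)| by apply: H2 => //; apply/andP; split; lra.
  by move=> /(lt_le_trans d2); rewrite ltxx.
Qed.
End Family.

Lemma cross_lower (R : realType) (u v : R * R) : cross u v != 0 ->
  exists2 k, 0 < k & forall a b : R, k * `|a| <= `|a *: u + b *: v| /\
    k * `|b| <= `|a *: u + b *: v|.
Proof.
move=> D; have D0 : 0 < `|cross u v| by rewrite normr_gt0.
pose m := 2 * (`|u| + `|v|) + 1.
have m0 : 0 < m by rewrite ltr_wpDl// mulr_ge0// addr_ge0.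
exists (`|cross u v| / m); first by rewrite divr_gt0.
move=> a b; set w := a *: u + b *: v.
have E1 : a * cross u v = cross w v.
  by rewrite /w; case: u v {D D0 m m0 w} => [? ?] [? ?]; rewrite /cross /= /GRing.scale /=; ring.
have E2 : b * cross u v = cross u w.
  by rewrite /w; case: u v {D D0 m m0 w E1} => [? ?] [? ?]; rewrite /cross /= /GRing.scale /=; ring.
have w0 := normr_ge0 w; have u0 := normr_ge0 u; have v0 := normr_ge0 v.
have E3 := cross_le w v; have E4 := cross_le u w.
rewrite -E1 normrM in E3; rewrite -E2 normrM in E4.
by split; rewrite mulrAC ler_pdivrMr// [leLHS]mulrC;
  [apply: (le_trans E3)|apply: (le_trans E4)]; rewrite /m; nra.
Qed.

Section Strong.
Context {R : realType} {s : pll_cc R} {Vb : R} {C : R -> set (R * R)}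
  {VPLL : R * R -> R} {p : R * R -> R * R} {U : R}.
Hypothesis CS : cycle_setting s Vb C VPLL p U.

Notation Reg := (region (C Vb)).
Notation pV := (fun y : R * R => 'D_(1, 0) p y).
Notation ps := (fun y : R * R => 'D_(0, 1) p y).

Lemma p_derivable y v : 0 < y.1 < U -> derivable p y v.
Proof. by have [_ /(_ v)[d _]] := cp_C1 (cs_param CS); exact: d. Qed.

Lemma Dp_continuous y v : 0 < y.1 < U -> {for y, continuous (fun y => 'D_v p y)}.
Proof. by have [_ /(_ v)[_ [d _]]] := cp_C1 (cs_param CS); exact: d. Qed.

Lemma cross_p_neq0 y : 0 < y.1 <= Vb -> cross (pV y) (ps y) != 0.
Proof. by move=> y0; rewrite -jac2_det; exact: (cp_det (cs_param CS)). Qed.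

(** Strict differentiability: both [a] and [b] vary. Differentiability at [y] alone would not give
    local injectivity or the Lipschitz bound on [VPLL]. *)
Lemma p_strong_diff y e : 0 < y.1 <= Vb -> 0 < e -> exists2 r, 0 < r &
  forall a b, `|a - y| <= r -> `|b - y| <= r ->
  `|p b - p a - (b.1 - a.1) *: pV y - (b.2 - a.2) *: ps y| <=
     e * (`|b.1 - a.1| + `|b.2 - a.2|).
Proof.
move=> /andP[y0 y1] e0; have VU := cp_U (cs_param CS).
have yU : 0 < y.1 < U by rewrite y0 (le_lt_trans y1).
have [d1 d10 H1] := (cont_epsP _ _).1 (Dp_continuous (v := (1, 0)) yU) e e0.
have [d2 d20 H2] := (cont_epsP _ _).1 (Dp_continuous (v := (0, 1)) yU) e e0.
(* The last two bounds keep the square inside the strip [0 < V < U] where [p] is continuously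
   differentiable, also around the outermost cycle. *)
pose r := Num.min (Num.min (d1 / 2) (d2 / 2)) (Num.min (y.1 / 2) ((U - Vb) / 2)).
have r0 : 0 < r by rewrite !lt_min; repeat (apply/andP; split); lra.
have [[r1 r2] [r3 r4]] : (r <= d1 / 2 /\ r <= d2 / 2) /\ (r <= y.1 / 2 /\ r <= (U - Vb) / 2).
  by rewrite /r !ge_min !lexx !orbT.
exists r => //.
have inU q : `|q - y| <= r -> 0 < q.1 < U.
  by move=> /pair_norm_leP[]; rewrite ler_norml /= => /andP[? ?] _; apply/andP; split; lra.
apply: mean_value2 => q qy.
  by split; apply: p_derivable; exact: inU.
by split; apply: ltW; [apply: H1|apply: H2]; lra.
Qed.

(** A quantitative substitute for the inverse function theorem: an error of [k / 4] for each
    coordinate uses up at most half of the lower bound [k] for the linear part. *)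
Lemma p_strong_inj y : 0 < y.1 <= Vb -> exists k r, [/\ 0 < k, 0 < r &
  forall a b, `|a - y| <= r -> `|b - y| <= r -> k * `|b - a| <= `|p b - p a|].
Proof.
move=> y0; have D := cross_p_neq0 y0.
set u := pV y in D; set v := ps y in D.
have [k k0 low] := cross_lower D.
have e0 : 0 < k / 4 by lra.
have [r r0 Hr] := p_strong_diff y0 e0.
exists (k / 2), r; split=> //; first by lra.
move=> a b ay b_y; have := Hr a b ay b_y; rewrite -/u -/v.
have [] := low (b.1 - a.1) (b.2 - a.2).
set w := _ *: u + _ *: v => L1 L2.
have -> : p b - p a - (b.1 - a.1) *: u - (b.2 - a.2) *: v = p b - p a - w.
  by rewrite /w opprD addrA.
move=> X; have := lerB_dist w (p b - p a); rewrite [`|w - _|]distrC => Y.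
have Z : `|b - a| <= `|b.1 - a.1| \/ `|b - a| <= `|b.2 - a.2|.
  by rewrite prod_normE /=; case: (leP `|b.1 - a.1| `|b.2 - a.2|) => hh; [right|left].
have := normr_ge0 (b.1 - a.1); have := normr_ge0 (b.2 - a.2) => ? ?.
by case: (leP `|b.1 - a.1| `|b.2 - a.2|) => hh; case: Z => Z; nra.
Qed.

(** Near such a point [VPLL] is the first coordinate of a local inverse of [p], up to an integer
    shift of the angle that [p] does not see. *)
Lemma VPLL_lip V t : 0 < V <= Vb -> exists K r, [/\ 0 <= K, 0 < r &
  forall q q', Reg q -> Reg q' -> `|q - p (V, t)| < r -> `|q' - p (V, t)| < r ->
    `|VPLL q - VPLL q'| <= K * `|q - q'|].
Proof.
move=> V0; have [k [r [k0 r0 Hk]]] := @p_strong_inj (V, t) V0.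
have [d d0 Hd] := p_local CS t V0 r0.
exists k^-1, d; split=> //; first by rewrite invr_ge0 ltW.
move=> _ _ /(region_ex CS)[V1 [t1 [V1b ->]]] /(region_ex CS)[V2 [t2 [V2b ->]]] q1 q2.
rewrite !(VPLL_p CS)//.
have [v1 [n1 w1]] := Hd _ _ V1b q1; have [v2 [n2 w2]] := Hd _ _ V2b q2.
rewrite -(p_period_int CS V1 t1 n1) -(p_period_int CS V2 t2 n2).
rewrite ler_pdivlMl//; apply: le_trans (Hk (V2, t2 + n2%:~R) (V1, t1 + n1%:~R) _ _).
- by rewrite ler_pM2l// prod_normE le_max /= lexx.
- by apply/pair_norm_leP; split=> /=; apply: ltW.
- by apply/pair_norm_leP; split=> /=; apply: ltW.
Qed.

Definition Lam (V : R) : set (R * R) := [set q | Reg q /\ VPLL q <= V].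

Lemma Lam_int V' V t : 0 <= V' < V -> V <= Vb -> exists2 r, 0 < r &
  forall q, `|q - p (V', t)| < r -> Lam V q.
Proof.
move=> /andP[V'0 V'V] VVb.
have V'b : 0 <= V' <= Vb by apply/andP; split; lra.
have [|r1 r10 H1] := VPLL_cont CS (region_p CS t V'b) (_ : 0 < V - V'); first by lra.
have : (Reg)° (p (V', t)) by apply: (region_int CS); apply/andP; split; lra.
move=> /nbhs_normP[r2 /= r20 H2].
exists (Num.min r1 r2); first by rewrite lt_min r10.
move=> q; rewrite lt_min => /andP[q1 q2].
have Rq : Reg q by apply: H2; rewrite /= distrC.
split=> //; have := H1 q Rq q1; rewrite (VPLL_p CS)// ltr_norml => /andP[_]; lra.
Qed.

Lemma Lam_p V q : V <= Vb -> Lam V q <->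
  exists V' t, [/\ 0 <= V', V' <= V & q = p (V', t)].
Proof.
move=> VVb; split.
  move=> [/(region_ex CS)[V' [t [V'b ->]]]]; rewrite (VPLL_p CS)// => V'V.
  by exists V', t; case/andP: V'b.
move=> [V' [t [V'0 V'V ->]]].
have V'b : 0 <= V' <= Vb by rewrite V'0 (le_trans V'V).
by split; [exact: (region_p CS t V'b)|rewrite (VPLL_p CS t V'b)].
Qed.

Lemma Lam_closest V q : 0 <= V <= Vb -> exists V' t, [/\ 0 <= V', V' <= V &
  forall q', Lam V q' -> `|q - p (V', t)| <= `|q - q'|].
Proof.
move=> /andP[V0 VVb]; pose B := [set y : R * R | 0 <= y.1 <= V /\ 0 <= y.2 <= 1].
have B0 : B !=set0 by exists (0, 0); rewrite /B /= !lexx V0 ler01.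
have cB : compact B := @box_compact R 0 V 0 1.
have cp : {within B, continuous (fun y => `|q - p y|)}.
  have cpB : {within B, continuous p}.
    apply: continuous_subspaceW (cp_cont (cs_param CS)) => y [/andP[? ?] _] /=.
    by apply/andP; split=> //; exact: le_trans VVb.
  move=> y; apply: (@continuous_comp (subspace B) _ _ p (fun w => `|q - w|)); first exact: cpB.
  apply: continuous_comp; last exact: norm_continuous.
  by apply: continuousB; [exact: cst_continuous|move=> ?].
have [[V' t]] := compact_EVT_min B0 cB cp.
rewrite inE => -[/= /andP[V'0 V'V] t01] Hmin.
exists V', t; split=> // q' /(Lam_p _ VVb)[V2 [t2 [V20 V2V ->]]].
have [t' t'01 <-] := p_unit CS V2 t2.
by apply: (Hmin (V2, t')); rewrite inE; split=> //=; rewrite V20.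
Qed.

(* A segment that leaves the closed region leaves it through the outer cycle,
   since every other point of the region is interior. *)
Lemma region_exit a c : Reg a -> ~ Reg c -> exists2 b, Reg b /\ VPLL b = Vb &
  `|b - a| <= `|c - a|.
Proof.
move=> Ra Rc; pose gm (r : R) := a + r *: (c - a).
pose S := [set r : R | 0 <= r <= 1 /\ Reg (gm r)].
have S0 : S 0 by split; rewrite ?lexx ?ler01// /gm scale0r addr0.
have subS : has_ubound S by exists 1 => r [/andP[_ ?]].
have supS : has_sup S by split=> //; exists 0.
set r := sup S.
have Sle x : S x -> x <= r by move=> Sx; exact: (ub_le_sup subS).
have r0 : 0 <= r := Sle _ S0.
have r1 : r <= 1 by apply: ge_sup; [exists 0|move=> x [/andP[_ ?]]].
have gmE x : gm x - gm r = (x - r) *: (c - a).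
  by rewrite /gm opprD addrACA subrr add0r scalerBl.
(* The region is closed: points of it on the segment come arbitrarily close to [gm r], so the
   closest point of the region to [gm r] is at distance 0. *)
have Rr : Reg (gm r).
  have Vb0 : 0 <= Vb <= Vb by rewrite lexx ltW// (cs_Vb CS).
  have [V' [t [V'0 V'V Hm]]] := Lam_closest (gm r) Vb0.
  have Rp : Reg (p (V', t)) by apply: (region_p CS); rewrite V'0.
  suff E : `|gm r - p (V', t)| <= 0.
    by move: E; rewrite normr_le0 subr_eq0 => /eqP ->.
  apply/ler_addgt0Pr => e e0; rewrite add0r.
  have n0 : 0 < `|c - a| + 1 by rewrite ltr_wpDl.
  have [x [x01 Rx] xr] := sup_adherent (divr_gt0 e0 n0) supS.
  have Lx : Lam Vb (gm x).
    split=> //; have [V2 [t2 [V2b ->]]] := region_ex CS Rx.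
    by rewrite (VPLL_p CS)//; case/andP: V2b.
  apply: (le_trans (Hm _ Lx)); rewrite distrC gmE normrZ.
  have xr' := Sle x (conj x01 Rx).
  rewrite ler0_norm ?subr_le0// opprB -/r in xr *.
  move: xr; rewrite ltrBlDr -ltrBlDl ltr_pdivlMr//.
  have := normr_ge0 (c - a); nra.
have ca : 0 < `|c - a|.
  by rewrite normr_gt0 subr_eq0; apply/eqP => E; apply: Rc; rewrite E.
exists (gm r); last first.
  rewrite /gm addrC addKr normrZ ger0_norm// ler_piMl//.
split=> //; have [V' [t [V'b E]]] := region_ex CS Rr.
rewrite E (VPLL_p CS)//; apply/eqP; rewrite eq_le; case/andP: (V'b) => V'0 -> /=.
rewrite leNgt; apply/negP => V'Vb.
have : (Reg)° (gm r) by rewrite E; apply: (region_int CS); rewrite V'0.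
move=> /nbhs_normP[d /= d0 Hd].
have r1' : r < 1.
  rewrite lt_neqAle r1 andbT; apply/eqP => r1'; apply: Rc.
  by move: Rr; rewrite /gm r1' scale1r addrC subrK.
pose x := Num.min 1 (r + d / (2 * `|c - a|)).
have rx : r < x by rewrite lt_min r1' ltrDl divr_gt0// mulr_gt0.
have : x <= r.
  apply: Sle; split; first by rewrite (le_trans r0 (ltW rx)) ge_min lexx.
  apply: Hd; rewrite /= distrC gmE normrZ gtr0_norm ?subr_gt0//.
  rewrite -ltr_pdivlMr//.
  have : x <= r + d / (2 * `|c - a|) by rewrite ge_min lexx orbT.
  have -> : d / (2 * `|c - a|) = d / `|c - a| / 2 by field; rewrite gt_eqF.
  have : 0 < d / `|c - a| by rewrite divr_gt0.
  lra.
by rewrite leNgt rx.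
Qed.

End Strong.

Lemma finite_isolated (R : realType) (F : set R) (t : R) : finite_set F ->
  exists2 d, 0 < d & forall r, F r -> r != t -> d <= `|r - t|.
Proof.
move=> /finite_seqP[l ->]; elim: l => [|x l [d d0 IH]]; first by exists 1.
have [xt|xt] := eqVneq x t.
  exists d => // r /=; rewrite inE => /orP[/eqP->|rl]; first by rewrite xt eqxx.
  exact: IH.
exists (Num.min d `|x - t|); first by rewrite lt_min d0 normr_gt0 subr_eq0.
move=> r /=; rewrite inE ge_min => /orP[/eqP->|rl]; first by rewrite lexx orbT.
by move=> /(IH r rl) ->.
Qed.

Lemma locally_finite_isolated (R : realType) (E : set R) (t : R) :
  (forall a b : R, finite_set (E `&` `[a, b])) ->
  exists2 d, 0 < d & forall r, 0 < `|r - t| < d -> ~ E r.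
Proof.
move=> HE; have [d d0 Hd] := finite_isolated t (HE (t - 1) (t + 1)).
exists (Num.min d 1); first by rewrite lt_min d0 ltr01.
move=> r /andP[rt]; rewrite lt_min => /andP[rd r1] Er.
have := Hd r; rewrite -subr_eq0 -normr_gt0 rt => H.
suff : d <= `|r - t| by rewrite leNgt rd.
apply: H => //; split=> //=; rewrite in_itv /=.
by move: r1; rewrite ltr_norml => /andP[? ?]; apply/andP; split; lra.
Qed.

(** * Values of f on an ellipsoid and their extremes *)

Section Extremes.
Context {R : realType} {s : pll_cc R}.
Hypothesis Hs : standing_assumptions s.

(** The vector is [mu ^+ 2] times the gradient of [f s q] at [x = 0]. Were it zero, [f s q] would be
    the constant [g s q / mu s] wherever it is defined, and its gradient at 0 would vanish. *)
Lemma f_spread_direction q : g s q *: nu s - mu s *: h s q.2 != 0.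
Proof.
apply/eqP => c0; have mu0 := mu_neq0 Hs.
have fc x : dot (nu s) x != mu s -> f s q x = g s q / mu s.
  move=> xs; have D : mu s - dot (nu s) x != 0 by rewrite subr_eq0 eq_sym.
  have E : dot (g s q *: nu s - mu s *: h s q.2) x = 0.
    by rewrite c0 dotE big1// => i _; rewrite mxE mul0r.
  rewrite dotBl !dotZl in E.
  rewrite /f; apply/eqP; rewrite eqr_div//; apply/eqP; lra.
have n0 : dot (nu s) 0 != mu s by rewrite dot0r eq_sym.
have /negP := grad_f_neq0 Hs q n0; apply; apply/eqP/colP => i; rewrite !mxE.
rewrite /derive; apply: cvg_lim; first exact: Rhausdorff.
apply: cvg_near_cst.
(* Increments [r] below this radius keep the denominator of [f] away from 0. *)
have K0 : 0 < 4 * `|nu s| + 1 by rewrite ltr_wpDl// mulr_ge0.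
exists (`|mu s| / (4 * `|nu s| + 1)); first by rewrite /= divr_gt0// normr_gt0.
move=> r /=; rewrite distrC subr0 ltr_pdivlMr// => r1 r0.
rewrite addr0 !fc ?subrr ?scaler0//.
rewrite dotZr; apply/eqP => E.
have : `|mu s| <= 4 * `|nu s| * `|r|.
  rewrite -E normrM mulrC ler_wpM2r//; apply: (le_trans (dot_norm_le _ _)).
  rewrite -[leRHS]mulr1 ler_wpM2l ?mulr_ge0//.
  by apply/mx_norm_leP => // k l; rewrite mxE; case: (_ && _); rewrite ?normr1 ?normr0.
have := normr_ge0 (nu s); have : 0 < `|r| by rewrite normr_gt0.
nra.
Qed.

(** Along the direction [c] of the gradient the difference [f s q (e *: c) - f s q 0] is
    [e * dot c c] over a product that stays positive on the ellipsoid, so it has the sign of [e]. *)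
Lemma f_spread V q : 0 < V -> nonsingular s V -> exists x1 x2,
  [/\ VCC s x1 <= V, VCC s x2 <= V, f s q x1 < f s q 0 & f s q 0 < f s q x2].
Proof.
move=> V0 ns; have mu0 := mu_neq0 Hs; have [m0 m00 Hm] := den_sign Hs (ltW V0) ns.
set c := g s q *: nu s - mu s *: h s q.2.
have cc : 0 < dot c c := dot_gt0 (f_spread_direction q).
have W0 := VCC_ge0 Hs c.
pose r := Num.min 1 (V / (VCC s c + 1)).
have r0 : 0 < r by rewrite lt_min ltr01 divr_gt0// ltr_wpDl.
have rV (e : R) : e ^+ 2 = r ^+ 2 -> VCC s (e *: c) <= V.
  move=> eE; rewrite VCCZ eE.
  have r1 : r <= 1 by rewrite ge_min lexx.
  have : r <= V / (VCC s c + 1) by rewrite ge_min lexx orbT.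
  rewrite ler_pdivlMr ?ltr_wpDl//; nra.
have D e : e ^+ 2 = r ^+ 2 -> 0 < mu s * (mu s - dot (nu s) (e *: c)) /\
    f s q (e *: c) - f s q 0 = e * dot c c / (mu s * (mu s - dot (nu s) (e *: c))).
  move=> /rV eV; have := Hm _ eV => pos.
  have P : 0 < mu s * (mu s - dot (nu s) (e *: c)).
    rewrite {1}[mu s]numEsg mulrAC mulr_gt0 ?normr_gt0//; exact: lt_le_trans pos.
  split=> //; have d0 : mu s - dot (nu s) (e *: c) != 0.
    by apply: contraTneq P => ->; rewrite mulr0 ltxx.
  have E : dot c c = g s q * dot (nu s) c - mu s * dot (h s q.2) c.
    by rewrite {1}/c dotBl !dotZl.
  rewrite /f E !dotZr !dot0r !subr0 in d0 *.
  by field; rewrite mu0 d0.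
have sq : (- r) ^+ 2 = r ^+ 2 by rewrite sqrrN.
exists ((- r) *: c), (r *: c); split; [exact: rV|exact: rV| |].
  have [P E] := D _ sq; rewrite -subr_lt0 E mulNr mulNr oppr_lt0 divr_gt0// mulr_gt0//.
have [P E] := D _ erefl; rewrite -subr_gt0 E divr_gt0// mulr_gt0//.
Qed.

(** [q] lies strictly inside the box, so that a whole neighbourhood of [q] is covered and continuity
    statements about [f] can be transferred from [ft]. *)
Lemma f_ft V (q : R * R) : 0 <= V -> nonsingular s V -> exists M m0 : R,
  [/\ blip (ft s M m0), `|q| < M & forall (q' : R * R) x, `|q'| <= M -> VCC s x <= V ->
     ft s M m0 (q', x) = f s q' x].
Proof.
move=> V0 ns; have [m0 m00 Hm] := den_sign Hs V0 ns.
have [M M0 HM] := VCC_bounded Hs V.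
have M1 : 0 <= M + `|q| by rewrite addr_ge0// ltW.
exists (M + `|q|), m0; split.
- exact: (blip_ft Hs M1 m00).
- by rewrite ltrDr.
- move=> q' x q'M xV; apply: (ft_id Hs Hm) => //.
  by apply: le_trans (ltW (HM _ xV)) _; rewrite lerDl.
Qed.

(** [minimum] is a choice with a default value, so it has to be shown first that the minimum is
    attained: [f] agrees on the compact ellipsoid with a continuous function. *)
Lemma fstar_le V q x : 0 <= V -> nonsingular s V -> VCC s x <= V -> 0 <= q.2 ->
  fstar s V q <= f s q x.
Proof.
move=> V0 ns xV q0; rewrite /fstar q0.
have [M [m0 [bl /ltW qM ftE]]] := f_ft q V0 ns.
have ct : continuous (fun x => ft s M m0 (q, x)).
  apply: blip_continuous; apply: blip_comp bl => a b.
  by rewrite prod_normE ge_max /= subrr normr0 normr_ge0 lexx.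
have ne : [set x | VCC s x <= V] !=set0 by exists 0; rewrite /= VCC0.
have [c] := compact_EVT_min ne (@ellipsoid_compact R s Hs V) (continuous_subspaceT ct).
rewrite inE => cV cmin.
have [] : [set m | (f s q @` [set x | VCC s x <= V]) m /\
    lbound (f s q @` [set x | VCC s x <= V]) m] (minimum (f s q @` [set x | VCC s x <= V])).
  apply: getPex; exists (f s q c); split; first by exists c.
  move=> _ [y yV <-]; rewrite -!ftE//.
  by apply: cmin; rewrite inE.
by move=> _; apply; exists x.
Qed.

Lemma fstar_ge V q x : 0 <= V -> nonsingular s V -> VCC s x <= V -> q.2 < 0 ->
  f s q x <= fstar s V q.
Proof.
move=> V0 ns xV q0; rewrite /fstar [0 <= _]leNgt q0 /=.
have [M [m0 [bl /ltW qM ftE]]] := f_ft q V0 ns.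
have ct : continuous (fun x => ft s M m0 (q, x)).
  apply: blip_continuous; apply: blip_comp bl => a b.
  by rewrite prod_normE ge_max /= subrr normr0 normr_ge0 lexx.
have ne : [set x | VCC s x <= V] !=set0 by exists 0; rewrite /= VCC0.
have [c] := compact_EVT_max ne (@ellipsoid_compact R s Hs V) (continuous_subspaceT ct).
rewrite inE => cV cmin.
have [] : [set m | (f s q @` [set x | VCC s x <= V]) m /\
    ubound (f s q @` [set x | VCC s x <= V]) m] (maximum (f s q @` [set x | VCC s x <= V])).
  apply: getPex; exists (f s q c); split; first by exists c.
  move=> _ [y yV <-]; rewrite -!ftE//.
  by apply: cmin; rewrite inE.
by move=> _; apply; exists x.
Qed.

End Extremes.

(* The rate of change of the cycle parameter [V] at the point [p y] under the
   PLL equations, when [f] takes the value [c] there. *)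
Definition alpha (R : realType) (s : pll_cc R) (p : R * R -> R * R) (y : R * R) (c : R) : R :=
  cross (pll_rhs s c (p y)) ('D_(0, 1) p y) / cross ('D_(1, 0) p y) ('D_(0, 1) p y).

Lemma cross_snd0 (R : realType) (u v : R * R) : v.2 = 0 -> cross u v = - (u.2 * v.1).
Proof. by rewrite /cross => ->; rewrite mulr0 sub0r. Qed.

Lemma cross_cvg (R : realType) (T : Type) (F : set_system T) (FF : Filter F)
    (u v : T -> R * R) (a b : R * R) :
  u @ F --> a -> v @ F --> b -> (cross (u x) (v x) @[x --> F]) --> cross a b.
Proof.
move=> ua vb.
have u1 : (u x).1 @[x --> F] --> a.1 by exact: cvg_comp ua cvg_fst.
have u2 : (u x).2 @[x --> F] --> a.2 by exact: cvg_comp ua cvg_snd.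
have v1 : (v x).1 @[x --> F] --> b.1 by exact: cvg_comp vb cvg_fst.
have v2 : (v x).2 @[x --> F] --> b.2 by exact: cvg_comp vb cvg_snd.
by apply: cvgB; apply: cvgM.
Qed.

Section Alpha.
Context {R : realType} {s : pll_cc R} {Vb : R} {C : R -> set (R * R)}
  {VPLL : R * R -> R} {p : R * R -> R * R} {U : R}.
Hypothesis CS : cycle_setting s Vb C VPLL p U.

Notation pV := (fun y : R * R => 'D_(1, 0) p y).
Notation ps := (fun y : R * R => 'D_(0, 1) p y).

Lemma p_continuous y : 0 < y.1 <= Vb -> {for y, continuous p}.
Proof.
have VU := cp_U (cs_param CS); move=> /andP[y0 y1].
have [H _] := cp_C1 (cs_param CS); apply: H.
by rewrite /= y0 (le_lt_trans y1).
Qed.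

Lemma Dp_continuous' y v : 0 < y.1 <= Vb -> {for y, continuous (fun y => 'D_v p y)}.
Proof.
have VU := cp_U (cs_param CS); move=> /andP[y0 y1].
by apply: (Dp_continuous CS); rewrite y0 (le_lt_trans y1).
Qed.

Lemma alpha_continuous (y : R * R) (c : R) : 0 < y.1 <= Vb ->
  {for (y, c), continuous (fun w : R * R * R => alpha s p w.1 w.2 : R^o)}.
Proof.
move=> y0; rewrite /prop_for /continuous_at /=.
have f1 : w.1 @[w --> (y, c)] --> y by exact: cvg_fst.
have f2 : w.2 @[w --> (y, c)] --> c by exact: cvg_snd.
have P : p w.1 @[w --> (y, c)] --> p y by exact: cvg_comp f1 (p_continuous y0).
have PV : pV w.1 @[w --> (y, c)] --> pV y.
  exact: cvg_comp f1 (Dp_continuous' (v := (1, 0)) y0).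
have PS : ps w.1 @[w --> (y, c)] --> ps y.
  exact: cvg_comp f1 (Dp_continuous' (v := (0, 1)) y0).
have X : pll_rhs s w.2 (p w.1) @[w --> (y, c)] --> pll_rhs s c (p y).
  have P2 : (p w.1).2 @[w --> (y, c)] --> (p y).2 by exact: cvg_comp P cvg_snd.
  have X1 : (- kp s * w.2 + (p w.1).2) @[w --> (y, c)] --> - kp s * c + (p y).2.
    by apply: cvgD => //; apply: cvgM => //; exact: cvg_cst.
  have X2 : (- ki s * w.2) @[w --> (y, c)] --> - ki s * c.
    by apply: cvgM => //; exact: cvg_cst.
  exact: (cvg_pair X1 X2).
have NZ := cross_p_neq0 CS y0.
have FF : Filter (nbhs (y, c)) by exact: nbhs_filter.
have Y1 := cross_cvg FF X PS; have Y2 := cross_cvg FF PV PS.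
exact: cvgM Y1 (cvgV NZ Y2).
Qed.

Lemma Dp_period V t (n : int) v : 'D_v p (V, t + n%:~R) = 'D_v p (V, t).
Proof.
have E : p \o shift (V, t + n%:~R) = p \o shift (V, t).
  apply/funext => -[a b].
  transitivity (p (a + V, b + t + n%:~R)); first by rewrite -addrA.
  by rewrite (p_period_int CS).
by rewrite /derive E (p_period_int CS).
Qed.

Lemma alpha_period V t (n : int) c : alpha s p (V, t + n%:~R) c = alpha s p (V, t) c.
Proof. by rewrite /alpha !Dp_period (p_period_int CS). Qed.

Lemma ps_neq0 y : 0 < y.1 <= Vb -> ps y != 0.
Proof.
move=> y0; apply: contraNneq (cross_p_neq0 CS y0) => E.
by rewrite /cross E /= !mulr0 subrr.
Qed.

Lemma pll_rhs_decomp y c : 0 < y.1 <= Vb -> pll_rhs s c (p y) =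
  alpha s p y c *: pV y +
  (cross (pV y) (pll_rhs s c (p y)) / cross (pV y) (ps y)) *: ps y.
Proof. by move=> y0; apply: cross_span; exact: cross_p_neq0 CS _ y0. Qed.

(* The topmost point of the region orients the parametrization: it lies on the
   outermost cycle, where [ps] is horizontal and [pV] points upwards. *)
Lemma top_point V : 0 < V <= Vb -> exists t,
  [/\ 0 < (p (V, t)).2, (ps (V, t)).2 = 0 & 0 < (pV (V, t)).2].
Proof.
move=> V0; have /andP[V1 V2] := V0.
pose B := [set y : R * R | 0 <= y.1 <= V /\ 0 <= y.2 <= 1].
have B0 : B !=set0 by exists (0, 0); rewrite /B /= !lexx (ltW V1) ler01.
have cB : compact B := @box_compact R 0 V 0 1.
have cp : {within B, continuous (fun y => (p y).2)}.
  have cpB : {within B, continuous p}.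
    apply: continuous_subspaceW (cp_cont (cs_param CS)) => y [/andP[? ?] _] /=.
    by apply/andP; split=> //; exact: le_trans V2.
  move=> y; apply: (@continuous_comp (subspace B) _ _ p snd); first exact: cpB.
  exact: cvg_snd.
have [[V' t]] := compact_EVT_max B0 cB cp.
rewrite inE => -[/= /andP[V'0 V'V] t01] Hmax.
have top q : @Lam R Vb C VPLL V q -> q.2 <= (p (V', t)).2.
  move=> /(Lam_p CS q V2)[V3 [t3 [V30 V3V ->]]].
  have [t' t'01 <-] := p_unit CS V3 t3.
  by apply: (Hmax (V3, t')); rewrite inE; split=> //=; rewrite V30.
have up r (q : R * R) : 0 < r -> `|(q.1, q.2 + r / 2) - q| < r.
  move=> r0; apply/pair_norm_ltP => /=; rewrite subrr normr0 addrAC subrr add0r.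
  by split=> //; rewrite gtr0_norm; lra.
(* A point of a smaller cycle is interior to [Lam V], and a slightly higher point would still belong
   to it. *)
have V'E : V' = V.
  apply/eqP; rewrite eq_le V'V /= leNgt; apply/negP => V'lt.
  have [|r r0 Hr] := Lam_int CS t (V' := V') _ V2; first by rewrite V'0.
  have := top _ (Hr _ (up r _ r0)) => /=; lra.
subst V'.
have pos : 0 < (p (V, t)).2.
  have [|r r0 Hr] := Lam_int CS 0 (V' := 0) _ V2; first by rewrite lexx.
  have := top _ (Hr _ (up r _ r0)); rewrite (p_0 CS) /= add0r; lra.
have LamV V3 t3 : 0 <= V3 -> V3 <= V -> (p (V3, t3)).2 <= (p (V, t)).2.
  by move=> ? ?; apply: top; apply/(Lam_p CS _ V2); exists V3, t3.
have coord2 (a b u v : R * R) (x y e : R) : `|b - a - x *: u - y *: v| <= e ->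
    `|b.2 - a.2 - x * u.2 - y * v.2| <= e by move=> /pair_norm_leP[].
have s0 : (ps (V, t)).2 = 0.
  apply/eqP; rewrite -normr_le0; apply/ler_addgt0Pr => e e0; rewrite add0r.
  have [r r0 Hr] := p_strong_diff CS (y := (V, t)) V0 e0.
  have near_ (h : R) : `|h| <= r -> `|(V, t + h) - (V, t)| <= r.
    by move=> hr; apply/pair_norm_leP; rewrite /= subrr normr0 addrAC subrr add0r ltW.
  have base : `|(V, t) - (V, t)| <= r by rewrite subrr normr0 ltW.
  have rr : `|r| <= r by rewrite gtr0_norm.
  have nr : `|- r| <= r by rewrite normrN.
  have E0 : V - V = 0 by ring.
  have E1 : t + r - t = r by ring.
  have E2 : t - r - t = - r by ring.
  have /coord2 := Hr _ _ base (near_ _ rr); have /coord2 := Hr _ _ base (near_ _ nr).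
  rewrite /= E0 E1 E2 !mul0r !subr0 normr0 !add0r normrN (gtr0_norm r0).
  have := LamV V (t + r) (ltW V1) (lexx _); have := LamV V (t - r) (ltW V1) (lexx _).
  rewrite !ler_norml => ? ? /andP[? ?] /andP[? ?].
  by apply/andP; split; rewrite -(ler_pM2l r0); lra.
exists t; split; [exact: pos|exact: s0|].
(* The height derivative is non-zero because the Jacobian determinant is, [ps] being horizontal, and
   it is non-negative because the point [p (V - h, t)] is not higher. *)
rewrite lt_neqAle; apply/andP; split.
  apply: contraNneq (cross_p_neq0 CS (y := (V, t)) V0) => E.
  by rewrite (cross_snd0 _ s0) -E mul0r oppr0.
apply/ler_addgt0Pr => e e0.
have [r r0 Hr] := p_strong_diff CS (y := (V, t)) V0 e0.
pose h := Num.min r V.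
have h0 : 0 < h by rewrite lt_min r0.
have [hr hV] : h <= r /\ h <= V by rewrite /h !ge_min !lexx orbT.
have base : `|(V, t) - (V, t)| <= r by rewrite subrr normr0 ltW.
have nb : `|(V - h, t) - (V, t)| <= r.
  apply/pair_norm_leP; rewrite /= subrr normr0 addrAC subrr add0r normrN gtr0_norm//.
  by split=> //; exact: ltW.
have /coord2 := Hr _ _ base nb.
have E0 : V - h - V = - h by ring.
have E1 : t - t = 0 by ring.
rewrite /= E0 E1 !mul0r !subr0 normr0 !addr0 normrN (gtr0_norm h0).
have Vh : 0 <= V - h <= V by rewrite subr_ge0 hV gerBl ltW.
have := LamV (V - h) t; case/andP: Vh => -> -> /(_ isT isT).
rewrite ler_norml -(ler_pM2l h0 0) mulr0.
move: (p (V - h, t)).2 (p (V, t)).2 ('D_(1, 0) p (V, t)).2 => x1 x2 d.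
by move=> ? /andP[? ?]; lra.
Qed.

End Alpha.

(** * The sign of [alpha] along the comparison cycles *)

Lemma cross_eq0_collinear (R : realType) (u v : R * R) : v != 0 -> cross u v = 0 ->
  u = ((u.1 * v.1 + u.2 * v.2) / (v.1 ^+ 2 + v.2 ^+ 2)) *: v.
Proof.
case: u v => [a b] [c d]; rewrite /cross /= => v0 E.
have D : 0 < c ^+ 2 + d ^+ 2.
  rewrite lt_neqAle addr_ge0 ?sqr_ge0// andbT eq_sym paddr_eq0 ?sqr_ge0//.
  rewrite !sqrf_eq0; apply: contra v0 => /andP[/eqP -> /eqP ->]; exact: eqxx.
transitivity ((a * c + b * d) / (c ^+ 2 + d ^+ 2) * c, (a * c + b * d) / (c ^+ 2 + d ^+ 2) * d) => //.
have D' : c ^+ 2 + d ^+ 2 != 0 by rewrite gt_eqF.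
have E' : a * d = b * c by apply/eqP; rewrite -subr_eq0; apply/eqP.
congr (_, _); apply: (mulIf D'); rewrite [RHS]mulrAC divfK//.
  have -> : a * (c ^+ 2 + d ^+ 2) = a * c ^+ 2 + a * d * d by ring.
  by rewrite E'; ring.
have -> : b * (c ^+ 2 + d ^+ 2) = b * c * c + b * d ^+ 2 by ring.
by rewrite -E'; ring.
Qed.

(** The multiples of [v] with the given sign condition form a closed set: collinearity is the closed
    condition [cross w v = 0], and the coefficient, an orthogonal projection, depends continuously
    on [w]. *)
Lemma limit_of_multiples (R : realType) (w v : R * R) (e : R) : v != 0 ->
  (forall eps, 0 < eps -> exists2 k, 0 <= e * k & `|w - k *: v| <= eps) ->
  exists2 k, 0 <= e * k & w = k *: v.
Proof.
move=> v0 H; have nv : 0 < `|v| by rewrite normr_gt0.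
have [/pair_norm_leP[v1 v2] nv1] : `|v| <= `|v| /\ 0 < 2 * `|v| + 1 by split=> //; lra.
have C0 : cross w v = 0.
  apply/eqP; rewrite -normr_le0; apply/ler_addgt0Pr => eps eps0; rewrite add0r.
  have [k _ Hk] := H (eps / (2 * `|v| + 1)) (divr_gt0 eps0 nv1).
  have -> : cross w v = cross (w - k *: v) v.
    by case: w v {H v0 nv v1 v2 nv1 Hk} => [? ?] [? ?]; rewrite /cross /= /GRing.scale /=; ring.
  apply: (le_trans (cross_le _ _)).
  move: Hk; rewrite ler_pdivlMr//; have := normr_ge0 (w - k *: v); nra.
exists ((w.1 * v.1 + w.2 * v.2) / (v.1 ^+ 2 + v.2 ^+ 2)); last exact: cross_eq0_collinear.
rewrite mulrA divr_ge0 ?addr_ge0 ?sqr_ge0//.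
apply/ler_addgt0Pr => eps eps0.
have n2 : 0 < 2 * `|e| * `|v| + 1 by rewrite ltr_wpDl// !mulr_ge0.
have [k k0 Hk] := H (eps / (2 * `|e| * `|v| + 1)) (divr_gt0 eps0 n2).
have /pair_norm_leP[w1 w2] := Hk.
have E : e * (w.1 * v.1 + w.2 * v.2) = e * k * (v.1 ^+ 2 + v.2 ^+ 2) +
    (e * ((w - k *: v).1 * v.1) + e * ((w - k *: v).2 * v.2)).
  by rewrite /= /GRing.scale /=; ring.
rewrite E.
have A1 : `|e * ((w - k *: v).1 * v.1)| <= `|e| * (eps / (2 * `|e| * `|v| + 1) * `|v|).
  by rewrite !normrM ler_wpM2l// ler_pM.
have A2 : `|e * ((w - k *: v).2 * v.2)| <= `|e| * (eps / (2 * `|e| * `|v| + 1) * `|v|).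
  by rewrite !normrM ler_wpM2l// ler_pM.
have A3 : 2 * (`|e| * (eps / (2 * `|e| * `|v| + 1) * `|v|)) <= eps.
  have -> : 2 * (`|e| * (eps / (2 * `|e| * `|v| + 1) * `|v|)) =
    eps * ((2 * `|e| * `|v|) / (2 * `|e| * `|v| + 1)) by field; rewrite gt_eqF.
  by rewrite ler_piMr ?(ltW eps0)// ler_pdivrMr// mul1r lerDl.
have A4 : 0 <= e * k * (v.1 ^+ 2 + v.2 ^+ 2) by rewrite mulr_ge0// addr_ge0 ?sqr_ge0.
move: A1 A2; rewrite !ler_norml => /andP[? _] /andP[? _]; lra.
Qed.

Record comparison_cycle (R : realType) (s : pll_cc R) (V : R) (CV : set (R * R))
    (z : R -> R * R) (T : R) (E : set R) : Prop := {
  cc_T : 0 < T;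
  cc_cont : forall t e, 0 < e -> exists2 d, 0 < d &
    forall r, `|r - t| < d -> `|z r - z t| < e;
  cc_finite : forall a b : R, finite_set (E `&` `[a, b]);
  cc_deriv : forall t, ~ E t -> has_deriv setT z t (comparison_rhs s V (z t));
  cc_period : forall t, z (t + T) = z t;
  cc_inj : {in `[0, T[ &, injective z};
  cc_range : CV = range z
}.

Section Cycle.
Context {R : realType} {s : pll_cc R} {Vb : R} {C : R -> set (R * R)}
  {VPLL : R * R -> R} {p : R * R -> R * R} {U : R}.
Hypothesis CS : cycle_setting s Vb C VPLL p U.

Context {V : R} {z : R -> R * R} {T : R} {E : set R}.
Hypothesis V0 : 0 < V <= Vb.
Hypothesis CC : comparison_cycle s V (C V) z T E.
Let T0 := cc_T CC.
Let zc := cc_cont CC.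
Let zT := cc_period CC.
Let zi := cc_inj CC.
Let zr := cc_range CC.

Lemma cycle_param_of (t : R) : exists t', p (V, t') = z t.
Proof.
have V0' : 0 <= V <= Vb by case/andP: V0 => /ltW -> ->.
have : range z (z t) by exists t.
by rewrite -zr (cp_range (cs_param CS) V0') => -[t' _ <-]; exists t'.
Qed.

Lemma cycle_time_of t' : exists2 t, 0 <= t < T & z t = p (V, t').
Proof.
have V0' : 0 <= V <= Vb by case/andP: V0 => /ltW -> ->.
have : range (fun t => p (V, t)) (p (V, t')) by exists t'.
rewrite -(cp_range (cs_param CS) V0') zr => -[t _ <-].
have zTn (n : nat) r : z (r + n%:R * T) = z r.
  elim: n r => [|n IH] r; first by rewrite mul0r addr0.
  by rewrite -natr1 mulrDl mul1r addrA zT IH.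
have zTi (n : int) r : z (r + n%:~R * T) = z r.
  case: n => n; first exact: zTn.
  by rewrite NegzE mulrNz mulNr -(zTn n.+1 (r - _)) subrK.
exists (t + (- Num.floor (t / T))%:~R * T); last exact: zTi.
have := floor_itv (t / T); rewrite intrD mulr1z ler_pdivlMr// ltr_pdivrMr//.
by rewrite mulrNz => /andP[? ?]; apply/andP; split; lra.
Qed.

(** A window of length 1 singles out one angle for each time. Its left end is the angle of [z 0], to
    which the cycle does not return before [T], so the window can be taken open. *)
Lemma cycle_sigma : exists (t0 : R) (sg : R -> R), p (V, t0) = z 0 /\
  forall t, 0 < t < T -> t0 < sg t < t0 + 1 /\ p (V, sg t) = z t.
Proof.
have [t0 Et0] := cycle_param_of 0; exists t0.
suff /choice[sg Hsg] : forall t, exists r, 0 < t < T -> t0 < r < t0 + 1 /\ p (V, r) = z t.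
  by exists sg.
move=> t; have [tT|nt] := pselect (0 < t < T); last by exists 0.
have [t1 Et1] := cycle_param_of t.
have [n /andP[n1 n2] En] := p_frac CS V t1 t0.
exists (t1 + n%:~R) => _; split; last by rewrite En.
rewrite n2 andbT lt_neqAle n1 andbT; apply/eqP => Et.
have : z 0 = z t by rewrite -Et0 -Et1 -En -Et.
case/andP: tT => t_gt0 t_ltT.
have T0' := T0.
move/zi; rewrite !in_itv /= lexx T0 t_ltT (ltW t_gt0) => /(_ isT isT) t_eq0.
by rewrite -t_eq0 ltxx in t_gt0.
Qed.

(** A continuous injective angle function on an interval is strictly monotone; [e] records the
    direction in which the solution runs through the parametrization. *)
Lemma cycle_monotone : exists (e : R) (sg : R -> R), [/\ e = 1 \/ e = -1,
  forall t, 0 < t < T -> p (V, sg t) = z t,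
  forall t d, 0 < t < T -> 0 < d -> exists2 d', 0 < d' &
    forall r, 0 < r < T -> `|r - t| < d' -> `|sg r - sg t| < d &
  forall t r, 0 < t < T -> 0 < r < T -> t < r -> 0 < e * (sg r - sg t)].
Proof.
have [t0 [sg [_ Hsg]]] := cycle_sigma.
have sgc t d : 0 < t < T -> 0 < d -> exists2 d', 0 < d' &
    forall r, 0 < r < T -> `|r - t| < d' -> `|sg r - sg t| < d.
  move=> tT d0; have [/andP[s1 s2] sE] := Hsg t tT.
  (* Closer than [d1] to [sg t] the shifted angle lies in the open window of length 1, as [sg x]
     does, so the integer shift supplied by [p_local] is 0. *)
  pose d1 := Num.min d (Num.min (sg t - t0) (t0 + 1 - sg t)).
  have d10 : 0 < d1 by rewrite !lt_min d0 !subr_gt0 s1 s2.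
  have [r r0 Hr] := p_local CS (sg t) V0 d10.
  have [d' d'0 Hd'] := zc t r0; exists d' => // x xT /Hd' xt.
  have [/andP[x1 x2] xE] := Hsg x xT.
  have V0' : 0 <= V <= Vb by case/andP: V0 => /ltW -> ->.
  have [|_ [n]] := Hr V (sg x) V0'; first by rewrite sE xE.
  rewrite !lt_min => /andP[n1 /andP[n2 n3]].
  suff n0 : n = 0 by move: n1; rewrite n0 addr0.
  have [a1 a2] : n%:~R < 1 :> R /\ -1 < n%:~R :> R.
    by move: n2 n3; rewrite !ltr_norml => /andP[? ?] /andP[? ?]; split; lra.
  have := a1; rewrite -[1]/(1%:~R) ltr_int => b1.
  have := a2; rewrite -[-1]/((-1)%:~R) ltr_int => b2.
  by clear -b1 b2; case: n b1 b2 => [[|n]|[|n]].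
have sgi : {in `]0, T[ &, injective sg}.
  move=> x y; rewrite !in_itv /= => xT yT Exy.
  have [_ xE] := Hsg x xT; have [_ yE] := Hsg y yT.
  have Z : z x = z y by rewrite -xE -yE Exy.
  by apply: zi Z; rewrite in_itv /=; [case/andP: xT => /ltW -> ->|case/andP: yT => /ltW -> ->].
have sgw : {within `]0, T[, continuous sg}.
  apply: continuous_in_subspaceT => t; rewrite inE /= in_itv /= => tT.
  apply/(@cont_epsP _ R^o R^o) => d d0; have [d' d'0 Hd'] := sgc t d tT d0.
  case/andP: (tT) => t1 t2.
  exists (Num.min d' (Num.min t (T - t))); first by rewrite !lt_min d'0 t1 subr_gt0.
  move=> y; rewrite !lt_min => /andP[y1 /andP[y2 y3]]; apply: Hd' => //.
  by move: y2 y3; rewrite !ltr_norml => /andP[? ?] /andP[? ?]; apply/andP; split; lra.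
have := itv_continuous_inj_mono sgw sgi.
case=> mono.
- exists 1, sg; split=> //; first by left.
    by move=> t /Hsg[].
  move=> t r tT rT tr; rewrite mul1r subr_gt0.
  by apply: mono => //; rewrite in_itv.
- exists (-1), sg; split=> //; first by right.
    by move=> t /Hsg[].
  move=> t r tT rT tr; rewrite mulN1r oppr_gt0 subr_lt0.
  by apply: mono => //; rewrite in_itv.
Qed.

End Cycle.

Lemma comparison_cycle_exists (R : realType) (s : pll_cc R) (Vb V : R)
    (C : R -> set (R * R)) : limit_cycle_family s Vb C -> 0 < V <= Vb ->
  exists z T E, comparison_cycle s V (C V) z T E.
Proof.
move=> HC /(cycle_V HC)[[z [T [[T0 [zc [E [El zd]]] zT zi zr] _]]] _].
exists z, T, E; split=> //.
- move=> t e e0; have zc' : continuous z by move: zc; rewrite -continuous_subspace_setT.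
  have [d d0 Hd] := (@cont_epsP _ R^o _ z t).1 (zc' t) e e0.
  by exists d.
- by move=> t Et; apply/derive_withinP; exact: zd.
Qed.

Lemma has_deriv_uniq0 (R : realType) (u : R -> R) (t d r : R) : 0 < r ->
  has_deriv setT (u : R -> R^o) t d -> (forall x, `|x - t| < r -> u x = u t) -> d = 0.
Proof.
move=> r0 ud uc; apply/eqP; rewrite -normr_le0; apply/ler_addgt0Pr => e e0.
rewrite add0r; have [del del0 H] := ud e e0.
pose h := Num.min (del / 2) (r / 2).
have h0 : 0 < h by rewrite lt_min; apply/andP; split; lra.
have [h1 h2] : h <= del / 2 /\ h <= r / 2 by rewrite /h !ge_min !lexx orbT.
have E : t + h - t = h by ring.
have := H (t + h) I; rewrite E uc ?E gtr0_norm//; last lra.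
rewrite subrr sub0r normrN => /(_ _).
rewrite /GRing.scale /= normrM gtr0_norm// mulrC ler_pM2r//.
by apply; lra.
Qed.

Lemma constant_sign (R : realType) (u : R -> R) (a b : R) : continuous (u : R -> R^o) ->
  (forall t, u t != 0) -> u a < 0 -> u b < 0.
Proof.
move=> uc u0 ua; rewrite ltNge; apply/negP => ub.
have uw (x y : R) : {within `[x, y], continuous u} by exact: continuous_subspaceT.
have [ab|/ltW ba] := leP a b.
  have [|c _ Ec] := @IVT R u a b 0 ab (uw a b).
    by rewrite ge_min le_max (ltW ua) ub orbT.
  by move/eqP: (u0 c); rewrite Ec.
have [|c _ Ec] := @IVT R u b a 0 ba (uw b a).
  by rewrite ge_min le_max (ltW ua) ub orbT.
by move/eqP: (u0 c); rewrite Ec.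
Qed.

Section CycleSign.
Context {R : realType} {s : pll_cc R} {Vb : R} {C : R -> set (R * R)}
  {VPLL : R * R -> R} {p : R * R -> R * R} {U : R}.
Hypothesis CS : cycle_setting s Vb C VPLL p U.

Notation ps := (fun y : R * R => 'D_(0, 1) p y).

Context {V : R} {z : R -> R * R} {T : R} {E : set R}.
Hypothesis V0 : 0 < V <= Vb.
Hypothesis CC : comparison_cycle s V (C V) z T E.

Let ki0 := ki_gt0 (cs_assumptions CS).

(** No differentiability of [sg] is available. The difference quotients of [z] are approximated by
    those of [sg] times [ps]; these multiples all have the sign of [e], and so has their limit. *)
Lemma cycle_tangent e sg : e = 1 \/ e = -1 ->
  (forall t, 0 < t < T -> p (V, sg t) = z t) ->
  (forall t d, 0 < t < T -> 0 < d -> exists2 d', 0 < d' &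
    forall r, 0 < r < T -> `|r - t| < d' -> `|sg r - sg t| < d) ->
  (forall t r, 0 < t < T -> 0 < r < T -> t < r -> 0 < e * (sg r - sg t)) ->
  forall t, 0 < t < T -> ~ E t ->
  exists2 k, 0 <= e * k & comparison_rhs s V (z t) = k *: ps (V, sg t).
Proof.
move=> e1 sgz sgc sgm t tT Et; have S0 := ps_neq0 CS (y := (V, sg t)) V0.
apply: limit_of_multiples => //.
move: S0; set S := 'D_(0, 1) p (V, sg t); set W := comparison_rhs s V (z t) => S0 eps eps0.
have nS : 0 < `|S| by rewrite normr_gt0.
have nW : 0 < `|W| + 1 by rewrite ltr_wpDl.
(* The first bound makes the angle increment at most proportional to [h]; the second then turns the
   error [eta * |D'|] into at most [eps / 2 * h]. *)
pose eta := Num.min (`|S| / 2) (eps * `|S| / (4 * (`|W| + 1))).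
have eta0 : 0 < eta.
  by rewrite lt_min divr_gt0//= divr_gt0// mulr_gt0.
have [eta1 eta2] : eta <= `|S| / 2 /\ eta <= eps * `|S| / (4 * (`|W| + 1)).
  by rewrite /eta !ge_min !lexx orbT.
have [r r0 Hr] := p_strong_diff CS (y := (V, sg t)) V0 eta0.
have [d' d'0 Hd'] := sgc t r tT r0.
have m0 : 0 < Num.min 1 (eps / 2) by rewrite lt_min ltr01; lra.
have [del del0 Hz] := cc_deriv CC Et m0.
case/andP: (tT) => t_gt0 t_ltT.
pose h := Num.min (del / 2) (Num.min (d' / 2) ((T - t) / 2)).
have h0 : 0 < h by rewrite !lt_min; repeat (apply/andP; split); lra.
have [h1 [h2 h3]] : h <= del / 2 /\ h <= d' / 2 /\ h <= (T - t) / 2.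
  by rewrite /h !ge_min !lexx !orbT.
have Eh : t + h - t = h by ring.
have thT : 0 < t + h < T by apply/andP; split; lra.
have nh : `|h| = h by rewrite gtr0_norm.
have := Hz (t + h) I; rewrite Eh nh -/W => /(_ _)Z; have {}Z := Z ltac:(lra).
have := Hd' (t + h) thT; rewrite Eh nh => /(_ _)D; have {}D := D ltac:(lra).
have sgm' := sgm t (t + h) tT thT _; have {}sgm' : 0 < e * (sg (t + h) - sg t) by apply: sgm'; lra.
have := Hr (V, sg t) (V, sg (t + h)).
rewrite !sgz// -/S /=.
have E0 : V - V = 0 by ring.
rewrite E0 scale0r subr0 normr0 add0r.
set D' := sg (t + h) - sg t in D sgm' *.
have n1 : `|(V, sg t) - (V, sg t)| <= r by rewrite subrr normr0 ltW.
have n2 : `|(V, sg (t + h)) - (V, sg t)| <= r.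
  by apply/pair_norm_leP; rewrite /= E0 normr0 (ltW r0) ltW.
move=> /(_ n1 n2) X.
set dz := z (t + h) - z t in Z X.
have M1 : Num.min 1 (eps / 2) <= 1 by rewrite ge_min lexx.
have M2 : Num.min 1 (eps / 2) <= eps / 2 by rewrite ge_min lexx orbT.
have dzW : `|dz| <= (`|W| + 1) * h.
  rewrite -(subrK (h *: W) dz); apply: (le_trans (ler_normD _ _)).
  by rewrite normrZ nh; nra.
have DS : `|D'| * `|S| <= `|dz| + eta * `|D'|.
  rewrite -normrZ -(subrK dz (D' *: S)); apply: (le_trans (ler_normD _ _)).
  by rewrite distrC; lra.
have D'b : `|D'| * `|S| <= 2 * ((`|W| + 1) * h).
  have := normr_ge0 D'; nra.
have etaD : eta * `|D'| <= eps / 2 * h.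
  apply: (@le_trans _ _ (eps * `|S| / (4 * (`|W| + 1)) * `|D'|)).
    by rewrite ler_wpM2r.
  have -> : eps * `|S| / (4 * (`|W| + 1)) * `|D'| =
    eps / (4 * (`|W| + 1)) * (`|D'| * `|S|) by field; rewrite gt_eqF.
  apply: (@le_trans _ _ (eps / (4 * (`|W| + 1)) * (2 * ((`|W| + 1) * h)))).
    by rewrite ler_wpM2l// divr_ge0// ltW// mulr_gt0.
  rewrite le_eqVlt; apply/orP; left; apply/eqP; field; rewrite gt_eqF//.
exists (D' / h); first by rewrite mulrA divr_ge0// ltW.
have key : h * `|W - (D' / h) *: S| = `|h *: W - D' *: S|.
  by rewrite -{1}nh -normrZ scalerBr scalerA [h * _]mulrC divfK// gt_eqF.
rewrite -(ler_pM2l h0) key.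
have -> : h *: W - D' *: S = (dz - D' *: S) - (dz - h *: W).
  by rewrite opprB [RHS]addrC addrA subrK.
apply: (le_trans (ler_normB _ _)).
have : Num.min 1 (eps / 2) * h <= eps / 2 * h by rewrite ler_wpM2r// ltW.
lra.
Qed.

Lemma comparison_rhs_E q : comparison_rhs s V q =
  (- kp s * fstar s V q + q.2, - ki s * fstar s V q).
Proof. by []. Qed.

(* Otherwise the cycle would rest at an equilibrium with [omega = 0] for some
   time. *)
Lemma cycle_dense a b : 0 <= a -> a < b -> b <= T -> exists t,
  [/\ a < t < b, ~ E t & (z t).2 != 0].
Proof.
move=> a0 ab bT; apply: contrapT => H.
(* Shortening the interval to []a, b'[] avoids the exceptional times, so the equation holds
   throughout. *)
have [d d0 Hd] := locally_finite_isolated a (cc_finite CC).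
pose b' := Num.min b (a + d).
have ab' : a < b' by rewrite lt_min ab; lra.
have [b'b b'd] : b' <= b /\ b' <= a + d by rewrite /b' !ge_min !lexx orbT.
have nE t : a < t < b' -> ~ E t.
  by move=> /andP[? ?]; apply: Hd; rewrite gtr0_norm; [apply/andP; split|]; lra.
have z0 t : a < t < b' -> (z t).2 = 0.
  move=> tab; apply/eqP; apply: contrapT => zt; apply: H; exists t; split.
  - by case/andP: tab => ? ?; apply/andP; split; lra.
  - exact: nE.
  - exact/negP.
have zd0 t : a < t < b' -> comparison_rhs s V (z t) = 0.
  move=> tab; have /= := has_deriv_snd (cc_deriv CC (nE t tab)).
  rewrite comparison_rhs_E /= => D.
  pose r := Num.min (t - a) (b' - t).
  have r0 : 0 < r by case/andP: tab => ? ?; rewrite lt_min !subr_gt0; apply/andP.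
  have := has_deriv_uniq0 r0 D => D0.
  have {}D0 : - ki s * fstar s V (z t) = 0.
    apply: D0 => x; rewrite lt_min => /andP[].
    rewrite !ltr_norml => /andP[? ?] /andP[? ?].
    by rewrite !z0//; apply/andP; split; lra.
  have f0 : fstar s V (z t) = 0.
    by move/eqP: D0; rewrite mulNr oppr_eq0 mulf_eq0 gt_eqF//= => /eqP.
  by rewrite f0 !mulr0 z0// addr0.
pose t1 := a + (b' - a) / 3; pose t2 := a + (b' - a) * 2 / 3.
have t12 : t1 <= t2 by rewrite /t1 /t2; lra.
have zz : `|z t2 - z t1 - (t2 - t1) *: 0| <= 0 * (t2 - t1).
  apply: (@mean_value_lin _ _ setT z (fun=> 0)) => // t /andP[tt1 tt2].
    have tab : a < t < b' by move: tt1 tt2; rewrite /t1 /t2 => ? ?; apply/andP; split; lra.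
    by rewrite -(zd0 t tab); exact: cc_deriv CC _ (nE t tab).
  by rewrite subrr normr0.
move: zz; rewrite scaler0 subr0 mul0r normr_le0 subr_eq0 => /eqP zz.
have : t2 = t1.
  by apply: (cc_inj CC) => //; rewrite in_itv /=; apply/andP; split; rewrite /t1 /t2; lra.
rewrite /t1 /t2; lra.
Qed.

(** Carries density from times to angles: an inequality continuous in the angle has to be checked
    only where the cycle is differentiable and [omega != 0]. *)
Lemma cycle_dense_param sg t0 rho : (forall t, 0 < t < T -> p (V, sg t) = z t) ->
  0 < rho -> exists t, [/\ 0 < t < T, ~ E t, (z t).2 != 0 &
    exists n : int, `|sg t + n%:~R - t0| < rho].
Proof.
move=> sgz rho0; have [t1 /andP[t10 t1T] Et1] := cycle_time_of CS V0 CC t0.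
have [r r0 Hr] := p_local CS t0 V0 rho0.
have [d d0 Hd] := cc_cont CC t1 r0.
have [||t [/andP[tt1 tt2] nEt zt]] := @cycle_dense t1 (Num.min T (t1 + d)) t10.
- by rewrite lt_min t1T; lra.
- by rewrite ge_min lexx.
move: tt2; rewrite lt_min => /andP[tT td].
have tT' : 0 < t < T by rewrite tT andbT; lra.
exists t; split=> //.
have V0' : 0 <= V <= Vb by case/andP: V0 => /ltW -> ->.
have [|_ //] := Hr V (sg t) V0'.
by rewrite sgz// -Et1; apply: Hd; rewrite gtr0_norm; lra.
Qed.

End CycleSign.

Lemma continuous_slice (R : realType) (W : normedModType R) (u : R * R -> W) (V t : R) :
  {for (V, t), continuous u} -> {for t, continuous (fun r : R^o => u (V, r))}.
Proof.
move=> /cont_epsP uc; apply/cont_epsP => e /uc[d d0 Hd]; exists d => // r rt.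
by apply: Hd; apply/pair_norm_ltP; rewrite /= subrr normr0.
Qed.

Lemma continuous_pos (R : realType) (W : normedModType R) (u : W -> R) (t : W) :
  {for t, continuous (u : W -> R^o)} -> 0 < u t ->
  exists2 d, 0 < d & forall r, `|r - t| < d -> 0 < u r.
Proof.
move=> uc ut; have [d d0 Hd] := (@cont_epsP _ W R^o u t).1 uc _ ut.
by exists d => // r /Hd; rewrite ltr_norml => /andP[]; lra.
Qed.

Lemma pmulr_sign (R : realDomainType) (a b k : R) : 0 < b * a -> 0 < k * a -> 0 < k * b.
Proof.
move=> ba ka.
have a2 : 0 < a ^+ 2.
  by rewrite exprn_even_gt0//=; apply: contraTneq ba => ->; rewrite mulr0 ltxx.
by rewrite -(pmulr_lgt0 _ a2); have := mulr_gt0 ba ka; rewrite (_ : b * a * (k * a) = k * b * a ^+ 2); last ring.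
Qed.

Lemma pmulr_sign_ge0 (R : realDomainType) (e b k : R) : 0 <= e * k -> 0 < k * b -> e != 0 -> 0 < e * b.
Proof.
move=> ek kb e0.
have k0 : k != 0 by apply: contraTneq kb => ->; rewrite mul0r ltxx.
have {}ek : 0 < e * k by rewrite lt_neqAle eq_sym mulf_neq0.
by apply: (@pmulr_sign _ k); rewrite // mulrC.
Qed.

Section Sign.
Context {R : realType} {s : pll_cc R} {Vb : R} {C : R -> set (R * R)}
  {VPLL : R * R -> R} {p : R * R -> R * R} {U : R}.
Hypothesis CS : cycle_setting s Vb C VPLL p U.

Notation pV := (fun y : R * R => 'D_(1, 0) p y).
Notation ps := (fun y : R * R => 'D_(0, 1) p y).

Let Hs := cs_assumptions CS.
Let ki0 := ki_gt0 Hs.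

Lemma ps_cont V t : 0 < V <= Vb -> {for t, continuous (fun r : R^o => ps (V, r))}.
Proof.
move=> V0.
exact: (continuous_slice (Dp_continuous' CS (y := (V, t)) (v := (0, 1)) V0)).
Qed.

Lemma cross_cont V : 0 < V <= Vb ->
  continuous (fun t : R^o => cross (pV (V, t)) (ps (V, t)) : R^o).
Proof.
move=> V0 t.
apply: cross_cvg.
  exact: (continuous_slice (Dp_continuous' CS (y := (V, t)) (v := (1, 0)) V0)).
exact: ps_cont.
Qed.

Lemma p_cont V t : 0 < V <= Vb -> {for t, continuous (fun r : R^o => p (V, r))}.
Proof. by move=> V0; exact: (continuous_slice (p_continuous CS (y := (V, t)) V0)). Qed.

Section FixedCycle.
Context {V : R} {z : R -> R * R} {T : R} {E : set R}.
Hypothesis V0 : 0 < V <= Vb.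
Hypothesis CC : comparison_cycle s V (C V) z T E.

(* In the coordinates [(xi, omega)], [xi = theta - kp / ki * omega], the field
   is [xi' = omega]; this does not involve [f] and gives the direction of
   rotation. *)
Lemma cycle_orientation (e : R) (sg : R -> R) :
  (forall t, 0 < t < T -> p (V, sg t) = z t) ->
  (forall t, 0 < t < T -> ~ E t ->
    exists2 k, 0 <= e * k & comparison_rhs s V (z t) = k *: ps (V, sg t)) ->
  e = 1 \/ e = -1 -> forall t, e * cross (pV (V, t)) (ps (V, t)) < 0.
Proof.
move=> sgz sgk e1 t'; have [t1 [w1 s1 v1]] := top_point CS V0.
have J0 t : cross (pV (V, t)) (ps (V, t)) != 0 by exact: (cross_p_neq0 CS (y := (V, t)) V0).
have e0 : e != 0 by case: e1 => ->; rewrite ?oppr_eq0 oner_eq0.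
(* The Jacobian determinant never vanishes along the cycle, so its sign is needed at the topmost
   point only. *)
apply: (@constant_sign R (fun t => e * cross (pV (V, t)) (ps (V, t))) t1).
- by move=> t; apply: cvgM; [exact: cvg_cst|exact: cross_cont].
- by move=> t; rewrite mulf_neq0.
have J1 : cross (pV (V, t1)) (ps (V, t1)) = - ((pV (V, t1)).2 * (ps (V, t1)).1).
  exact: cross_snd0.
have S1 : (ps (V, t1)).1 != 0.
  by apply: contraNneq (J0 t1) => S1; rewrite J1 S1 mulr0 oppr0.
rewrite J1 mulrN oppr_lt0 mulrCA mulr_gt0//.
(* [S] is the derivative of [xi] with respect to the angle. Since [ps] is horizontal at the topmost
   point, [S t1] equals [(ps (V, t1)).1], and [u] is a square there. *)
pose S t := (ps (V, t)).1 - kp s / ki s * (ps (V, t)).2.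
pose u t := (ps (V, t1)).1 * S t.
have [d1 d10 H1] : exists2 d, 0 < d & forall r, `|r - t1| < d -> 0 < u r.
  refine (@continuous_pos R R^o u t1 _ _); last first.
    by rewrite /u /S s1 mulr0 subr0 -expr2 exprn_even_gt0.
  apply: cvgM; first exact: cvg_cst.
  have c1 := cvg_comp _ _ (@ps_cont V t1 V0) (@cvg_fst _ _ _ _ _).
  have c2 := cvg_comp _ _ (@ps_cont V t1 V0) (@cvg_snd _ _ _ _ _).
  by apply: cvgB; [exact: c1|apply: cvgM; [exact: cvg_cst|exact: c2]].
have [d2 d20 H2] : exists2 d, 0 < d & forall r, `|r - t1| < d -> 0 < (p (V, r)).2.
  apply: (@continuous_pos R R^o (fun r => (p (V, r)).2) t1); last exact: w1.
  exact: cvg_comp _ _ (@p_cont V t1 V0) (@cvg_snd _ _ _ _ _).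
have d0 : 0 < Num.min d1 d2 by rewrite lt_min d10.
have [t [tT nEt zt [n]]] := cycle_dense_param CS V0 CC t1 sgz d0.
rewrite lt_min => /andP[/H1 n1 /H2 n2].
have [k ek Ek] := sgk t tT nEt.
rewrite /u /S !(Dp_period CS) in n1; rewrite (p_period_int CS) sgz// in n2.
have {}Ek : k * ((ps (V, sg t)).1 - kp s / ki s * (ps (V, sg t)).2) = (z t).2.
  have := congr1 fst Ek; have := congr1 snd Ek; rewrite comparison_rhs_E /= /GRing.scale /=.
  move=> X1 X2; rewrite mulrBr -X2 mulrCA -X1.
  by field; rewrite gt_eqF.
move: n1; set a := _ - _ in Ek *; set b := 'D_(0, 1) p (V, t1) in S1 *.
rewrite -Ek in n2 => n1.
have kb : 0 < k * b.1 := pmulr_sign n1 n2.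
exact: pmulr_sign_ge0 ek kb e0.
Qed.

(** The comparison field is [k *: ps], so [k] times the numerator of [alpha] is the cross product of
    two values of the PLL field at the same point, which is [ki * (c - c0) * omega]. Minimum and
    maximum in [fstar] are placed so that [(c - c0) * omega >= 0], and the orientation gives
    [k * J < 0]. *)
Lemma alpha_good (e : R) (sg : R -> R) t x :
  p (V, sg t) = z t -> (z t).2 != 0 ->
  e * cross (pV (V, sg t)) (ps (V, sg t)) < 0 ->
  (exists2 k, 0 <= e * k & comparison_rhs s V (z t) = k *: ps (V, sg t)) ->
  VCC s x <= V -> alpha s p (V, sg t) (f s (z t) x) <= 0.
Proof.
move=> sgz w0 eJ [k ek Ek] xV.
have ns : nonsingular s V by apply: (comparison_defined (cs_family CS)); case/andP: V0 => /ltW ->.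
have V0' : 0 <= V by case/andP: V0 => /ltW.
rewrite /alpha sgz.
set J := cross _ _ in eJ *; set S := 'D_(0, 1) p (V, sg t) in Ek J eJ *.
have J0 : J != 0 by exact: (cross_p_neq0 CS (y := (V, sg t)) V0).
set c := f s (z t) x; set c0 := fstar s V (z t).
have cw : 0 <= (c - c0) * (z t).2.
  have [w|w] := leP 0 (z t).2.
    by rewrite mulr_ge0// subr_ge0; exact: fstar_le.
  by rewrite nmulr_lge0// subr_le0; exact: fstar_ge.
have [X1 X2] : - kp s * c0 + (z t).2 = k * S.1 /\ - ki s * c0 = k * S.2.
  by have := congr1 fst Ek; have := congr1 snd Ek; rewrite comparison_rhs_E.
have ki0' : ki s != 0 by rewrite gt_eqF.
have k0 : k != 0.
  apply: contraNneq w0 => k0; rewrite k0 !mul0r in X1 X2.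
  move/eqP: X2; rewrite mulNr oppr_eq0 mulf_eq0 (negbTE ki0') /= => /eqP c00.
  by rewrite c00 mulr0 add0r in X1; rewrite X1.
have kJ : k * J < 0.
  have k2 : 0 < k ^+ 2 by rewrite exprn_even_gt0.
  rewrite lt_neqAle mulf_neq0//= leNgt; apply/negP => kJ.
  have : e * k * (k * J) = (e * J) * k ^+ 2 by ring.
  move=> X; have : 0 <= e * k * (k * J) by rewrite mulr_ge0// ltW.
  by rewrite X pmulr_lge0// leNgt eJ.
have -> : cross (pll_rhs s c (z t)) S / J = (c - c0) * (z t).2 * (ki s / (k * J)).
  apply: (mulIf J0); rewrite divfK//.
  have -> : (c - c0) * (z t).2 * (ki s / (k * J)) * J = (c - c0) * (z t).2 * ki s / k.
    by field; rewrite k0.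
  apply: (mulIf k0); rewrite divfK// mulrC.
  have -> : k * cross (pll_rhs s c (z t)) S =
     (- kp s * c + (z t).2) * (k * S.2) - (- ki s * c) * (k * S.1).
    by rewrite /cross /=; ring.
  by rewrite -X1 -X2; ring.
rewrite mulr_ge0_le0// pmulr_rle0// invr_le0 ltW//.
Qed.

End FixedCycle.

(** A positive value would persist at nearby angles by continuity, hence at one covered by
    [alpha_good]. Continuity is argued for [ft], which is defined and continuous everywhere. *)
Lemma alpha_le0 V t x : 0 < V <= Vb -> VCC s x <= V ->
  alpha s p (V, t) (f s (p (V, t)) x) <= 0.
Proof.
move=> V0 xV; have [z [T [E CC]]] := comparison_cycle_exists (cs_family CS) V0.
have [e [sg [e1 sgz sgc sgm]]] := cycle_monotone CS V0 CC.
have sgk := cycle_tangent CS V0 CC e1 sgz sgc sgm.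
have eJ := cycle_orientation V0 CC sgz sgk e1.
have ns : nonsingular s V by apply: (comparison_defined (cs_family CS)); case/andP: V0 => /ltW ->.
have V0' : 0 <= V by case/andP: V0 => /ltW.
have [M [m0 [bl qM ftE]]] := f_ft Hs (p (V, t)) V0' ns.
rewrite leNgt; apply/negP => pos.
pose A r := alpha s p (V, r) (ft s M m0 (p (V, r), x)).
have Ac : {for t, continuous (A : R^o -> R^o)}.
  have c1 : (p (V, r), x) @[r --> t] --> (p (V, t), x).
    have c11 : p (V, r) @[r --> t] --> p (V, t) by exact: (@p_cont V t V0).
    have c12 : (fun _ : R => x) r @[r --> t] --> x by exact: cvg_cst.
    exact: (cvg_pair c11 c12).
  have c2' : continuous (ft s M m0 : _ -> R^o) := blip_continuous bl.
  have c2 := cvg_comp _ _ c1 (c2' (p (V, t), x)).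
  have c3 : (V, r) @[r --> t] --> (V, t).
    have c31 : (fun _ : R => V) r @[r --> t] --> V by exact: cvg_cst.
    have c32 : id r @[r --> t] --> t by exact: cvg_id.
    exact: (cvg_pair c31 c32).
  have c4 : ((V, r), ft s M m0 (p (V, r), x)) @[r --> t] -->
    ((V, t), ft s M m0 (p (V, t), x)) by exact: (cvg_pair c3 c2).
  have c5 := alpha_continuous CS (y := (V, t)) (c := ft s M m0 (p (V, t), x)) V0.
  exact: (cvg_comp _ _ c4 c5).
have At : 0 < A t by rewrite /A ftE// ltW.
have [d1 d10 H1] := continuous_pos Ac At.
have [d2 d20 H2] : exists2 d, 0 < d & forall r, `|r - t| < d -> 0 < M - `|p (V, r)|.
  apply: (@continuous_pos R R^o (fun r => M - `|p (V, r)|) t); last by rewrite subr_gt0.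
  apply: cvgB; first exact: cvg_cst.
  exact: (cvg_norm (@p_cont V t V0)).
have d0 : 0 < Num.min d1 d2 by rewrite lt_min d10.
have [r [rT nEr zr0 [n]]] := cycle_dense_param CS V0 CC t sgz d0.
rewrite lt_min => /andP[/H1 n1 /H2 n2].
rewrite subr_gt0 (p_period_int CS) in n2.
move: n1; rewrite /A (alpha_period CS) (p_period_int CS) sgz//.
rewrite ftE ?ltNge; last 2 first.
- by move: n2; rewrite sgz// => /ltW.
- exact: xV.
by rewrite (alpha_good V0 (sgz r rT) zr0 (eJ _) (sgk r rT nEr) xV).
Qed.

End Sign.

Section Strict.
Context {R : realType} {s : pll_cc R} {Vb : R} {C : R -> set (R * R)}
  {VPLL : R * R -> R} {p : R * R -> R * R} {U : R}.
Hypothesis CS : cycle_setting s Vb C VPLL p U.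

Let Hs := cs_assumptions CS.
Let ki0 := ki_gt0 Hs.

Lemma nonsingular_cycle V : 0 < V <= Vb -> nonsingular s V.
Proof. by move=> V0; apply: (comparison_defined (cs_family CS)); case/andP: V0 => /ltW ->. Qed.

(* [alpha] is affine in the value of [f], and [f (q, 0)] is an interior point
   of the range of [f (q, _)] on the ellipsoid: if [alpha] vanished there it
   would be constant. *)
Lemma alpha_lt0 V t : 0 < V <= Vb -> (p (V, t)).2 != 0 ->
  alpha s p (V, t) (f s (p (V, t)) 0) < 0.
Proof.
move=> V0 w0; have ns := nonsingular_cycle V0.
have Vpos : 0 < V by case/andP: V0.
have [x1 [x2 [x1V x2V c1 c2]]] := f_spread Hs (p (V, t)) Vpos ns.
have a1 := alpha_le0 CS t V0 x1V; have a2 := alpha_le0 CS t V0 x2V.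
have x0V : VCC s 0 <= V by rewrite VCC0 ltW.
have a0 := alpha_le0 CS t V0 x0V.
rewrite lt_neqAle a0 andbT; apply/eqP => A0.
have S0 := ps_neq0 CS (y := (V, t)) V0.
have J0 := cross_p_neq0 CS (y := (V, t)) V0.
move: A0 a1 a2; rewrite /alpha.
move: ('D_(0, 1) p (V, t)) ('D_(1, 0) p (V, t)) S0 J0 => S W S0 J0.
set c0 := f s _ 0 in c1 c2 *; set w := (p (V, t)).2 in w0 *.
move: c1 c2; move: (f s (p (V, t)) x1) (f s (p (V, t)) x2) => c1 c2 c10 c02.
set J := cross W S in J0 *.
have aE c : cross (pll_rhs s c (p (V, t))) S / J =
    w * (S.2 / J) + c * ((ki s * S.1 - kp s * S.2) / J).
  by rewrite /cross /=; field.
rewrite !aE; set m := (_ - _) / J => A0 a1 a2.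
have m0 : m = 0.
  have m1 : 0 <= m.
    have : (c1 - c0) * m <= 0 by lra.
    by rewrite nmulr_rle0// subr_lt0.
  have m2 : m <= 0.
    have : (c2 - c0) * m <= 0 by lra.
    by rewrite pmulr_rle0// subr_gt0.
  by apply/eqP; rewrite eq_le m1 m2.
move/eqP: A0; rewrite m0 mulr0 addr0 !mulf_eq0 (negbTE w0) invr_eq0 (negbTE J0) orbF /=.
move=> /eqP S2; move/eqP: m0; rewrite /m S2 mulr0 subr0 !mulf_eq0 invr_eq0 (negbTE J0) orbF.
rewrite gt_eqF//= => /eqP S1.
by move/eqP: S0; apply; rewrite [S]surjective_pairing S1 S2.
Qed.

Lemma f_sign_near V q x : 0 <= V -> nonsingular s V -> VCC s x <= V ->
  f s q x != 0 -> exists2 r, 0 < r & forall q', `|q' - q| < r -> 0 < f s q x * f s q' x.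
Proof.
move=> V0 ns xV fx; have [M [m0 [bl qM ftE]]] := f_ft Hs q V0 ns.
have ct : continuous (fun q' => f s q x * ft s M m0 (q', x) : R^o).
  apply: blip_continuous; apply: blipM; first exact: blip_cst.
  apply: blip_comp bl => a b.
  by rewrite prod_normE ge_max /= subrr normr0 normr_ge0 lexx.
have [|d d0 Hd] := continuous_pos (ct q).
  by rewrite /= ftE ?(ltW qM)// -expr2 exprn_even_gt0.
exists (Num.min d (M - `|q|)); first by rewrite lt_min d0 subr_gt0.
move=> q'; rewrite lt_min => /andP[/Hd + q'M].
rewrite ftE// -(subrK q q') addrC; apply: (le_trans (ler_normD _ _)).
by move: q'M; lra.
Qed.

(* If [f] took both signs at such a point then [|omega|] would grow along the
   cycle near it, and the cycle could not pass through it. *)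
Lemma f0_neq0 V t : 0 < V <= Vb -> (p (V, t)).2 = 0 -> f s (p (V, t)) 0 != 0.
Proof.
move=> V0 w0; apply/eqP => F0; have ns := nonsingular_cycle V0.
have Vpos : 0 < V by case/andP: V0.
have [x1 [x2 [x1V x2V]]] := f_spread Hs (p (V, t)) Vpos ns; rewrite F0 => c1 c2.
have [r1 r10 H1] := f_sign_near (ltW Vpos) ns x1V (ltr0_neq0 c1).
have [r2 r20 H2] := f_sign_near (ltW Vpos) ns x2V (lt0r_neq0 c2).
have [z [T [E CC]]] := comparison_cycle_exists (cs_family CS) V0.
have [tau _ Etau] := cycle_time_of CS V0 CC t.
have r0 : 0 < Num.min r1 r2 by rewrite lt_min r10.
have [d1 d10 Hz] := cc_cont CC tau r0.
have [d2 d20 HE] := locally_finite_isolated tau (cc_finite CC).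
pose d := Num.min d1 d2; have d0 : 0 < d by rewrite lt_min d10.
have near_ x : tau - d < x < tau -> [/\ ~ E x, f s (z x) x1 < 0 & 0 < f s (z x) x2].
  rewrite ltrBlDl -ltrBlDr lt_min => /andP[/andP[xd1 xd2] xt].
  have nx : `|x - tau| = tau - x by rewrite ltr0_norm ?subr_lt0// opprB.
  have := Hz x; rewrite nx => /(_ _)Zx; have {}Zx := Zx ltac:(lra).
  move: Zx; rewrite Etau lt_min => /andP[/H1 f1 /H2 f2].
  split; last by rewrite -(pmulr_rgt0 _ c2).
    by apply: HE; rewrite nx; apply/andP; split; lra.
  by rewrite -(nmulr_rgt0 _ c1).
have om_deriv x : ~ E x -> has_deriv setT (fun x => (z x).2 : R^o) x (- ki s * fstar s V (z x)).
  by move=> /(cc_deriv CC)/has_deriv_snd.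
(* Just before [tau] the modulus of [omega] does not decrease, and it is 0 at [tau]. *)
have om0 x : tau - d < x < tau -> (z x).2 = 0.
  move=> xd; have /andP[xd1 xd2] := xd; apply/eqP; rewrite -normr_le0.
  suff : - `|(z tau).2| <= - `|(z x).2| by rewrite Etau w0 normr0 lerN2.
  apply: (@right_dini_le0 R (fun x => - `|(z x).2|) x tau (ltW xd2)).
  - move=> y e _ e0; have [d' d'0 Hd'] := cc_cont CC y e0.
    exists d' => // y' /andP[_ y'y] yy'.
    have := Hd' y'; rewrite ltr0_norm ?subr_lt0// opprB => /(_ _)Y.
    have {}Y := Y ltac:(lra); have [_] := (pair_norm_ltP _ _).1 Y.
    rewrite /= => Y2; have := lerB_dist (z y').2 (z y).2; lra.
  - move=> y e /andP[xy yt] e0.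
    have yd : tau - d < y < tau by apply/andP; split; lra.
    have [nE f1 f2] := near_ y yd.
    have [del del0 Hd] := om_deriv y nE e e0.
    exists del => // h /andP[h0 hdel].
    have Eh : y + h - y = h by ring.
    have := Hd (y + h) I; rewrite Eh gtr0_norm// => /(_ hdel).
    rewrite /GRing.scale /= ler_norml => /andP[D1 D2].
    have eh : 0 < e * h by rewrite mulr_gt0.
    have := ler_norm (z (y + h)).2; have := ler_norm (- (z (y + h)).2); rewrite normrN.
    have Vpos' := ltW Vpos; have ki0' := ki0.
    have [w|w|w] := ltgtP (z y).2 0.
    + have fs := fstar_ge Hs Vpos' ns x2V w.
      have : 0 < ki s * fstar s V (z y) by rewrite mulr_gt0//; lra.
      move=> K; have : 0 < h * (ki s * fstar s V (z y)) by rewrite mulr_gt0.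
      rewrite (ltr0_norm w); lra.
    + have fs := fstar_le Hs Vpos' ns x1V (ltW w).
      have : ki s * fstar s V (z y) < 0 by rewrite pmulr_rlt0//; lra.
      move=> K; have : h * (ki s * fstar s V (z y)) < 0 by rewrite pmulr_rlt0.
      rewrite (gtr0_norm w); lra.
    + rewrite w normr0 oppr0 add0r => _ _.
      by apply: le_trans (ltW eh); rewrite oppr_le0.
have hd : tau - d < tau - d / 2 < tau by apply/andP; split; lra.
have [nE f1 _] := near_ _ hd.
have d20' : 0 < d / 2 by lra.
(* With [omega] constantly 0 its derivative gives [fstar = 0]; but at [omega = 0] this is the
   minimum of [f], which is negative because of [x1]. *)
have fz : - ki s * fstar s V (z (tau - d / 2)) = 0.
  apply: (has_deriv_uniq0 d20' (om_deriv _ nE)) => x.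
  rewrite ltr_norml => /andP[x_1 x_2]; rewrite !om0//; apply/andP; split; lra.
have fs := fstar_le Hs (ltW Vpos) ns x1V (_ : 0 <= (z (tau - d / 2)).2).
have {}fs := fs ltac:(by rewrite om0).
move/eqP: fz; rewrite mulNr oppr_eq0 mulf_eq0 gt_eqF//= => /eqP fz; lra.
Qed.

End Strict.

(** * Invariance *)

(* A globally Lipschitz field that agrees with [rhs s] as long as the state
   stays in the box of size [M] and in the ellipsoid where [m0] bounds the
   denominator of [f]. *)
Definition clamped_rhs (R : realType) (s : pll_cc R) (M m0 : R) (z : R * R * 'cV[R]_4) :
    R * R * 'cV[R]_4 :=
  (pll_rhs s (ft s M m0 z) z.1, A s *m z.2).

Lemma clamped_rhs_lip (R : realType) (s : pll_cc R) (M m0 : R) : blip (ft s M m0) ->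
  exists2 L, 0 < L & forall a b,
    `|clamped_rhs s M m0 a - clamped_rhs s M m0 b| <= L * `|a - b|.
Proof.
move=> [K K0 [_ HK]].
pose L := (`|kp s| + `|ki s|) * K + 1 + 4 * `|A s|.
have nA := normr_ge0 (A s); have nkp := normr_ge0 (kp s); have nki := normr_ge0 (ki s).
have kK : 0 <= (`|kp s| + `|ki s|) * K by rewrite mulr_ge0// addr_ge0.
exists L => [|a b]; first by rewrite /L; lra.
have /pair_norm_leP[ab1 ab2] : `|a - b| <= `|a - b| by [].
have /pair_norm_leP[_ ab12] := ab1.
have n0 := normr_ge0 (a - b); have Kab := HK a b.
have kKab := mulr_ge0 kK n0.
apply/pair_norm_leP; split; last first.
  rewrite /= -mulmxBr; apply: (le_trans (mulmx_norm_le _ _)); rewrite /L; nra.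
have E1 : `|kp s| * `|ft s M m0 a - ft s M m0 b| <= `|kp s| * (K * `|a - b|) by rewrite ler_wpM2l.
have E2 : `|ki s| * `|ft s M m0 a - ft s M m0 b| <= `|ki s| * (K * `|a - b|) by rewrite ler_wpM2l.
have E3 : 0 <= `|kp s| * (K * `|a - b|) by rewrite !mulr_ge0.
have E4 : 0 <= `|ki s| * (K * `|a - b|) by rewrite !mulr_ge0.
have E5 : 0 <= `|A s| * `|a - b| by rewrite mulr_ge0.
apply/pair_norm_leP; split; rewrite /= /L.
  have -> : - kp s * ft s M m0 a + a.1.2 - (- kp s * ft s M m0 b + b.1.2) =
    - (kp s * (ft s M m0 a - ft s M m0 b)) + (a.1.2 - b.1.2) by ring.
  apply: (le_trans (ler_normD _ _)); rewrite normrN normrM; lra.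
have -> : - ki s * ft s M m0 a - - ki s * ft s M m0 b =
    - (ki s * (ft s M m0 a - ft s M m0 b)) by ring.
rewrite normrN normrM; lra.
Qed.

(** The companion of [alpha]: the rate of the angle, that is, the coefficient of the PLL field along
    [ps]. *)
Definition beta (R : realType) (s : pll_cc R) (p : R * R -> R * R) (y : R * R) (c : R) : R :=
  cross ('D_(1, 0) p y) (pll_rhs s c (p y)) / cross ('D_(1, 0) p y) ('D_(0, 1) p y).

Section Nagumo.
Context {R : realType} {s : pll_cc R} {Vb : R} {C : R -> set (R * R)}
  {VPLL : R * R -> R} {p : R * R -> R * R} {U : R}.
Hypothesis CS : cycle_setting s Vb C VPLL p U.

Notation pV := (fun y : R * R => 'D_(1, 0) p y).
Notation ps := (fun y : R * R => 'D_(0, 1) p y).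
Notation Lam := (@Lam R Vb C VPLL).

Lemma path_approx V t a b e : 0 < V <= Vb -> 0 < e -> exists2 d, 0 < d &
  forall h, `|h| < d -> `|p (V + a * h, t + b * h) - p (V, t)
    - h *: (a *: pV (V, t) + b *: ps (V, t))| <= e * `|h|.
Proof.
move=> V0 e0; pose K := `|a| + `|b| + 1.
have na := normr_ge0 a; have nb := normr_ge0 b.
have K0 : 0 < K by rewrite /K; lra.
have [r r0 Hr] := p_strong_diff CS (y := (V, t)) V0 (divr_gt0 e0 K0).
exists (r / K); first by rewrite divr_gt0.
move=> h; rewrite ltr_pdivlMr// => hr.
have nh := normr_ge0 h.
have Ea : V + a * h - V = a * h by ring.
have Eb : t + b * h - t = b * h by ring.
have := Hr (V, t) (V + a * h, t + b * h).
rewrite /= Ea Eb => /(_ _ _) H.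
have {}H := H ltac:(by rewrite subrr normr0 ltW).
have {}H := H ltac:(by apply/pair_norm_leP; rewrite /= Ea Eb !normrM; split; rewrite /K in hr; nra).
move: H; move: ('D_(1, 0) p (V, t)) ('D_(0, 1) p (V, t)) => u v.
move: (p (V + a * h, t + b * h)) (p (V, t)) => P1 P0 H.
have -> : P1 - P0 - h *: (a *: u + b *: v) = P1 - P0 - (a * h) *: u - (b * h) *: v.
  by rewrite scalerDr !scalerA (mulrC h a) (mulrC h b) opprD addrA.
apply: (le_trans H); rewrite !normrM -mulrDl mulrA ler_wpM2r// mulrAC ler_pdivrMr//.
by rewrite ler_wpM2l ?(ltW e0)// /K lerDl.
Qed.

Context (Vbb : R).

Lemma Lam_subset V V' q : V <= V' -> Lam V q -> Lam V' q.
Proof. by move=> VV' [Rq qV]; split=> //; exact: le_trans VV'. Qed.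

(** From a smaller cycle any short step stays in the region. On the outermost one the step is
    replaced by a motion in the coordinates of [p] with rates [alpha - eps] and [beta], whose level
    the growing region reaches. *)
Lemma subtangent V V' t x (a' : R -> R) e : 0 < V -> V <= Vb -> 0 <= V' -> V' <= V ->
  VCC s x <= Vbb ->
  (forall eps, 0 < eps -> exists2 d, 0 < d & forall h, 0 < h < d ->
     V + (alpha s p (V, t) (f s (p (V, t)) x) - eps) * h <= a' h) ->
  (forall h, 0 < h -> V <= a' h) -> (forall h, 0 < h -> a' h <= Vb) -> 0 < e ->
  exists2 d, 0 < d & forall h, 0 < h < d -> exists2 q', Lam (a' h) q' &
    `|q' - p (V', t) - h *: pll_rhs s (f s (p (V', t)) x) (p (V', t))| <= e * h.
Proof.
move=> V0 VVb V'0 V'V xV Ha aV aVb e0.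
have [V'E|V'V'] := eqVneq V' V; last first.
  have lt : 0 <= V' < V by rewrite V'0 lt_neqAle V'V'.
  have [r r0 Hr] := Lam_int CS t lt VVb.
  set X := pll_rhs _ _ _.
  have X0 : 0 < `|X| + 1 by rewrite ltr_wpDl.
  exists (r / (`|X| + 1)); first by rewrite divr_gt0.
  move=> h /andP[h0]; rewrite ltr_pdivlMr// => hr.
  exists (p (V', t) + h *: X).
    apply: (Lam_subset (aV h h0)); apply: Hr.
    by rewrite addrC addrA addNr add0r normrZ gtr0_norm//; nra.
  by rewrite [p _ + _]addrC addrK subrr normr0 mulr_ge0// ltW.
rewrite V'E; have VV : 0 < V <= Vb by rewrite V0.
set c := f s (p (V, t)) x in Ha *.
have nv := normr_ge0 (pV (V, t)).
(* Lowering the rate of the level by [eps] displaces the point by [eps * |pV|] per unit time, at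
   most [e / 2]. *)
pose eps := e / (2 * (`|pV (V, t)| + 1)).
have eps0 : 0 < eps by rewrite divr_gt0// mulr_gt0// ltr_wpDl.
have e20 : 0 < e / 2 by lra.
have [d1 d10 H1] := Ha eps eps0.
set al := alpha s p (V, t) c in H1.
have [d2 d20 H2] := path_approx t (al - eps) (beta s p (V, t) c) VV e20.
have K0 : 0 < `|al - eps| + 1 by rewrite ltr_wpDl.
exists (Num.min d1 (Num.min d2 (V / (`|al - eps| + 1)))).
  by rewrite !lt_min d10 d20 divr_gt0.
move=> h /andP[h0]; rewrite !lt_min ltr_pdivlMr// => /andP[h1 /andP[h2 h3]].
exists (p (V + (al - eps) * h, t + beta s p (V, t) c * h)).
  apply/(Lam_p CS _ (aVb h h0)).
  exists (V + (al - eps) * h), (t + beta s p (V, t) c * h); split=> //.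
    have := ler_norm (- ((al - eps) * h)); rewrite normrN normrM (gtr0_norm h0); nra.
  by apply: H1; rewrite h0.
rewrite (pll_rhs_decomp CS c (y := (V, t)) VV) -/al -/(beta s p (V, t) c).
have := H2 h; rewrite (gtr0_norm h0) => /(_ h2).
have epsE : eps * `|pV (V, t)| <= e / 2.
  rewrite /eps; set w := `|_| in nv *.
  have -> : e / (2 * (w + 1)) * w = e / 2 * (w / (w + 1)) by field; rewrite gt_eqF// ltr_wpDl.
  by rewrite ler_piMr ?(ltW e20)// ler_pdivrMr ?mul1r ?lerDl// ltr_wpDl.
move: epsE; clear -e0 h0 eps0.
move: ('D_(1, 0) p (V, t)) ('D_(0, 1) p (V, t)) (p (V, t)) => u v P0.
move: (p _) => P1; move: (beta _ _ _ _) => b epsE X.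
have -> : P1 - P0 - h *: (al *: u + b *: v) =
  (P1 - P0 - h *: ((al - eps) *: u + b *: v)) - (h * eps) *: u.
  rewrite -[RHS]addrA -opprD -[(h * eps) *: u]scalerA -scalerDr; congr (_ - _ *: _).
  by rewrite scalerBl addrAC subrK.
apply: (le_trans (ler_normB _ _)).
rewrite normrZ normrM (gtr0_norm h0) (gtr0_norm eps0).
have : h * (eps * `|u|) <= h * (e / 2) by rewrite ler_wpM2l// ltW.
lra.
Qed.
End Nagumo.

Section Invariance.
Context {R : realType} {s : pll_cc R} {Vb : R} {C : R -> set (R * R)}
  {VPLL : R * R -> R} {p : R * R -> R * R} {U : R}.
Hypothesis CS : cycle_setting s Vb C VPLL p U.

Notation Reg := (region (C Vb)).
Notation Lam := (@Lam R Vb C VPLL).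

Context (M m0 Vbb : R).
Hypothesis bl : blip (ft s M m0).
Hypothesis ftE : forall (q : R * R) x, `|q| <= M -> VCC s x <= Vbb -> ft s M m0 (q, x) = f s q x.
Hypothesis RegM : forall q, Reg q -> `|q| <= M.

(* Nagumo's argument: the distance to the (growing) set [Lam (a t)] satisfies
   a Gronwall inequality, because the field is Lipschitz and subtangential to
   the set at the closest point. *)
Lemma nagumo (T : R) (q : R -> R * R) (x : R -> 'cV[R]_4) (a : R -> R) : 0 < T ->
  (forall t, 0 <= t <= T ->
    has_deriv `[0, T] q t (pll_rhs s (ft s M m0 (q t, x t)) (q t))) ->
  (forall t, 0 <= t <= T -> VCC s (x t) <= Vbb) ->
  (forall t t', 0 <= t -> t <= t' -> t' <= T -> a t <= a t') ->
  (forall t, 0 <= t <= T -> 0 <= a t <= Vb) ->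
  (forall t, 0 < t <= T -> 0 < a t) ->
  Lam (a 0) (q 0) ->
  (forall t tau eps, 0 < t < T -> 0 < eps -> exists2 d, 0 < d & forall h, 0 < h < d ->
     a t + (alpha s p (a t, tau) (f s (p (a t, tau)) (x t)) - eps) * h <= a (t + h)) ->
  Lam (a T) (q T).
Proof.
move=> T0 qd xV amono aVb apos L0 Ha.
have [L L0' HL] := clamped_rhs_lip bl.
have XL (q1 q2 : R * R) (y : 'cV[R]_4) : `|pll_rhs s (ft s M m0 (q1, y)) q1 -
    pll_rhs s (ft s M m0 (q2, y)) q2| <= L * `|q1 - q2|.
  have /pair_norm_leP[H _] := HL (q1, y) (q2, y); apply: (le_trans H).
  by rewrite ler_wpM2l ?(ltW L0')// prod_normE ge_max /= subrr normr0 normr_ge0 lexx.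
have /choice[y Hy] : forall t, exists y : R * R, 0 <= t <= T ->
    [/\ 0 <= y.1, y.1 <= a t & forall q', Lam (a t) q' -> `|q t - p y| <= `|q t - q'|].
  move=> t; have [tT|nt] := pselect (0 <= t <= T); last by exists 0.
  have [V' [t' H]] := Lam_closest CS (q t) (aVb t tT).
  by exists (V', t').
have Ly t : 0 <= t <= T -> Lam (a t) (p (y t)).
  move=> tT; have [y1 y2 _] := Hy t tT; have /andP[a0 ab] := aVb t tT.
  by apply/(Lam_p CS _ ab); exists (y t).1, (y t).2; rewrite -surjective_pairing.
pose d t := `|q t - p (y t)|.
have dle t q' : 0 <= t <= T -> Lam (a t) q' -> d t <= `|q t - q'|.
  by move=> tT; have [_ _] := Hy t tT; apply.
suff dT : d T = 0.
  have TT : 0 <= T <= T by rewrite lexx ltW.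
  have := Ly T TT; suff -> : q T = p (y T) by [].
  by apply/eqP; rewrite -subr_eq0 -normr_eq0 -/(d T) dT.
apply/eqP; rewrite eq_le normr_ge0 andbT; apply/ler_addgt0Pr => e e0; rewrite add0r.
have E0 := expR_gt0 (L * T).
have [|del del0 Hdel] := has_deriv_cont (qd 0 _) (divr_gt0 e0 E0).
  by rewrite lexx ltW.
(* [a 0] may be 0, where the parametrization degenerates. The estimate therefore starts at a small
   positive time, when the solution is still close to [q 0] and hence to the region. *)
pose t0 := Num.min (del / 2) (T / 2).
have t00 : 0 < t0 by rewrite lt_min; apply/andP; split; lra.
have [t01 t02] : t0 <= del / 2 /\ t0 <= T / 2 by rewrite /t0 !ge_min !lexx orbT.
have t0T : 0 <= t0 <= T by apply/andP; split; lra.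
have dt0 : d t0 <= e / expR (L * T).
  have Lq0 : Lam (a t0) (q 0).
    by apply: Lam_subset L0; apply: amono => //; lra.
  apply: (le_trans (dle t0 _ t0T Lq0)); apply/ltW/Hdel; first by rewrite /= in_itv.
  by rewrite subr0 gtr0_norm//; lra.
have G : d T <= expR (L * (T - t0)) * d t0.
  apply: right_dini_gronwall; [exact: ltW| by case/andP: t0T |by move=> *; exact: normr_ge0|..].
  - move=> t eps /andP[tt0 tT] eps0.
    have tT' : 0 <= t <= T by apply/andP; split; lra.
    have [r r0 Hr] := has_deriv_cont (qd t tT') eps0.
    exists r => // t' /andP[t0t' t't] tr.
    have t'T : 0 <= t' <= T by apply/andP; split; lra.
    (* The region only grows, so an earlier closest point remains admissible. *)
    have Lt : Lam (a t) (p (y t')).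
      by apply: Lam_subset (Ly t' t'T); apply: amono; lra.
    apply: (le_trans (dle t _ tT' Lt)).
    have := Hr t'; rewrite /= in_itv /= t'T => /(_ isT).
    rewrite ltr0_norm ?subr_lt0// opprB => /(_ _) Y; have {}Y := Y ltac:(lra).
    have := ler_distD (q t') (q t) (p (y t')); rewrite [`|q t - q t'|]distrC /d; lra.
  - move=> t eps /andP[tt0 tT] eps0.
    have tT' : 0 <= t <= T by apply/andP; split; lra.
    have eps20 : 0 < eps / 2 by lra.
    have [r1 r10 H1] := qd t tT' _ eps20.
    have [y1 y2 _] := Hy t tT'; have at0 : 0 < a t by apply: apos; apply/andP; split; lra.
    have /andP[_ aVbt] := aVb t tT'.
    (* Frozen after [T], because [subtangent] asks for the bounds at all [h > 0]. *)
    pose a' h := a (Num.min (t + h) T).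
    have minT h : 0 < h -> t <= Num.min (t + h) T /\ Num.min (t + h) T <= T.
      by move=> h0; rewrite ge_min lexx orbT le_min; split=> //; apply/andP; split; lra.
    have [||||r2 r20 H2] := @subtangent R s Vb C VPLL p U CS Vbb (a t) (y t).1 (y t).2
      (x t) a' (eps / 2) at0 aVbt y1 y2 (xV t tT').
    + move=> eta eta0; have [|r r0 Hr] := Ha t (y t).2 eta _ eta0.
        by apply/andP; split; lra.
      exists (Num.min r (T - t)); first by rewrite lt_min r0 subr_gt0.
      move=> h /andP[h0]; rewrite lt_min => /andP[hr hT].
      rewrite /a' min_l; first by apply: Hr; rewrite h0.
      lra.
    + by move=> h /minT[m1 m2]; apply: amono => //; case/andP: tT'.
    + move=> h /minT[m1 m2]; have /andP[] // : 0 <= a (Num.min (t + h) T) <= Vb.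
      by apply: aVb; rewrite m2 andbT; lra.
    + by [].
    exists (Num.min (Num.min r1 r2) (T - t)); first by rewrite !lt_min r10 r20 subr_gt0.
    move=> h /andP[h0]; rewrite !lt_min => /andP[/andP[hr1 hr2] hT].
    have thT : 0 <= t + h <= T by apply/andP; split; lra.
    have [|q' Lq' Hq'] := H2 h; first by rewrite h0.
    have {}Lq' : Lam (a (t + h)) q'.
      by move: Lq'; rewrite /a' min_l//; lra.
    apply: (le_trans (dle _ _ thT Lq')).
    have := H1 (t + h); rewrite /= in_itv /= thT => /(_ isT).
    have Eh : t + h - t = h by ring.
    rewrite Eh gtr0_norm// => /(_ hr1) Z.
    rewrite -surjective_pairing in Hq'.
    have pyM : `|p (y t)| <= M by apply: RegM; case: (Ly t tT').
    rewrite -ftE ?xV// in Hq'.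
    have X := XL (q t) (p (y t)) (x t).
    move: Z Hq' X; rewrite /d.
    set X1 := pll_rhs _ _ (q t); set X2 := pll_rhs _ _ (p (y t)).
    move: (q (t + h)) (q t) (p (y t)) X1 X2 => qh qt py X1 X2 Z Hq' X.
    (* Two first-order errors, the current distance, and the variation of the field between [q t]
       and its closest point, which the Lipschitz constant bounds. *)
    have -> : qh - q' = (qh - qt - h *: X1) - (q' - py - h *: X2) + (qt - py) + h *: (X1 - X2).
      by apply: injective_projections; rewrite /= /GRing.scale /=; ring.
    apply: (le_trans (ler_normD _ _)).
    have : `|qh - qt - h *: X1 - (q' - py - h *: X2) + (qt - py)| <=
        eps / 2 * h + eps / 2 * h + `|qt - py|.
      apply: (le_trans (ler_normD _ _)); rewrite lerD2r.
      by apply: (le_trans (ler_normB _ _)); exact: lerD.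
    have : `|h *: (X1 - X2)| <= h * (L * `|qt - py|).
      by rewrite normrZ gtr0_norm// ler_wpM2l// ltW.
    lra.
apply: (le_trans G).
apply: (@le_trans _ _ (expR (L * T) * (e / expR (L * T)))).
  apply: ler_pM; [exact: ltW (expR_gt0 _)|exact: normr_ge0| |exact: dt0].
  by rewrite ler_expR ler_wpM2l ?(ltW L0')//; lra.
by rewrite mulrC divfK// gt_eqF.
Qed.

End Invariance.

(** * The rate of the level along solutions and its bound by F *)

Lemma has_deriv_reflect (R : realType) (W : normedModType R) (J : set R) (u : R -> W) t d :
  has_deriv J u (- t) d -> has_deriv [set r | J (- r)] (fun r => u (- r)) t (- d).
Proof.
move=> ud e e0; have [del del0 H] := ud e e0; exists del => // r Jr rt.
have E : - r - - t = - (r - t) by ring.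
have := H (- r) Jr; rewrite E normrN => /(_ rt).
by rewrite scaleNr -scalerN.
Qed.

Section Rate.
Context {R : realType} {s : pll_cc R} {Vb : R} {C : R -> set (R * R)}
  {VPLL : R * R -> R} {p : R * R -> R * R} {U : R}.
Hypothesis CS : cycle_setting s Vb C VPLL p U.

Notation Reg := (region (C Vb)).

(** [q r] may lie outside the region, where [VPLL] says nothing, so it is compared with a point [a]
    of the cycle whose level is the linear prediction. The clause on [b] serves both for [q r]
    itself and for the exit point of the segment from [a] to [q r]. *)
Lemma VPLL_approx (J : set R) (q : R -> R * R) (t V tau c e : R) : 0 < V <= Vb ->
  q t = p (V, tau) -> has_deriv J q t (pll_rhs s c (p (V, tau))) -> 0 < e ->
  exists2 d, 0 < d & forall r, J r -> `|r - t| < d ->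
    V + alpha s p (V, tau) c * (r - t) <= Vb ->
    exists a, [/\ Reg a, VPLL a = V + alpha s p (V, tau) c * (r - t),
      `|q r - a| <= e * `|r - t| &
      forall b, Reg b -> `|b - a| <= `|q r - a| -> `|VPLL b - VPLL a| <= e * `|r - t|].
Proof.
move=> V0 qt qd e0; have [K [r0 [K0 r00 HK]]] := VPLL_lip CS tau V0.
have K1 : 0 < K + 1 by lra.
pose e' := Num.min (e / 2) (e / (2 * (K + 1))).
have e'0 : 0 < e' by rewrite lt_min !divr_gt0// mulr_gt0.
have [e'1 e'2] : e' <= e / 2 /\ e' <= e / (2 * (K + 1)) by rewrite /e' !ge_min !lexx orbT.
have [d1 d10 H1] := qd e' e'0.
have [d2 d20 H2] := path_approx CS tau (alpha s p (V, tau) c) (beta s p (V, tau) c) V0 e'0.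
rewrite -(pll_rhs_decomp CS c (y := (V, tau)) V0) in H2.
move: (alpha s p (V, tau) c) H2 => al H2.
set X := pll_rhs s c _ in H1 H2.
have V1 : 0 < V by case/andP: V0.
have nal := normr_ge0 al; have nX := normr_ge0 X.
have al0 : 0 < `|al| + 1 by lra.
have X0 : 0 < `|X| + 3 * e + 1 by lra.
exists (Num.min (Num.min d1 d2) (Num.min (V / (`|al| + 1)) (r0 / (`|X| + 3 * e + 1)))).
  by rewrite !lt_min d10 d20 !divr_gt0.
move=> r Jr; rewrite !lt_min !ltr_pdivlMr// => /andP[/andP[h1 h2] /andP[h3 h4]] hVb.
set h := r - t in h1 h2 h3 h4 hVb *.
have nh := normr_ge0 h.
exists (p (V + al * h, tau + beta s p (V, tau) c * h)).
have Vh : 0 <= V + al * h <= Vb.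
  rewrite hVb andbT; have := ler_norm (- (al * h)); rewrite normrN normrM; nra.
have A1 := H1 r Jr h1; have A2 := H2 h h2; rewrite -/h qt in A1.
have RA : Reg (p (V + al * h, tau + beta s p (V, tau) c * h)) by apply: (region_p CS).
have VA := VPLL_p CS (tau + beta s p (V, tau) c * h) Vh.
move: A2 RA VA; set a := p _ => A2 RA VA.
have qa : `|q r - a| <= 2 * e' * `|h|.
  have -> : q r - a = (q r - p (V, tau) - h *: X) - (a - p (V, tau) - h *: X).
    move: (q r) a (p _) X {A1 A2 RA VA H1 H2 X0 nX h4 qd} => [? ?] [? ?] [? ?] [? ?].
    by apply: injective_projections; rewrite /= /GRing.scale /=; ring.
  by apply: (le_trans (ler_normB _ _)); lra.
have pa : `|a - p (V, tau)| <= (`|X| + e) * `|h|.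
  rewrite -(subrK (h *: X) (a - p (V, tau))); apply: (le_trans (ler_normD _ _)).
  rewrite normrZ; nra.
split=> //.
  by apply: (le_trans qa); rewrite ler_wpM2r//; lra.
move=> b Rb ba.
have ar : `|a - p (V, tau)| < r0 by nra.
have br : `|b - p (V, tau)| < r0.
  have := ler_distD a b (p (V, tau)); nra.
apply: (le_trans (HK b a Rb RA br ar)).
have : 2 * (K + 1) * e' <= e by move: e'2; rewrite ler_pdivlMr ?mulr_gt0//; lra.
have := normr_ge0 (b - a) => nba X1.
apply: (@le_trans _ _ (K * (2 * e' * `|h|))); first by rewrite ler_wpM2l//; lra.
have : 0 <= e' * `|h| by rewrite mulr_ge0// ltW.
nra.
Qed.

Lemma VPLL_rate (J : set R) (q : R -> R * R) (t V tau c e : R) : 0 < V <= Vb ->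
  q t = p (V, tau) -> has_deriv J q t (pll_rhs s c (p (V, tau))) -> 0 < e ->
  exists2 d, 0 < d & forall r, J r -> `|r - t| < d ->
    V + alpha s p (V, tau) c * (r - t) <= Vb -> Reg (q r) ->
    `|VPLL (q r) - V - alpha s p (V, tau) c * (r - t)| <= e * `|r - t|.
Proof.
move=> V0 qt qd e0; have [d d0 H] := VPLL_approx V0 qt qd e0; exists d => // r Jr rt Vr Rq.
have [a [_ Va _ Ha]] := H r Jr rt Vr.
by have := Ha (q r) Rq (lexx _); rewrite Va opprD addrA.
Qed.

(** Before [t] the predicted level is below [Vb] by at least [al * (t - r)]. If [q r] were outside,
    the segment to it would meet the outer cycle at a point whose level differs from the prediction
    by at most half of that. *)
Lemma region_backward (J : set R) (q : R -> R * R) (t V tau c : R) : 0 < V <= Vb ->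
  q t = p (V, tau) -> has_deriv J q t (pll_rhs s c (p (V, tau))) ->
  0 < alpha s p (V, tau) c ->
  exists2 d, 0 < d & forall r, J r -> t - d < r <= t -> Reg (q r).
Proof.
move=> V0 qt qd; set al := alpha s p (V, tau) c => al0.
have al2 : 0 < al / 2 by lra.
have [d d0 H] := VPLL_approx V0 qt qd al2; exists d => // r Jr /andP[r1 r2].
have VVb : V <= Vb by case/andP: V0.
have [->|rt] := eqVneq r t.
  by rewrite qt; apply: (region_p CS); rewrite VVb ltW//; case/andP: V0.
have rt' : r < t by rewrite lt_neqAle rt.
have nr : `|r - t| = t - r by rewrite ltr0_norm ?subr_lt0// opprB.
have Vr : V + al * (r - t) <= Vb by nra.
have rd : `|r - t| < d by rewrite nr; lra.
have [a [Ra Va qa Ha]] := H r Jr rd Vr.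
apply: contrapT => nR; have [b [Rb Vbb] ba] := region_exit CS Ra nR.
have := Ha b Rb ba; rewrite Vbb Va -/al nr ler_norml => /andP[_].
have : 0 < al * (t - r) by rewrite mulr_gt0// subr_gt0.
lra.
Qed.

Context (M m0 Vbb : R) (F : R -> R -> R).
Hypothesis bl : blip (ft s M m0).
Hypothesis ftE : forall (q : R * R) x, `|q| <= M -> VCC s x <= Vbb -> ft s M m0 (q, x) = f s q x.
Hypothesis RegM : forall q, Reg q -> `|q| <= M.
Hypothesis Hnonsing : nonsingular s Vbb.
Hypothesis HF : forall (J : set R) (z : R -> R * R * 'cV[R]_4),
  is_interval J -> solution s J z ->
  (forall t, J t -> Reg (z t).1 /\ VCC s (z t).2 <= Vbb) ->
  forall t, J t -> exists d : R, derive_within J (fun r => VPLL (z r).1 : R^o) t d /\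
    d <= F (VPLL (z t).1) (VCC s (z t).2).

Lemma clamped_rhs_E z : Reg z.1 -> VCC s z.2 <= Vbb -> clamped_rhs s M m0 z = rhs s z.
Proof.
move=> Rz xV; rewrite /clamped_rhs /rhs; case: z Rz xV => q x /= Rq xV.
by rewrite ftE// RegM.
Qed.

Lemma clamped_solution z0 (e : R) : e = 1 \/ e = -1 ->
  exists u : R -> R * R * 'cV[R]_4, u 0 = z0 /\
    forall t, 0 <= t -> has_deriv [set t | 0 <= t] u t (e *: clamped_rhs s M m0 (u t)).
Proof.
move=> e1; have [L L0 HL] := clamped_rhs_lip bl.
apply: (@picard R _ (fun z => e *: clamped_rhs s M m0 z) L z0) => //.
  apply: picard_space_prod; last exact: picard_space_col.
  by apply: picard_space_prod; exact: picard_space_R.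
move=> a b; rewrite -scalerBr normrZ.
have -> : `|e| = 1 by case: e1 => ->; rewrite ?normrN normr1.
by rewrite mul1r; exact: HL.
Qed.

(** The hypothesis on [F] concerns solutions that stay in the region. One that ends at the given
    state is obtained by reversing time: [alpha > 0] keeps its past in the region, and the strict
    bound on [VCC] leaves room for the growth of [VCC] backwards. Its left derivative at the end is
    [alpha]. *)
Lemma alpha_le_F V tau x : 0 < V <= Vb -> VCC s x < Vbb ->
  0 < alpha s p (V, tau) (f s (p (V, tau)) x) ->
  alpha s p (V, tau) (f s (p (V, tau)) x) <= F V (VCC s x).
Proof.
move=> V0 xV al0.
have [u [u0 ud]] := clamped_solution (p (V, tau), x) (or_intror erefl).
have V0' : 0 <= V <= Vb by case/andP: V0 => /ltW -> ->.
have Rp : Reg (p (V, tau)) by apply: (region_p CS).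
pose z t := u (- t).
pose Jn := [set r : R | 0 <= - r].
have zd t : t <= 0 -> has_deriv Jn z t (clamped_rhs s M m0 (z t)).
  move=> t0; have nt : 0 <= - t by rewrite oppr_ge0.
  by have := has_deriv_reflect (ud _ nt); rewrite scaleN1r opprK.
have z0 : z 0 = (p (V, tau), x) by rewrite /z oppr0 u0.
have rhs0 : clamped_rhs s M m0 (z 0) = rhs s (p (V, tau), x).
  by rewrite z0 clamped_rhs_E// ltW.
have zd0 := has_deriv_fst (zd 0 (lexx _)).
rewrite rhs0 /= in zd0.
have [d1 d10 H1] := region_backward V0 (congr1 fst z0) zd0 al0.
have [d2 d20 H2] : exists2 d, 0 < d & forall r, Jn r -> `|r| < d -> VCC s (z r).2 < Vbb.
  have zdx := has_deriv_snd (zd 0 (lexx _)).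
  have wd := has_deriv_quad (P s) zdx.
  have e0 : 0 < Vbb - VCC s x by rewrite subr_gt0.
  have [d d0 Hd] := has_deriv_cont wd e0; exists d => // r Jr rd.
  have := Hd r Jr; rewrite subr0 => /(_ rd); rewrite z0 /= ltr_norml /VCC => /andP[_]; lra.
pose eps := Num.min d1 d2 / 2.
have m12 : 0 < Num.min d1 d2 by rewrite lt_min d10.
have [m1 m2] : Num.min d1 d2 <= d1 /\ Num.min d1 d2 <= d2 by rewrite !ge_min !lexx orbT.
have eps0 : 0 < eps by rewrite /eps; lra.
pose J := `[- eps, 0]%classic : set R.
have JJ : J `<=` Jn by move=> r; rewrite /J /Jn /= in_itv /=; lra.
have inJ r : J r -> Reg (z r).1 /\ VCC s (z r).2 <= Vbb.
  move=> Jr; have Jnr := JJ _ Jr; move: Jr; rewrite /J /= in_itv /= => /andP[r1 r2]; split.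
    by apply: H1 => //; apply/andP; split; rewrite ?sub0r /eps in r1 *; lra.
  apply/ltW/H2 => //; rewrite ler0_norm//; rewrite /eps in r1; lra.
have sol : solution s J z.
  move=> r Jr; have [Rr xr] := inJ r Jr; split; first exact: Hnonsing.
  apply/derive_withinP; apply: (has_deriv_sub JJ).
  rewrite -clamped_rhs_E//; apply: zd; have := JJ _ Jr; rewrite /Jn /=; lra.
have J0 : J 0 by rewrite /J /= in_itv /= lexx andbT; lra.
have iJ : is_interval J by exact: interval_is_interval.
have [d [/derive_withinP dd dF]] := HF iJ sol inJ J0.
move: dF; rewrite z0 /= (VPLL_p CS)// => dF; apply: le_trans dF.
apply/ler_addgt0Pr => e e0; have e20 : 0 < e / 2 by lra.
have [d3 d30 H3] := VPLL_rate V0 (congr1 fst z0) zd0 e20.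
have [d4 d40 H4] := dd _ e20.
pose h := Num.min eps (Num.min (d3 / 2) (d4 / 2)).
have h0 : 0 < h by rewrite !lt_min eps0; apply/andP; split; lra.
have [h1 [h2 h3]] : h <= eps /\ h <= d3 / 2 /\ h <= d4 / 2.
  by rewrite /h !ge_min !lexx !orbT.
have Jh : J (- h) by rewrite /J /= in_itv /=; apply/andP; split; lra.
have nh : `|- h| = h by rewrite normrN gtr0_norm.
have := H4 (- h) Jh; rewrite !subr0 nh => /(_ _) X4; have {}X4 := X4 ltac:(lra).
have [Rh _] := inJ _ Jh.
have := H3 (- h) (JJ _ Jh); rewrite !subr0 nh => /(_ _ _ Rh) X3.
have VVb : V <= Vb by case/andP: V0.
have {}X3 := X3 ltac:(lra) ltac:(nra).
move: X4; rewrite z0 /= (VPLL_p CS)// /GRing.scale /= => X4.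
move: al0 X3; move: (alpha _ _ _ _) => al al0 X3.
move: X3 X4; rewrite !ler_norml => /andP[? ?] /andP[? ?].
by rewrite -(ler_pM2r h0); lra.
Qed.

End Rate.

(** * Decay of the quadratic Lyapunov function *)

Lemma deriv_le_decrease (R : realType) (J : set R) (w w' : R -> R) (a b rho : R) : a <= b ->
  `[a, b] `<=` J -> (forall t, a <= t <= b -> has_deriv J (w : R -> R^o) t (w' t)) ->
  (forall t, a <= t <= b -> w' t <= - rho) -> w b <= w a - rho * (b - a).
Proof.
move=> ab abJ wd wr.
have inJ t : a <= t <= b -> J t by move=> tab; apply: abJ; rewrite /= in_itv.
suff : w b + rho * b <= w a + rho * a by lra.
apply: (@right_dini_le0 R (fun t => w t + rho * t)) => //.
- move=> t e /andP[ta tb] e0.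
  have tab : a <= t <= b by rewrite tb ltW.
  have e20 : 0 < e / 2 by lra.
  have [d d0 Hd] := has_deriv_cont (wd t tab) e20.
  have r0 : 0 < 2 * (`|rho| + 1) by rewrite mulr_gt0// ltr_wpDl.
  exists (Num.min d (e / (2 * (`|rho| + 1)))); first by rewrite lt_min d0 divr_gt0.
  move=> r /andP[ar rt]; rewrite ltrBlDl -ltrBlDr lt_min ltr_pdivlMr// => /andP[r1 r2].
  have rab : a <= r <= b by apply/andP; split; lra.
  have := Hd r (inJ r rab); rewrite ltr0_norm ?subr_lt0// opprB => /(_ r1).
  rewrite ltr_norml => /andP[X _].
  have := ler_norm rho; nra.
- move=> t e /andP[ta tb] e0.
  have tab : a <= t <= b by rewrite ta ltW.
  have [d d0 Hd] := wd t tab e e0; exists (Num.min d (b - t)).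
    by rewrite lt_min d0 subr_gt0.
  move=> h /andP[h0]; rewrite lt_min => /andP[hd hb].
  have hab : a <= t + h <= b by apply/andP; split; lra.
  have E : t + h - t = h by ring.
  have := Hd _ (inJ _ hab); rewrite E gtr0_norm// => /(_ hd).
  rewrite ler_norml /GRing.scale /= => /andP[_ X]; have := wr t tab; nra.
Qed.

Section Lyapunov.
Context {R : realType} {s : pll_cc R}.
Hypothesis Hs : standing_assumptions s.

Lemma VCC_rate (J : set R) (x : R -> 'cV[R]_4) (a b c : R) : a <= b -> `[a, b] `<=` J ->
  (forall t, a <= t <= b -> has_deriv J x t (A s *m x t)) ->
  (forall t, a <= t <= b -> c <= VCC s (x t)) ->
  VCC s (x b) <= VCC s (x a) - gamma s * c * (b - a).
Proof.
move=> ab abJ xd xc.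
have /choice[w' Hw'] : forall t, exists w', a <= t <= b ->
    has_deriv J (fun r => VCC s (x r) : R^o) t w' /\ w' <= - (gamma s * VCC s (x t)).
  move=> t; have [tab|nt] := pselect (a <= t <= b); last by exists 0.
  by have [w' ? ?] := VCC_deriv Hs (xd t tab); exists w'.
apply: (@deriv_le_decrease R J (fun t => VCC s (x t)) w' a b) => // t tab.
  by have [] := Hw' t tab.
have [_ X] := Hw' t tab.
by apply: (le_trans X); rewrite lerN2 ler_wpM2l ?xc// (ltW (gamma_gt0 Hs)).
Qed.

Lemma VCC_nonincreasing (J : set R) (x : R -> 'cV[R]_4) (a b : R) : a <= b -> `[a, b] `<=` J ->
  (forall t, a <= t <= b -> has_deriv J x t (A s *m x t)) ->
  VCC s (x b) <= VCC s (x a).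
Proof.
move=> ab abJ xd; have := @VCC_rate J x a b 0 ab abJ xd (fun t _ => VCC_ge0 Hs (x t)).
by rewrite mulr0 mul0r subr0.
Qed.

Lemma VCC_decreasing (J : set R) (x : R -> 'cV[R]_4) (a b : R) : a < b -> `[a, b] `<=` J ->
  (forall t, a <= t <= b -> has_deriv J x t (A s *m x t)) -> 0 < VCC s (x a) ->
  VCC s (x b) < VCC s (x a).
Proof.
move=> ab abJ xd xa; rewrite ltNge; apply/negP => H.
have sub t r : a <= t -> t <= r -> r <= b -> VCC s (x r) <= VCC s (x t).
  move=> at_ tr rb; apply: (@VCC_nonincreasing J) => // [y|y /andP[ty yr]].
    by rewrite /= in_itv /= => /andP[ty yr]; apply: abJ; rewrite /= in_itv /=; apply/andP; split; lra.
  by apply: xd; apply/andP; split; lra.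
have X : VCC s (x b) <= VCC s (x a) - gamma s * VCC s (x a) * (b - a).
  apply: (@VCC_rate J x a b (VCC s (x a)) (ltW ab) abJ xd) => t /andP[ta tb].
  by apply: (le_trans H); apply: sub.
have : 0 < gamma s * VCC s (x a) * (b - a).
  by rewrite !mulr_gt0 ?subr_gt0 ?(gamma_gt0 Hs).
lra.
Qed.

End Lyapunov.

(* First-order composition: [w] decreases at a rate of at least [g], and [phi]
   has the negative derivative [D] with respect to [w]. *)
Lemma chain_rate_ge (R : realFieldType) (phi phi' D w w2 w' g al eps e2 h : R) :
  0 < h -> 0 < eps -> D < 0 -> 0 < e2 /\ e2 <= 1 -> e2 <= eps / (2 * (- D + 1)) ->
  `|w2 - w - h * w'| <= e2 * h -> w' <= - g -> al <= D * - g ->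
  - (eps / (2 * (`|w'| + 1)) * `|w2 - w|) <= phi' - phi - (w2 - w) * D ->
  phi + (al - eps) * h <= phi'.
Proof.
move=> h0 eps0 D0 [e20 e2a] e2b X2 w'le alD X1.
move: X2; rewrite ler_norml => /andP[X2a X2b].
have nw' := normr_ge0 w'.
set e1 := eps / (2 * (`|w'| + 1)) in X1.
have e10 : 0 < e1 by rewrite divr_gt0// mulr_gt0// ltr_wpDl.
have Dw : `|w2 - w| <= (`|w'| + 1) * h.
  rewrite ler_norml; have := ler_norm w'; have := ler_norm (- w'); rewrite normrN.
  by move=> ? ?; apply/andP; split; nra.
have E1 : e1 * `|w2 - w| <= eps / 2 * h.
  apply: (le_trans (ler_wpM2l (ltW e10) Dw)); rewrite mulrA ler_wpM2r ?(ltW h0)//.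
  rewrite /e1 le_eqVlt; apply/orP; left; apply/eqP; field.
  by rewrite gt_eqF// ltr_wpDl.
have E2 : - D * e2 <= eps / 2.
  by move: e2b; rewrite ler_pdivlMr; [nra|lra].
have hw : h * w' <= h * - g by rewrite ler_pM2l.
have E3 : D * (w2 - w) >= D * ((- g + e2) * h).
  by rewrite ler_wnM2l ?(ltW D0)//; lra.
have E5 : al * h <= D * - g * h by rewrite ler_pM2r.
have E6 : - D * e2 * h <= eps / 2 * h by rewrite ler_pM2r.
lra.
Qed.

(** * Invariance of the estimation *)

Section Estimation.
Context {R : realType} {s : pll_cc R} {Vb : R} {C : R -> set (R * R)}
  {VPLL : R * R -> R} {p : R * R -> R * R} {U : R}.
Hypothesis CS : cycle_setting s Vb C VPLL p U.

Notation Reg := (region (C Vb)).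
Notation Lam := (@Lam R Vb C VPLL).
Let Hs := cs_assumptions CS.
Let HVb := cs_Vb CS.

Context (M m0 Vbb : R) (F : R -> R -> R) (Phi : R -> R).
Hypothesis bl : blip (ft s M m0).
Hypothesis ftE : forall (q : R * R) x, `|q| <= M -> VCC s x <= Vbb -> ft s M m0 (q, x) = f s q x.
Hypothesis RegM : forall q, Reg q -> `|q| <= M.
Hypothesis HVbb : Vb < Vbb.
Hypothesis Hnonsing : nonsingular s Vbb.
Hypothesis HF : forall (J : set R) (z : R -> R * R * 'cV[R]_4),
  is_interval J -> solution s J z ->
  (forall t, J t -> Reg (z t).1 /\ VCC s (z t).2 <= Vbb) ->
  forall t, J t -> exists d : R, derive_within J (fun r => VPLL (z r).1 : R^o) t d /\
    d <= F (VPLL (z t).1) (VCC s (z t).2).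
Hypothesis HPhi_noninc : forall V1 V2, 0 <= V1 -> V1 <= V2 -> V2 <= Vbb ->
  Phi V2 <= Phi V1.
Hypothesis HPhi_const : forall V, 0 <= V <= Vb -> Phi V = Vb.
Hypothesis HPhi_ode : forall V, Vb <= V <= Vbb ->
  derive_within `[Vb, Vbb] (Phi : R -> R^o) V (- (F (Phi V) V / (gamma s * V))).
Hypothesis HPhi_pos : forall V, Vb <= V < Vbb -> 0 < Phi V.
Hypothesis HPhi_end : Phi Vbb = 0.

Definition clamped_sol (T : R) (z : R -> R * R * 'cV[R]_4) : Prop :=
  forall t, 0 <= t <= T -> has_deriv `[0, T] z t (clamped_rhs s M m0 (z t)).

Lemma clamped_sol_VCC T z t t' : clamped_sol T z -> 0 <= t -> t <= t' -> t' <= T ->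
  VCC s (z t').2 <= VCC s (z t).2.
Proof.
move=> zs t0 tt' t'T.
apply: (@VCC_nonincreasing R s Hs `[0, T] (fun r => (z r).2)) => //.
  by move=> r; rewrite /= !in_itv /= => /andP[? ?]; apply/andP; split; lra.
move=> r /andP[? ?]; have rT : 0 <= r <= T by apply/andP; split; lra.
exact: has_deriv_snd (zs r rT).
Qed.

Lemma Lam_invariant T z V : 0 <= T -> clamped_sol T z -> 0 < V <= Vb ->
  VCC s (z 0).2 <= V -> Lam V (z 0).1 -> Lam V (z T).1.
Proof.
move=> T0 zs V0 xV L0; have [<-//|T0'] := eqVneq 0 T.
have {T0'} T0' : 0 < T by rewrite lt_neqAle T0'.
have HVbb' := HVbb.
have [V1 V2] : 0 < V /\ V <= Vb by case/andP: V0.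
have xle t : 0 <= t <= T -> VCC s (z t).2 <= V.
  by move=> /andP[t0 tT]; apply: le_trans xV; exact: clamped_sol_VCC zs _ t0 tT.
apply: (@nagumo R s Vb C VPLL p U CS M m0 Vbb bl ftE RegM T (fun t => (z t).1)
  (fun t => (z t).2) (fun=> V)) => //.
- by move=> t tT; have := has_deriv_fst (zs t tT); rewrite /= -surjective_pairing.
- by move=> t tT; apply: (le_trans (xle t tT)); lra.
- by move=> t _; rewrite ltW.
move=> t tau eps /andP[t0 tT] eps0; exists 1 => // h /andP[h0 _].
have tT' : 0 <= t <= T by apply/andP; split; exact: ltW.
have := alpha_le0 CS tau V0 (xle t tT').
move: (alpha _ _ _ _) => al al0; nra.
Qed.

Lemma Phi_bounds V : 0 <= V <= Vbb -> 0 <= Phi V <= Vb.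
Proof.
have HVbb' := HVbb; have HVb' := HVb.
move=> /andP[V0 V1].
have := HPhi_noninc V0 V1 (lexx _); rewrite HPhi_end => -> /=.
by have := HPhi_noninc (lexx 0) V0 V1; rewrite (HPhi_const (V := 0)) ?lexx ?(ltW HVb).
Qed.

(* The differential equation of [Phi] is used only where [alpha] is positive,
   hence where [F] is positive and [VCC > Vb]. *)
Lemma Phi_rate T z t tau eps : clamped_sol T z -> 0 < t < T -> VCC s (z t).2 < Vbb -> 0 < eps ->
  let V := Phi (VCC s (z t).2) in 0 < V ->
  exists2 d, 0 < d & forall h, 0 < h < d ->
    V + (alpha s p (V, tau) (f s (p (V, tau)) (z t).2) - eps) * h <= Phi (VCC s (z (t + h)).2).
Proof.
move=> zs /andP[t0 tT] wlt eps0 V V0.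
have HVbb' := HVbb; have HVb' := HVb.
set w := VCC s (z t).2 in wlt V V0 *.
have tT' : 0 <= t <= T by apply/andP; split; exact: ltW.
have w0 : 0 <= w := VCC_ge0 Hs _.
have /andP[_ VVb] : 0 <= V <= Vb by apply: Phi_bounds; rewrite w0 ltW.
have VV : 0 < V <= Vb by rewrite V0.
set al := alpha _ _ _ _.
have mono h : 0 < h < T - t -> V <= Phi (VCC s (z (t + h)).2).
  move=> /andP[h0 hT]; apply: HPhi_noninc; [exact: VCC_ge0| |exact: ltW].
  by apply: (clamped_sol_VCC zs); lra.
have [al0|al0] := leP al 0.
  exists (T - t); first by rewrite subr_gt0.
  by move=> h /[dup] /mono H /andP[h0 _]; nra.
have wV : Vb < w.
  rewrite ltNge; apply/negP => wVb.
  have VE : V = Vb by rewrite /V HPhi_const// w0.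
  have wV' : VCC s (z t).2 <= V by rewrite VE.
  by have := alpha_le0 CS tau VV wV'; rewrite leNgt al0.
have alF : al <= F V w.
  by apply: (alpha_le_F CS bl ftE RegM Hnonsing HF VV wlt).
have gw : 0 < gamma s * w by rewrite mulr_gt0 ?(gamma_gt0 Hs)//; lra.
(* [D] is the derivative of [Phi] at [w]; the differential equation is designed so that the slowest
   decay [- (gamma * w)] of [VCC] moves [Phi] at exactly the rate [F V w]. *)
pose D := - (F V w / (gamma s * w)).
have DF : D * - (gamma s * w) = F V w by rewrite /D mulrNN divfK// gt_eqF.
have D0 : D < 0 by rewrite /D oppr_lt0 divr_gt0//; exact: lt_le_trans alF.
have [w' wd w'le] := VCC_deriv Hs (has_deriv_snd (zs t tT')).
rewrite -/w in w'le.
have nw' := normr_ge0 w'.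
pose e1 := eps / (2 * (`|w'| + 1)).
have e10 : 0 < e1 by rewrite divr_gt0// mulr_gt0// ltr_wpDl.
pose e2 := Num.min 1 (eps / (2 * (- D + 1))).
have e20 : 0 < e2 by rewrite lt_min ltr01 divr_gt0// mulr_gt0//; lra.
have [e2a e2b] : e2 <= 1 /\ e2 <= eps / (2 * (- D + 1)) by rewrite /e2 !ge_min !lexx orbT.
have wI : Vb <= w <= Vbb by rewrite !ltW.
have [d1 d10 H1] := (derive_withinP _ _ _ _).1 (HPhi_ode wI) e1 e10.
have [d2 d20 H2] := wd e2 e20.
(* Besides [d1], the bound [w - Vb] keeps [VCC] at time [t + h] above [Vb], since [Phi] is
   differentiated relative to the interval from [Vb] to [Vbb] only. *)
have wm : 0 < Num.min d1 (w - Vb) by rewrite lt_min d10 subr_gt0.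
have [d3 d30 H3] := has_deriv_cont wd wm.
exists (Num.min (T - t) (Num.min d2 d3)); first by rewrite !lt_min subr_gt0 tT d20.
move=> h /andP[h0]; rewrite !lt_min => /andP[hT /andP[hd2 hd3]].
have Eh : t + h - t = h by ring.
have tth : t <= t + h by rewrite lerDl ltW.
have thT' : t + h <= T by rewrite -lerBrDl ltW.
have thT : `[0, T]%classic (t + h) by rewrite /= in_itv /= thT' andbT addr_ge0 ?ltW.
have := H2 _ thT; have := H3 _ thT; rewrite Eh (gtr0_norm h0) => /(_ hd3) X3 /(_ hd2) X2.
have wle : VCC s (z (t + h)).2 <= w := clamped_sol_VCC zs (ltW t0) tth thT'.
move: X2 X3; rewrite -/w /GRing.scale /=; set w2 := VCC s (z (t + h)).2 in wle * => X2.
rewrite lt_min => /andP[X3 X4].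
have w2I : `[Vb, Vbb]%classic w2.
  rewrite /= in_itv /= (le_trans wle (ltW wlt)) andbT.
  by move: X4; rewrite ltr_norml opprB ltrD2r => /andP[/ltW].
have := H1 w2 w2I X3; rewrite -/V -/D /GRing.scale /= ler_norml => /andP[X1 _].
apply: (chain_rate_ge h0 eps0 D0 (conj e20 e2a) e2b X2 w'le _ X1).
by rewrite DF.
Qed.

Definition estimate : set (R * R * 'cV[R]_4) :=
  [set z | [/\ Reg z.1, VCC s z.2 <= Vbb & VPLL z.1 <= Phi (VCC s z.2)]].

Lemma estimate_invariant T z : 0 <= T -> clamped_sol T z -> estimate (z 0) -> estimate (z T).
Proof.
move=> T0 zs [R0 x0 V0]; have [<-//|T0'] := eqVneq 0 T.
have {T0'} T0' : 0 < T by rewrite lt_neqAle T0'.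
have HVbb' := HVbb; have HVb' := HVb.
have xle t : 0 <= t <= T -> VCC s (z t).2 <= Vbb.
  by move=> /andP[t0 tT]; apply: le_trans x0; exact: clamped_sol_VCC zs _ t0 tT.
(* Even from the surface [VCC = Vbb], where [Phi] is 0, the solution moves inside at once. This
   makes [Phi] positive at all later times, as [nagumo] requires. *)
have xlt t : 0 < t <= T -> VCC s (z t).2 < Vbb.
  move=> /andP[t0 tT]; have [xE|xN] := eqVneq (VCC s (z 0).2) Vbb; last first.
    apply: le_lt_trans (clamped_sol_VCC zs _ (ltW t0) tT) _ => //.
    by rewrite lt_neqAle xN.
  rewrite -xE; apply: (@VCC_decreasing R s Hs `[0, T] (fun r => (z r).2)) => //.
  - by move=> r; rewrite /= !in_itv /= => /andP[? ?]; apply/andP; split; lra.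
  - move=> r /andP[? ?]; have rT : 0 <= r <= T by apply/andP; split; lra.
    exact: has_deriv_snd (zs r rT).
  - rewrite xE; lra.
suff [RT VT] : Lam (Phi (VCC s (z T).2)) (z T).1.
  by split=> //; apply: xle; rewrite lexx ltW.
apply: (@nagumo R s Vb C VPLL p U CS M m0 Vbb bl ftE RegM T (fun t => (z t).1)
  (fun t => (z t).2) (fun t => Phi (VCC s (z t).2))) => //.
- by move=> t tT; have := has_deriv_fst (zs t tT); rewrite /= -surjective_pairing.
- move=> t t' t0 tt' t'T; apply: HPhi_noninc; first exact: VCC_ge0.
    exact: clamped_sol_VCC zs t0 tt' t'T.
  by apply: xle; rewrite t0 (le_trans tt').
- by move=> t tT; apply: Phi_bounds; rewrite (VCC_ge0 Hs) xle.
- move=> t tT; have wlt := xlt t tT.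
  have [wV|wV] := leP Vb (VCC s (z t).2); first by apply: HPhi_pos; rewrite wV.
  by rewrite HPhi_const// (VCC_ge0 Hs) ltW.
move=> t tau eps tT eps0; apply: (Phi_rate tau zs tT _ eps0).
  by apply: xlt; case/andP: tT => -> /ltW.
have wlt : VCC s (z t).2 < Vbb by apply: xlt; case/andP: tT => -> /ltW.
have [wV|wV] := leP Vb (VCC s (z t).2); first by apply: HPhi_pos; rewrite wV.
by rewrite HPhi_const// (VCC_ge0 Hs) ltW.
Qed.

End Estimation.

(** * Convergence *)

(** Compactness of the segment: a radius valid near each point can be made uniform because [Q]
    survives shrinking it. *)
Lemma segment_uniform (R : realType) (a b : R) (Q : R -> R -> Prop) :
  (forall r r' t, r' <= r -> Q r t -> Q r' t) ->
  (forall t, a <= t <= b -> exists2 d, 0 < d & forall t', `|t' - t| < d -> Q d t') ->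
  exists2 r, 0 < r & forall t, a <= t <= b -> Q r t.
Proof.
move=> mono loc.
have nc := (compact_near_coveringP _).1 (@segment_compact R a b).
have : \forall r \near (0 : R)^'+, `[a, b] `<=` Q r.
  apply: nc => t; rewrite /= in_itv /= => /loc[d d0 Hd].
  exists ([set t' | `|t' - t| < d], [set r : R | r < d]).
    split=> /=; last exact: nbhs_right_lt.
    by apply/nbhs_normP; exists d => // t' /=; rewrite distrC.
  by move=> [t' r] [/= t't rd]; apply: (mono d); [exact: ltW|exact: Hd].
move=> [d /= d0 Hd]; exists (d / 2); first by rewrite divr_gt0.
move=> t tab; apply: (Hd (d / 2)).
- by rewrite /= distrC subr0 gtr0_norm; lra.
- by rewrite divr_gt0.
- by rewrite /= in_itv.
Qed.

Section Convergence.
Context {R : realType} {s : pll_cc R} {Vb : R} {C : R -> set (R * R)}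
  {VPLL : R * R -> R} {p : R * R -> R * R} {U : R}.
Hypothesis CS : cycle_setting s Vb C VPLL p U.

Notation Reg := (region (C Vb)).
Let Hs := cs_assumptions CS.
Let HVb := cs_Vb CS.

Context (M m0 Vbb : R).
Hypothesis bl : blip (ft s M m0).
Hypothesis ftE : forall (q : R * R) x, `|q| <= M -> VCC s x <= Vbb -> ft s M m0 (q, x) = f s q x.
Hypothesis RegM : forall q, Reg q -> `|q| <= M.
Hypothesis HVbb : Vb < Vbb.

(* The rate of [VPLL] vanishes only where [omega = 0]; there, the rate of
   [omega * f (q, 0)] is [- ki * f (q, 0) ^+ 2 < 0]. *)
Lemma rates_negative L K : 0 < L <= Vb -> exists2 r, 0 < r &
  forall V tau x, 0 < V <= Vb -> `|V - L| < r -> `|x| < r ->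
    alpha s p (V, tau) (ft s M m0 (p (V, tau), x)) < - r \/
    - ki s * (ft s M m0 (p (V, tau), x) * ft s M m0 (p (V, tau), 0)) +
      K * `|(p (V, tau)).2| < - r.
Proof.
move=> L0; have L0' : 0 <= L <= Vb by case/andP: L0 => /ltW -> ->.
pose AA (w : R * R * 'cV[R]_4) := alpha s p w.1 (ft s M m0 (p w.1, w.2)).
pose BB (w : R * R * 'cV[R]_4) := - ki s * (ft s M m0 (p w.1, w.2) * ft s M m0 (p w.1, 0)) +
      K * `|(p w.1).2|.
pose Q r tau := forall V x, 0 < V <= Vb -> `|V - L| < r -> `|x| < r ->
  AA (V, tau, x) < - r \/ BB (V, tau, x) < - r.
have [||r r0 Hr] := @segment_uniform R 0 1 Q.
- move=> r r' t r'r Hr V x V0 VL xr.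
  have [H|H] := Hr V x V0 (lt_le_trans VL r'r) (lt_le_trans xr r'r); [left|right];
    by apply: (lt_le_trans H); rewrite lerN2.
- move=> t _; set w0 := ((L, t), 0 : 'cV[R]_4).
  have ftc : continuous (ft s M m0 : _ -> R^o) := blip_continuous bl.
  have c1 : w.1 @[w --> w0] --> (L, t) by exact: cvg_fst.
  have c2 : w.2 @[w --> w0] --> (0 : 'cV[R]_4) by exact: cvg_snd.
  have cp : p w.1 @[w --> w0] --> p (L, t).
    exact: (cvg_comp _ _ c1 (p_continuous CS (y := (L, t)) L0)).
  have c3 : (p w.1, w.2) @[w --> w0] --> (p (L, t), 0 : 'cV[R]_4) by exact: (cvg_pair cp c2).
  have c4 : ft s M m0 (p w.1, w.2) @[w --> w0] --> ft s M m0 (p (L, t), 0).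
    exact: (cvg_comp _ _ c3 (ftc (p (L, t), 0))).
  have RL : Reg (p (L, t)) by apply: (region_p CS).
  have ftL : ft s M m0 (p (L, t), 0) = f s (p (L, t)) 0.
    apply: ftE; first exact: RegM.
    by rewrite VCC0; have := HVb; have := HVbb; lra.
  have near_ (u : R * R * 'cV[R]_4 -> R) : {for w0, continuous (u : _ -> R^o)} -> u w0 < 0 ->
      exists2 d, 0 < d & forall V t' x, `|V - L| < d -> `|t' - t| < d -> `|x| < d -> u (V, t', x) < - d.
    move=> uc u0; have e0 : 0 < - u w0 / 2 by lra.
    have [d d0 Hd] := (@cont_epsP _ _ R^o u w0).1 uc _ e0.
    exists (Num.min d (- u w0 / 2)); first by rewrite lt_min d0 e0.
    move=> V t' x; rewrite !lt_min => /andP[V1 V2] /andP[t1 t2] /andP[x1 x2].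
    have := Hd (V, t', x); rewrite ltr_norml => /(_ _)Y.
    have {}Y := Y ltac:(by apply/pair_norm_ltP; rewrite /= subr0; split=> //; apply/pair_norm_ltP).
    case/andP: Y => _ Y.
    have : Num.min d (- u w0 / 2) <= - u w0 / 2 by rewrite ge_min lexx orbT.
    lra.
  have [w|w] := eqVneq (p (L, t)).2 0.
    have [||d d0 Hd] := near_ BB.
    + apply: cvgD.
        apply: cvgM; first exact: cvg_cst.
        apply: cvgM; first exact: c4.
        have c5 : (p w.1, 0 : 'cV[R]_4) @[w --> w0] --> (p (L, t), 0 : 'cV[R]_4).
          have c51 : (fun _ : R * R * 'cV[R]_4 => 0 : 'cV[R]_4) w @[w --> w0] --> (0 : 'cV[R]_4).
            exact: cvg_cst.
          exact: (cvg_pair cp c51).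
        exact: (cvg_comp _ _ c5 (ftc (p (L, t), 0))).
      apply: cvgM; first exact: cvg_cst.
      have c6 : (p w.1).2 @[w --> w0] --> (p (L, t)).2 by exact: cvg_comp cp cvg_snd.
      exact: (cvg_norm c6).
    + rewrite /BB /= w normr0 mulr0 addr0 mulNr oppr_lt0 mulr_gt0 ?(ki_gt0 Hs)//.
      rewrite -expr2 exprn_even_gt0//= ftL.
      exact: (f0_neq0 CS L0 w).
    + exists d => // t' t't V x V0 VL xd; right; exact: Hd.
  have [||d d0 Hd] := near_ AA.
  + have c5 : (w.1, ft s M m0 (p w.1, w.2)) @[w --> w0] --> ((L, t), ft s M m0 (p (L, t), 0)).
      exact: (cvg_pair c1 c4).
    exact: (cvg_comp _ _ c5 (alpha_continuous CS (y := (L, t)) (c := ft s M m0 (p (L, t), 0)) L0)).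
  + by rewrite /AA /= ftL; apply: (alpha_lt0 CS).
  + exists d => // t' t't V x V0 VL xd; left; exact: Hd.
exists r => // V tau x V0 VL xr.
have [n /andP[n1 n2] _] := p_frac CS V tau 0.
have := Hr (tau + n%:~R) _ V x V0 VL xr.
rewrite /AA /BB /= (alpha_period CS) (p_period_int CS); apply.
by apply/andP; split; lra.
Qed.

End Convergence.

Lemma has_deriv_translate (R : realType) (W : normedModType R) (J : set R) (u : R -> W) a t d :
  has_deriv J u (a + t) d -> has_deriv [set r | J (a + r)] (fun r => u (a + r)) t d.
Proof.
move=> ud e e0; have [del del0 H] := ud e e0; exists del => // r Jr rt.
have E : a + r - (a + t) = r - t by ring.
by have := H (a + r) Jr; rewrite E => /(_ rt).
Qed.

Lemma VPLL_no_limit (R : realType) (s : pll_cc R) (Vb : R) (C : R -> set (R * R))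
    (VPLL : R * R -> R) (p : R * R -> R * R) (U M m0 Vbb : R)
    (z : R -> R * R * 'cV[R]_4)
    (CS : cycle_setting s Vb C VPLL p U)
    (bl : blip (ft s M m0))
    (ftE : forall (q : R * R) x, `|q| <= M -> VCC s x <= Vbb -> ft s M m0 (q, x) = f s q x)
    (RegM : forall q, region (C Vb) q -> `|q| <= M)
    (HVbb : Vb < Vbb)
    (zd : forall t, 0 <= t -> has_deriv [set t | 0 <= t] z t (clamped_rhs s M m0 (z t)))
    (zR : forall t, 0 <= t -> region (C Vb) (z t).1 /\ VCC s (z t).2 <= Vbb)
    (VCC_to0 : forall rho, 0 < rho ->
      exists2 t0, 0 <= t0 & forall t, t0 <= t -> VCC s (z t).2 < rho) L :
  0 < L <= Vb ->
  ~ (forall eta, 0 < eta -> exists2 t0, 0 <= t0 & forall t, t0 <= t -> `|VPLL (z t).1 - L| < eta).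
Proof.
have Hs := cs_assumptions CS; have HVb := cs_Vb CS.
move=> L0 lim; have [Kf Kf0 [f1 f2]] := bl.
have nkp := normr_ge0 (kp s); have nki := normr_ge0 (ki s); have ki0 := ki_gt0 Hs.
have M0 : 0 <= M.
  have V0 : (0 : R) <= 0 <= Vb by rewrite lexx (ltW HVb).
  exact: le_trans (normr_ge0 _) (RegM _ (region_p CS 0 V0)).
pose Sp := (`|kp s| + `|ki s|) * Kf + M.
have Sp0 : 0 <= Sp by rewrite addr_ge0// mulr_ge0// addr_ge0.
have speed t : 0 <= t -> `|(clamped_rhs s M m0 (z t)).1| <= Sp.
  move=> t0; have [Rt _] := zR _ t0; have /pair_norm_leP[q1 q2] := RegM _ Rt.
  have ft1 := f1 (z t).
  have E1 : `|kp s| * `|ft s M m0 (z t)| <= `|kp s| * Kf by rewrite ler_wpM2l.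
  have E2 : `|ki s| * `|ft s M m0 (z t)| <= `|ki s| * Kf by rewrite ler_wpM2l.
  have E3 : 0 <= `|kp s| * Kf by rewrite mulr_ge0.
  have E4 : 0 <= `|ki s| * Kf by rewrite mulr_ge0.
  apply/pair_norm_leP; split; rewrite /= /Sp.
    apply: (le_trans (ler_normD _ _)); rewrite normrM normrN; lra.
  rewrite normrM normrN; lra.
(* [Sp] bounds the speed of [q], and [Sp + 1] its difference quotients over short times, so [f0]
   along the solution changes at a rate of at most [K]. *)
pose K := Kf * (Sp + 1).
have K0 : 0 <= K by rewrite mulr_ge0//; lra.
have [r r0 Hr] := rates_negative CS bl ftE RegM HVbb K L0.
pose f0 (q : R * R) := ft s M m0 (q, 0 : 'cV[R]_4).
have f0K (q q' : R * R) : `|f0 q - f0 q'| <= Kf * `|q - q'|.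
  apply: (le_trans (f2 _ _)); rewrite ler_wpM2l//.
  by apply/pair_norm_leP; rewrite /= subrr normr0.
pose B t := (z t).1.2 * f0 (z t).1.
(* An upper bound for the right growth rate of [B]: the exact contribution of [omega], and
   [K * |omega|] for that of [f0]. *)
pose c t := - ki s * (ft s M m0 (z t) * f0 (z t).1) + K * `|(z t).1.2|.
pose C0 := ki s * (Kf * Kf) + K * M + 1.
have C00 : 0 < C0.
  have KM : 0 <= K * M by rewrite mulr_ge0.
  have kK : 0 <= ki s * (Kf * Kf) by rewrite mulr_ge0 ?(ltW ki0)// mulr_ge0.
  by rewrite /C0; lra.
have cC0 t : 0 <= t -> c t <= C0.
  move=> t0; have [Rt _] := zR _ t0; have /pair_norm_leP[_ q2] := RegM _ Rt.
  have X : `|ft s M m0 (z t) * f0 (z t).1| <= Kf * Kf by rewrite normrM ler_pM// f1.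
  have Y : K * `|(z t).1.2| <= K * M by rewrite ler_wpM2l.
  have := ler_norm (- (ft s M m0 (z t) * f0 (z t).1)); rewrite normrN => Z.
  have W : ki s * - (ft s M m0 (z t) * f0 (z t).1) <= ki s * (Kf * Kf).
    by rewrite ler_pM2l//; lra.
  rewrite /c /C0; lra.
(* So small that [k * c t <= r / 2], which the alternative [alpha < - r] outweighs; under the other
   alternative [alpha <= 0] and [k * c t < - (k * r)]. The rate [eta] is the lesser of the two
   gains. *)
pose k := r / (2 * C0).
have k0 : 0 < k by rewrite divr_gt0// mulr_gt0.
have kC0 : k * C0 = r / 2 by rewrite /k; field; rewrite gt_eqF.
pose eta := Num.min (r / 2) (k * r).
have eta0 : 0 < eta by rewrite lt_min divr_gt0// mulr_gt0.
have [eta1 eta2] : eta <= r / 2 /\ eta <= k * r by rewrite /eta !ge_min !lexx orbT.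
have L1 : 0 < L by case/andP: L0.
have rL : 0 < Num.min r (L / 2) by rewrite lt_min r0; lra.
have [t1 t10 H1] := lim _ rL.
have [cc cc0 Hcc] := VCC_coercive Hs.
(* Below [L / 2] the value of [VCC] is less than the level, so that [alpha <= 0]; below
   [cc * r ^+ 2] coercivity gives [|x| < r]. *)
have w0 : 0 < Num.min (L / 2) (cc * r ^+ 2) by rewrite lt_min; apply/andP; split; [lra|rewrite mulr_gt0// exprn_gt0].
have [t2 t20 H2] := VCC_to0 _ w0.
pose t0 := Num.max t1 t2.
have t00 : 0 <= t0 by rewrite le_max t10.
have late t : t0 <= t -> exists V tau, [/\ (z t).1 = p (V, tau), VPLL (z t).1 = V, 0 < V <= Vb,
    alpha s p (V, tau) (ft s M m0 (z t)) <= 0 &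
    alpha s p (V, tau) (ft s M m0 (z t)) + k * c t <= - eta].
  rewrite ge_max => /andP[/H1 v1 /[dup] t2t /H2 w2].
  have tpos : 0 <= t by exact: le_trans t20 t2t.
  have [Rt xt] := zR _ tpos; have [V [tau [V0 E]]] := region_ex CS Rt.
  have VE : VPLL (z t).1 = V by rewrite E (VPLL_p CS).
  move: v1 w2; rewrite VE !lt_min => /andP[v1 v2] /andP[w1 w2].
  have V1 : L / 2 < V by move: v2; rewrite ltr_norml => /andP[v2 _]; clear - v2; lra.
  have V0' : 0 < V <= Vb by case/andP: V0 => _ ->; rewrite andbT; clear - V1 L1; lra.
  have ftz : ft s M m0 (z t) = f s (p (V, tau)) (z t).2.
    by rewrite -E -ftE ?RegM// -surjective_pairing.
  have al0 : alpha s p (V, tau) (ft s M m0 (z t)) <= 0.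
    by rewrite ftz; apply: (alpha_le0 CS) => //; clear - w1 V1; lra.
  exists V, tau; split=> //.
  have xr : `|(z t).2| < r.
    have := le_lt_trans (Hcc _) w2; rewrite ltr_pM2l// => X.
    by rewrite -(ltr_pXn2r (ltn0Sn 1)) ?nnegrE// ltW.
  have := Hr V tau (z t).2 V0' v1 xr; rewrite -E -surjective_pairing -/(f0 _) -/(c t).
  case=> H.
    have kc : k * c t <= r / 2 by rewrite -kC0 ler_pM2l// cC0.
    clear - H kc eta1; lra.
  have kc : k * c t < k * - r by rewrite ltr_pM2l.
  clear - kc al0 eta2; lra.
(* [f0] is known to be Lipschitz only, so the sum is not differentiated; its one-sided growth is
   estimated instead. *)
have decr T : t0 <= T -> VPLL (z T).1 + k * B T + eta * T <= VPLL (z t0).1 + k * B t0 + eta * t0.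
  move=> t0T; apply: (@right_dini_le0 R (fun t => VPLL (z t).1 + k * B t + eta * t)) => //.
  - move=> t e /andP[t0t tT] e0.
    have tpos : 0 <= t by clear - t0t t00; lra.
    have [Rt _] := zR _ tpos.
    have e30 : 0 < e / 3 by rewrite divr_gt0.
    have kb0 : 0 <= k * (Kf * (1 + M)) by rewrite mulr_ge0 ?(ltW k0)// mulr_ge0// addr_ge0.
    have kb1 : 0 < 3 * (k * (Kf * (1 + M)) + 1) by rewrite mulr_gt0// ltr_wpDl.
    have e40 : 0 < e / (3 * (k * (Kf * (1 + M)) + 1)) by rewrite divr_gt0.
    have [r1 r10 Hr1] := VPLL_cont CS Rt e30.
    have m1 : 0 < Num.min r1 (e / (3 * (k * (Kf * (1 + M)) + 1))) by rewrite lt_min r10.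
    have [d d0 Hd] := has_deriv_cont (has_deriv_fst (zd _ tpos)) m1.
    exists (Num.min d (e / (3 * eta))); first by rewrite lt_min d0 divr_gt0// mulr_gt0.
    move=> t' /andP[t0t' t't]; rewrite ltrBlDl -ltrBlDr lt_min => /andP[h1 h2].
    have t'pos : 0 <= t' by clear - t00 t0t'; lra.
    have [Rt' _] := zR _ t'pos.
    have := Hd t' t'pos; rewrite ltr0_norm ?subr_lt0// opprB => /(_ h1).
    rewrite lt_min => /andP[q1 q2].
    have := Hr1 _ Rt' q1; rewrite ltr_norml => /andP[v1 _].
    have h3 : eta * (t - t') <= e / 3.
      by move: h2; rewrite ltr_pdivlMr ?mulr_gt0// => h2; clear - h2; lra.
    have Bd : `|B t - B t'| <= Kf * (1 + M) * `|(z t').1 - (z t).1|.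
      have -> : B t - B t' = ((z t).1.2 - (z t').1.2) * f0 (z t).1 +
          (z t').1.2 * (f0 (z t).1 - f0 (z t').1) by rewrite /B; ring.
      have /pair_norm_leP[_ w1] : `|(z t).1 - (z t').1| <= `|(z t).1 - (z t').1| by [].
      have /pair_norm_leP[_ w2] := RegM _ Rt'.
      apply: (le_trans (ler_normD _ _)); rewrite (normrM (_ - _)) (normrM (z t').1.2).
      rewrite [`|(z t').1 - _|]distrC.
      have X1 : `|(z t).1.2 - (z t').1.2| * `|f0 (z t).1| <= `|(z t).1 - (z t').1| * Kf.
        by apply: ler_pM => //; exact: f1.
      have X2 : `|(z t').1.2| * `|f0 (z t).1 - f0 (z t').1| <= M * (Kf * `|(z t).1 - (z t').1|).
        by apply: ler_pM => //; exact: f0K.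
      apply: (le_trans (lerD X1 X2)).
      move: (`|(z t).1 - (z t').1|) => x; rewrite le_eqVlt; apply/orP; left; apply/eqP; ring.
    have kB : k * (B t - B t') <= e / 3.
      apply: (@le_trans _ _ (k * (Kf * (1 + M)) * `|(z t').1 - (z t).1|)).
        rewrite -mulrA ler_pM2l//; apply: le_trans Bd; exact: ler_norm.
      move: q2; rewrite ltr_pdivlMr// => q2.
      by have n := normr_ge0 ((z t').1 - (z t).1); clear - q2 n; lra.
    clear - v1 h3 kB; lra.
  - move=> t e /andP[t0t tT] e0.
    have tpos : 0 <= t by exact: le_trans t0t.
    have [V [tau [E VE V0 al0 psi]]] := late t t0t.
    have qd := has_deriv_fst (zd _ tpos).
    have qdE : has_deriv [set t | 0 <= t] (fun t => (z t).1) t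
        (pll_rhs s (ft s M m0 (z t)) (p (V, tau))) by rewrite -E.
    have e30 : 0 < e / 3 by rewrite divr_gt0.
    have [d1 d10 D1] := VPLL_rate CS V0 E qdE e30.
    have kK1 : 0 < k * Kf + 1 by rewrite ltr_wpDl// mulr_ge0// ltW.
    have kK2 : 0 < k * K + 1 by rewrite ltr_wpDl// mulr_ge0// ltW.
    pose e1 := e / (3 * (k * Kf + 1)); pose e3 := e / (3 * (k * K + 1)).
    have e10 : 0 < e1 by rewrite divr_gt0// mulr_gt0.
    have e3p : 0 < e3 by rewrite divr_gt0// mulr_gt0.
    have [d2 d20 D2] := qd _ e10.
    have [d3 d30 D3] := has_deriv_cont qd e3p.
    have [d4 d40 D4] := qd _ ltr01.
    exists (Num.min (Num.min d1 d2) (Num.min d3 d4)); first by rewrite !lt_min d10 d20 d30.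
    move=> h /andP[h0]; rewrite !lt_min => /andP[/andP[h1 h2] /andP[h3 h4]].
    have thpos : 0 <= t + h by rewrite addr_ge0// ltW.
    have Eh : t + h - t = h by ring.
    have nh : `|h| = h by rewrite gtr0_norm.
    have [Rh _] := zR _ thpos; have [Rt _] := zR _ tpos.
    have VVb : V <= Vb by case/andP: V0.
    have := D1 _ thpos; rewrite Eh nh => /(_ h1 _ Rh) X1.
    have {}X1 := X1 ltac:(clear - VVb al0 h0; nra).
    have := D2 _ thpos; rewrite Eh nh => /(_ h2) X2.
    have := D3 _ thpos; rewrite Eh nh => /(_ h3) X3.
    have := D4 _ thpos; rewrite Eh nh mul1r => /(_ h4) X4.
    have {X2} [_] := (pair_norm_leP _ _).1 X2.
    rewrite /= /GRing.scale /= => X2.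
    have {X3} [_] := (pair_norm_ltP _ _).1 X3; rewrite /= => X3.
    have dq : `|(z (t + h)).1 - (z t).1| <= (Sp + 1) * h.
      set X := (clamped_rhs _ _ _ _).1 in X4.
      rewrite -(subrK (h *: X) ((z (t + h)).1 - (z t).1)).
      apply: (le_trans (ler_normD _ _)); rewrite normrZ nh.
      have : h * `|X| <= h * Sp by rewrite ler_pM2l// speed.
      by move=> X5; clear - X4 X5; lra.
    have df : `|f0 (z (t + h)).1 - f0 (z t).1| <= K * h.
      apply: (le_trans (f0K _ _)); rewrite /K -mulrA ler_wpM2l//.
    set df' := f0 (z (t + h)).1 - f0 (z t).1 in df.
    have BE : B (t + h) - B t = ((z (t + h)).1.2 - (z t).1.2) * f0 (z t).1 +
      (z (t + h)).1.2 * df' by rewrite /B /df'; ring.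
    have ff := f1 ((z t).1, 0); rewrite -/(f0 (z t).1) in ff.
    have B1 : ((z (t + h)).1.2 - (z t).1.2) * f0 (z t).1 <=
        h * (- ki s * (ft s M m0 (z t) * f0 (z t).1)) + e1 * h * Kf.
      set dw := (z (t + h)).1.2 - (z t).1.2 in X2 *.
      have Y : `|(dw - h * (- ki s * ft s M m0 (z t))) * f0 (z t).1| <= e1 * h * Kf.
        by rewrite normrM; apply: ler_pM.
      by have {}Y := le_trans (ler_norm _) Y; clear - Y; lra.
    have B2 : (z (t + h)).1.2 * df' <= (`|(z t).1.2| + e3) * (K * h).
      apply: (le_trans (ler_norm _)); rewrite normrM; apply: ler_pM => //.
      by have X5 := lerB_dist (z (t + h)).1.2 (z t).1.2; clear - X3 X5; lra.
    have B3 : B (t + h) <= B t + h * c t + e1 * h * Kf + e3 * (K * h).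
      by rewrite /c; clear - B1 B2 BE; lra.
    have eh : 0 <= e / 3 * h by apply: mulr_ge0; exact: ltW.
    have B4 : k * (e1 * h * Kf) <= e / 3 * h.
      have -> : k * (e1 * h * Kf) = e / 3 * h * (k * Kf / (k * Kf + 1)).
        by rewrite /e1; field; rewrite gt_eqF.
      by rewrite ler_piMr// ler_pdivrMr// mul1r lerDl.
    have B5 : k * (e3 * (K * h)) <= e / 3 * h.
      have -> : k * (e3 * (K * h)) = e / 3 * h * (k * K / (k * K + 1)).
        by rewrite /e3; field; rewrite gt_eqF.
      by rewrite ler_piMr// ler_pdivrMr// mul1r lerDl.
    have B6 : k * B (t + h) <= k * (B t + h * c t + e1 * h * Kf + e3 * (K * h)).
      by rewrite ler_pM2l.
    have B7 : (alpha s p (V, tau) (ft s M m0 (z t)) + k * c t) * h <= - eta * h.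
      by rewrite ler_pM2r.
    move: X1; rewrite ler_norml VE => /andP[_ X1].
    clear - X1 B4 B5 B6 B7; lra.
have BM t : 0 <= t -> - (M * Kf) <= B t.
  move=> tpos; have [Rt _] := zR _ tpos; have /pair_norm_leP[_ q2] := RegM _ Rt.
  have : `|B t| <= M * Kf by rewrite normrM; apply: ler_pM => //; exact: f1.
  by rewrite ler_norml => /andP[].
set phi0 := VPLL (z t0).1 + k * B t0 + eta * t0 in decr.
(* After a further time [D / eta] the sum would be so low that, with [k * B >= - (k * (M * Kf))],
   the level would be negative. *)
pose D := `|phi0| + k * (M * Kf) + 1.
have D0 : 0 < D by rewrite ltr_wpDl// addr_ge0// mulr_ge0 ?(ltW k0)// mulr_ge0.
have t0T : t0 <= t0 + D / eta by rewrite lerDl divr_ge0// ltW.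
have Tpos : 0 <= t0 + D / eta by exact: le_trans t0T.
have [V [tau [_ VE /andP[V0 _] _ _]]] := late _ t0T.
have := decr _ t0T; have kB : k * - (M * Kf) <= k * B (t0 + D / eta) by rewrite ler_pM2l// BM.
have -> : eta * (t0 + D / eta) = eta * t0 + D by field; rewrite gt_eqF.
have := ler_norm phi0; have := mulr_ge0 (ltW eta0) t00; rewrite VE /D; clear - V0 kB; lra.
Qed.

Section Attraction.
Context {R : realType} {s : pll_cc R} {Vb : R} {C : R -> set (R * R)}
  {VPLL : R * R -> R} {p : R * R -> R * R} {U : R}.
Hypothesis CS : cycle_setting s Vb C VPLL p U.

Notation Reg := (region (C Vb)).
Let Hs := cs_assumptions CS.
Let HVb := cs_Vb CS.

Context (M m0 Vbb : R).
Hypothesis bl : blip (ft s M m0).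
Hypothesis ftE : forall (q : R * R) x, `|q| <= M -> VCC s x <= Vbb -> ft s M m0 (q, x) = f s q x.
Hypothesis RegM : forall q, Reg q -> `|q| <= M.
Hypothesis HVbb : Vb < Vbb.

Context (z : R -> R * R * 'cV[R]_4).
Hypothesis zd : forall t, 0 <= t -> has_deriv [set t | 0 <= t] z t (clamped_rhs s M m0 (z t)).
Hypothesis zR : forall t, 0 <= t -> Reg (z t).1 /\ VCC s (z t).2 <= Vbb.

Lemma shifted_sol t0 T : 0 <= t0 -> clamped_sol (s := s) M m0 T (fun r => z (t0 + r)).
Proof.
move=> t00 t /andP[t1 t2]; have t0t : 0 <= t0 + t by rewrite addr_ge0.
apply: has_deriv_sub (has_deriv_translate (zd t0t)).
by move=> r; rewrite /= in_itv /= => /andP[? ?]; rewrite addr_ge0.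
Qed.

Lemma VCC_mono t0 t : 0 <= t0 -> t0 <= t -> VCC s (z t).2 <= VCC s (z t0).2.
Proof.
move=> t00 t0t; have tt : 0 <= t - t0 by rewrite subr_ge0.
have := clamped_sol_VCC CS (shifted_sol (T := t - t0) t00) (lexx 0) tt (lexx _).
by rewrite addr0 addrC subrK.
Qed.

Lemma VCC_to0 rho : 0 < rho -> exists2 t0, 0 <= t0 & forall t, t0 <= t -> VCC s (z t).2 < rho.
Proof.
move=> rho0; have g0 := gamma_gt0 Hs; have w0 := VCC_ge0 Hs (z 0).2.
pose T := VCC s (z 0).2 / (gamma s * rho) + 1.
have gr : 0 < gamma s * rho by rewrite mulr_gt0.
have T0 : 0 <= T by rewrite addr_ge0// divr_ge0// ltW.
exists T => // t Tt; apply: (le_lt_trans (VCC_mono T0 Tt)).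
rewrite ltNge; apply/negP => H.
have := @VCC_rate R s Hs [set t | 0 <= t] (fun r => (z r).2) 0 T rho T0.
move=> /(_ _ _ _) X; have {}X : VCC s (z T).2 <= VCC s (z 0).2 - gamma s * rho * (T - 0).
  apply: X => [r|r /andP[r0 _]|r /andP[r0 rT]].
  - by rewrite /= in_itv /= => /andP[].
  - exact: has_deriv_snd (zd r0).
  - by apply: (le_trans H); exact: VCC_mono.
have E : gamma s * rho * (T - 0) = VCC s (z 0).2 + gamma s * rho.
  by rewrite subr0 /T; field; rewrite !gt_eqF.
by have := VCC_ge0 Hs (z T).2; lra.
Qed.

Lemma VPLL_forward t0 t V : 0 <= t0 -> t0 <= t -> 0 < V <= Vb ->
  VCC s (z t0).2 <= V -> VPLL (z t0).1 <= V -> VPLL (z t).1 <= V.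
Proof.
move=> t00 t0t V0 xV vV; have tt : 0 <= t - t0 by rewrite subr_ge0.
have := Lam_invariant CS bl ftE RegM HVbb tt (shifted_sol (T := t - t0) t00) V0.
rewrite addr0 => /(_ xV) H; have [] := H _.
  by split=> //; have [] := zR t00.
by rewrite [t0 + _]addrC subrK.
Qed.

Lemma VPLL_to0 eps : 0 < eps -> exists2 t0, 0 <= t0 & forall t, t0 <= t -> VPLL (z t).1 <= eps.
Proof.
move=> eps0; have HVb' := HVb.
(* The levels that are eventually not exceeded; their infimum is the candidate for the limit. *)
pose S := [set V : R | 0 < V <= Vb /\ exists2 t0, 0 <= t0 & forall t, t0 <= t -> VPLL (z t).1 <= V].
have SVb : S Vb.
  split; first by rewrite HVb lexx.
  exists 0 => // t t0; have [Rt _] := zR t0; have [V [tau [V0 E]]] := region_ex CS Rt.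
  by rewrite E (VPLL_p CS)//; case/andP: V0.
have S0 : has_inf S by split; [exists Vb|exists 0 => V [/andP[/ltW]]].
set L := inf S.
have LVb : L <= Vb by apply: (ge_inf S0.2).
have L0 : 0 <= L by apply: lb_le_inf; [exists Vb|move=> V [/andP[/ltW]]].
have adh e : 0 < e -> exists2 t0, 0 <= t0 & forall t, t0 <= t -> VPLL (z t).1 <= L + e.
  move=> e0; have [V [_ [t0 t00 Ht0]] VL] := inf_adherent e0 S0.
  by exists t0 => // t /Ht0 H; apply: (le_trans H); exact: ltW.
have [LE|LN] := eqVneq L 0.
  by have [t0 t00 H] := adh eps eps0; exists t0 => // t /H; rewrite LE add0r.
have Lpos : 0 < L by rewrite lt_neqAle eq_sym LN.
exfalso; apply: (VPLL_no_limit CS bl ftE RegM HVbb zd zR VCC_to0 (L := L)); first by rewrite Lpos.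
move=> eta eta0.
have eta20 : 0 < eta / 2 by lra.
have [t1 t10 H1] := adh _ eta20.
(* The term [L / 2] keeps [V] positive. If [VPLL] fell to [L - eta] once [VCC <= V], it would stay
   below [V] forever, and [V < L] would belong to [S]. *)
pose V := Num.max (L - eta / 2) (L / 2).
have V1 : 0 < V by rewrite lt_max; apply/orP; right; lra.
have VL : V < L by rewrite gt_max; apply/andP; split; lra.
have V0 : 0 < V <= Vb by rewrite V1; apply: le_trans LVb; exact: ltW.
have [t2 t20 H2] := VCC_to0 V1.
exists (Num.max t1 t2); first by rewrite le_max t10.
move=> t; rewrite ge_max => /andP[t1t t2t]; have tpos : 0 <= t by exact: le_trans t1t.
rewrite ltr_norml; apply/andP; split; last by have := H1 t t1t; lra.
rewrite ltNge; apply/negP => H.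
have : L <= V.
  apply: (ge_inf S0.2); split=> //; exists t => // t' tt'.
  apply: (VPLL_forward tpos tt' V0); first exact/ltW/H2.
  have : L - eta / 2 <= V by rewrite le_max lexx.
  lra.
by rewrite leNgt VL.
Qed.

(** The cycles shrink to the origin: [p] is continuous at [V = 0], where it is constantly 0,
    uniformly over a period of angles. *)
Lemma small_cycles e : 0 < e -> exists2 r, 0 < r & forall q, Reg q -> VPLL q <= r -> `|q| < e.
Proof.
move=> e0.
have [||r r0 Hr] := @segment_uniform R 0 1
    (fun r t => forall V, 0 <= V <= Vb -> V < r -> `|p (V, t)| < e).
- by move=> r r' t rr H V V0 Vr; apply: H => //; exact: lt_le_trans rr.
- move=> t _; pose D := [set q : R * R | 0 <= q.1 <= Vb].
  have D0 : D (0, t) by rewrite /D /= lexx (ltW HVb).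
  have near_ : within D (nbhs (0, t)) [set y | `|p (0, t) - p y| < e].
    have cpc : {within D, continuous p} := cp_cont (cs_param CS).
    have /cvgrPdist_lt /(_ e e0) := cpc (0, t).
    by rewrite nbhs_subspace_in.
  have /nbhs_normP[d /= d0 Hd] := near_; exists d => // t' t't V V0 Vd.
  have := Hd (V, t'); rewrite (p_0 CS) sub0r normrN; apply=> //.
  apply/pair_norm_ltP; rewrite /= sub0r normrN [`|t - t'|]distrC; split=> //.
  by rewrite ger0_norm//; case/andP: V0.
exists (r / 2); first by rewrite divr_gt0.
move=> q Rq; have [V [t [V0 ->]]] := region_ex CS Rq.
rewrite (VPLL_p CS)// => Vr; have [t' t'01 <-] := p_unit CS V t.
by apply: Hr => //; lra.
Qed.

Lemma sol_to0 : z t @[t --> +oo] --> (0 : R * R * 'cV[R]_4).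
Proof.
apply/cvgrPdist_lt => e e0.
have [cc cc0 Hcc] := VCC_coercive Hs.
have [r r0 Hr] := small_cycles e0.
have [t1 t10 H1] := VPLL_to0 r0.
have ce0 : 0 < cc * e ^+ 2 by rewrite mulr_gt0// exprn_gt0.
have [t2 t20 H2] := VCC_to0 ce0.
exists (Num.max t1 t2); split; first exact: num_real.
move=> t; rewrite gt_max => /andP[tt1 tt2]; rewrite sub0r normrN.
have tpos : 0 <= t by exact: le_trans t10 (ltW tt1).
apply/pair_norm_ltP; split.
  by apply: Hr; [case: (zR tpos)|apply: H1; exact: ltW].
have := le_lt_trans (Hcc _) (H2 t (ltW tt2)); rewrite ltr_pM2l// => X.
by rewrite -(ltr_pXn2r (ltn0Sn 1)) ?nnegrE// ltW.
Qed.

End Attraction.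

(** An arbitrary solution on a compact interval is bounded, so the clamping box can be taken large
    enough to contain it. *)
Lemma has_deriv_bounded (R : realType) (W : normedModType R) (T : R) (u du : R -> W) :
  (forall t, 0 <= t <= T -> has_deriv `[0, T] u t (du t)) ->
  exists K, forall t, 0 <= t <= T -> `|u t| <= K.
Proof.
move=> ud.
have [||r r0 Hr] := @segment_uniform R 0 T
  (fun r t => 0 < r -> 0 <= t <= T -> `|u t| * r <= 1).
- move=> r r' t rr H r'0 tT; have r0 : 0 < r by exact: lt_le_trans rr.
  by apply: le_trans (H r0 tT); rewrite ler_wpM2l.
- move=> t tT; have [d d0 Hd] := has_deriv_cont (ud t tT) ltr01.
  have u0 : 0 < `|u t| + 1 by rewrite ltr_wpDl.
  exists (Num.min d (`|u t| + 1)^-1); first by rewrite lt_min d0 invr_gt0.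
  move=> t'; rewrite lt_min => /andP[t1 t2] m0 t'T.
  have := Hd t'; rewrite /= in_itv => /(_ t'T t1) X.
  have Y : `|u t'| <= `|u t| + 1.
    by rewrite -(subrK (u t) (u t')) addrC; apply: (le_trans (ler_normD _ _)); lra.
  have Z : Num.min d (`|u t| + 1)^-1 <= (`|u t| + 1)^-1 by rewrite ge_min lexx orbT.
  apply: (@le_trans _ _ ((`|u t| + 1) * (`|u t| + 1)^-1)).
    by apply: ler_pM => //; exact: ltW.
  by rewrite divff// gt_eqF.
exists r^-1 => t tT; have := Hr t tT r0 tT.
by rewrite -ler_pdivlMr// div1r.
Qed.

(** * Choice of the clamping bounds, and the lock-in domain *)

Lemma curve_family_param (R : realType) (Vb : R) (C : R -> set (R * R)) :
  smooth_curve_family Vb C -> exists p U, cycle_param Vb C p U.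
Proof. by move=> [p [U [VU [Cp pper pinj pc [pC1 pdet]]]]]; exists p, U; split. Qed.

Section Setup.
Context {R : realType} {s : pll_cc R} {Vb : R} {C : R -> set (R * R)}
  {VPLL : R * R -> R} {p : R * R -> R * R} {U : R}.
Hypothesis CS : cycle_setting s Vb C VPLL p U.

Lemma region_bounded : exists K, forall q, region (C Vb) q -> `|q| <= K.
Proof.
pose B := [set y : R * R | 0 <= y.1 <= Vb /\ 0 <= y.2 <= 1].
have cB : compact (p @` B).
  apply: continuous_compact; last exact: box_compact.
  by apply: continuous_subspaceW (cp_cont (cs_param CS)) => y [].
have [K [_ HK]] := compact_bounded cB.
exists (K + 1) => q Rq; apply: HK; first by rewrite ltrDl.
have [V [t [V0 ->]]] := region_ex CS Rq.
by have [t' t'01 <-] := p_unit CS V t; exists (V, t').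
Qed.

Lemma clamp_parameters Vbb K : 0 <= Vbb -> nonsingular s Vbb -> exists M m0 : R,
  [/\ blip (ft s M m0),
      forall (q : R * R) x, `|q| <= M -> VCC s x <= Vbb -> ft s M m0 (q, x) = f s q x,
      forall q, region (C Vb) q -> `|q| <= M & K <= M].
Proof.
move=> V0 ns; have Hs := cs_assumptions CS.
have [m0 m00 Hm] := den_sign Hs V0 ns.
have [K1 HK1] := region_bounded; have [M1 M10 HM1] := VCC_bounded Hs Vbb.
pose M := Num.max (Num.max K K1) M1.
have [[MK MK1] MM1] : (K <= M /\ K1 <= M) /\ M1 <= M by rewrite /M !le_max !lexx !orbT.
have M0 : 0 <= M by apply: le_trans MM1; exact: ltW.
exists M, m0; split=> //.
- exact: (blip_ft Hs M0 m00).
- move=> q x qM xV; apply: (ft_id Hs Hm) => //.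
  by apply: le_trans MM1; exact/ltW/HM1.
- by move=> q /HK1 qK; exact: le_trans MK1.
Qed.
End Setup.

Theorem theorem10 (R : realType) (s : pll_cc R) (Vb Vbb : R)
  (C : R -> set (R * R)) (VPLL : R * R -> R) (F : R -> R -> R) (Phi : R -> R)
  (Hs : standing_assumptions s)
  (HVb : 0 < Vb)
  (HC : limit_cycle_family s Vb C)
  (HVPLL : is_VPLL Vb C VPLL)
  (Hbetween : forall q, region (C Vb) q -> - pi < q.1 < pi)
  (HVbb : Vb < Vbb)
  (Hnonsing : nonsingular s Vbb)
  (HF : forall (J : set R) (z : R -> R * R * 'cV[R]_4),
     is_interval J -> solution s J z ->
     (forall t, J t -> region (C Vb) (z t).1 /\ VCC s (z t).2 <= Vbb) ->
     forall t, J t ->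
       exists d : R, derive_within J (fun r => VPLL (z r).1) t d /\
         d <= F (VPLL (z t).1) (VCC s (z t).2))
  (HPhi_noninc : forall V1 V2, 0 <= V1 -> V1 <= V2 -> V2 <= Vbb ->
     Phi V2 <= Phi V1)
  (HPhi_const : forall V, 0 <= V <= Vb -> Phi V = Vb)
  (HPhi_ode : forall V, Vb <= V <= Vbb ->
     derive_within `[Vb, Vbb] Phi V (- (F (Phi V) V / (gamma s * V))))
  (HPhi_pos : forall V, Vb <= V < Vbb -> 0 < Phi V)
  (HPhi_end : Phi Vbb = 0) :
  lock_in_estimation s
    [set z | [/\ region (C Vb) z.1, VCC s z.2 <= Vbb &
                 VPLL z.1 <= Phi (VCC s z.2)]].
Proof.
have [p [U Hp]] := curve_family_param (cycle_smooth HC).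
have CS : cycle_setting s Vb C VPLL p U by split.
have Vbb0 : 0 <= Vbb by lra.
set S := (X in lock_in_estimation s X).
have inv M m0 (bl : blip (ft s M m0))
    (ftE : forall (q : R * R) x, `|q| <= M -> VCC s x <= Vbb -> ft s M m0 (q, x) = f s q x)
    (RegM : forall q, region (C Vb) q -> `|q| <= M) T z : 0 <= T ->
    @clamped_sol R s M m0 T z -> S (z 0) ->
    S (z T).
  exact: (estimate_invariant CS bl ftE RegM HVbb Hnonsing HF HPhi_noninc HPhi_const
    HPhi_ode HPhi_pos HPhi_end).
have fwd : forward_invariant s S.
  move=> T z sol Sz0 t tT; have [_ x0 _] := Sz0.
  have zd r : 0 <= r <= T -> has_deriv `[0, T] z r (rhs s (z r)).
    move=> rT; have J : `[0, T]%classic r by rewrite /= in_itv.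
    exact/derive_withinP/(sol r J).2.
  (* Here the box depends on the solution: it contains the whole trajectory, so [z] solves the
     clamped equation before anything is known about its staying in the region. The bound on [VCC]
     comes from the linear equation for [x] alone. *)
  have [K HK] := has_deriv_bounded zd.
  have [M [m0 [bl ftE RegM KM]]] := clamp_parameters CS K Vbb0 Hnonsing.
  apply: (inv M m0 bl ftE RegM) => //; first by case/andP: tT.
  move=> r /andP[r0 rt]; have rT : 0 <= r <= T by rewrite r0; case/andP: tT => _; exact: le_trans.
  have xr : VCC s (z r).2 <= Vbb.
    apply: le_trans x0.
    apply: (@VCC_nonincreasing R s Hs `[0, T] (fun r => (z r).2)) => //.
      move=> y; rewrite /= !in_itv /= => /andP[? yr]; apply/andP; split=> //.
      by case/andP: rT => _; exact: le_trans.
    move=> y /andP[y0 yr]; have yT : 0 <= y <= T.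
      by rewrite y0; case/andP: rT => _; exact: le_trans.
    exact: has_deriv_snd (zd y yT).
  have -> : clamped_rhs s M m0 (z r) = rhs s (z r).
    rewrite /clamped_rhs /rhs; congr (pll_rhs _ _ _, _).
    rewrite [z r]surjective_pairing ftE//.
    by apply: le_trans KM; apply: le_trans (HK r rT); rewrite prod_normE le_max lexx.
  apply: has_deriv_sub (zd r rT) => y; rewrite /= !in_itv /= => /andP[-> yt].
  by case/andP: tT => _; exact: le_trans.
split=> // z0 Sz0.
have [M [m0 [bl ftE RegM _]]] := clamp_parameters CS 0 Vbb0 Hnonsing.
split.
  (* The clamped solution exists for all time, and invariance keeps it where the clamped field is
     the given one. *)
  have [u [u0 ud]] := clamped_solution bl z0 (or_introl erefl).
  exists u => // t t0.
  have St : S (u t).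
    apply: (inv M m0 bl ftE RegM) => //; last by rewrite u0.
    move=> r /andP[r0 rt]; have := ud r r0; rewrite scale1r; apply: has_deriv_sub.
    by move=> y; rewrite /= in_itv /= => /andP[].
  have [Rt xt _] := St; split; first exact: Hnonsing.
  apply/derive_withinP; have := ud t t0.
  by rewrite scale1r (clamped_rhs_E ftE RegM).
move=> z sol zz0.
have St t : 0 <= t -> S (z t).
  move=> t0; apply: (fwd t z); rewrite ?zz0 ?lexx ?t0//.
  move=> r; rewrite /= in_itv /= => /andP[r0 rt]; have [D1 D2] := sol r r0; split=> //.
  apply/derive_withinP; apply: has_deriv_sub ((derive_withinP _ _ _ _).1 D2).
  by move=> y; rewrite /= in_itv /= => /andP[].
split; last by move=> t /St[/Hbetween].
have zR t : 0 <= t -> region (C Vb) (z t).1 /\ VCC s (z t).2 <= Vbb by move=> /St[].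
apply: (sol_to0 CS bl ftE RegM HVbb _ zR) => t t0.
have [Rt xt] := zR t t0; rewrite (clamped_rhs_E ftE RegM)//.
by apply/derive_withinP; have [] := sol t t0.
Qed.
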